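(* Let $\{X_n\}_{n\ge1}$ be a collection of uniformly bounded, independent, mean-zero random variables on a probability space $\Omega$. Define $$\mathcal{H}_X^{\mathbb{Z},*}f(x):=\sup_{N\ge1}\Bigl|\sum_{n=N}^\infty\frac{X_n}{n}f(x-n)\Bigr|.$$ Then almost surely (for almost every $\omega\in\Omega$) there is a finite constant $C_\omega$, independent of $r$, such that $$\|\mathcal{H}_X^{\mathbb{Z},*}:(1,r)\|\le\frac{C_\omega}{r-1}\qquad\text{for all }1<r<2.$$
   Context: Functions on $\mathbb{Z}$ are complex valued; $\langle f,g\rangle=\sum_{x\in\mathbb{Z}}f(x)\overline{g(x)}$. An interval in $\mathbb{Z}$ is a (nonempty) set $I=[\alpha,\beta]\cap\mathbb{Z}$ with $\alpha,\beta\in\mathbb{R}$, and $|I|$ is its cardinality. For $r\ge1$, $\langle f\rangle_{I,r}:=\bigl(\frac1{|I|}\sum_{x\in I}|f(x)|^r\bigr)^{1/r}$. A collection $\mathcal{S}$ of intervals is sparse if for every $S\in\mathcal{S}$ there is a set $E_S\subset S$ such that the sets $\{E_S:S\in\mathcal{S}\}$ are pairwise disjoint and $|E_S|\ge\frac14|S|$ for all $S\in\mathcal{S}$. For $1\le r,s<\infty$ put $\Lambda_{\mathcal{S},r,s}(f,g):=\sum_{S\in\mathcal{S}}|S|\langle f\rangle_{S,r}\langle g\rangle_{S,s}$. For a (sub)linear operator $T$, $\|T:(r,s)\|$ denotes the smallest constant $B$ such that for all finitely supported $f,g$ on $\mathbb{Z}$, $|\langle Tf,g\rangle|\le B\sup_{\mathcal{S}}\Lambda_{\mathcal{S},r,s}(f,g)$,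 the supremum being over all sparse collections $\mathcal{S}$. *)

(* Defs.v *)
From HB Require Import structures.
From mathcomp Require Import all_boot all_order all_algebra.
From mathcomp Require Import all_classical all_reals all_analysis.
From mathcomp Require Import finmap complex.

Set Implicit Arguments.
Unset Strict Implicit.
Unset Printing Implicit Defensive.

Import Order.TTheory GRing.Theory Num.Theory.
Import numFieldNormedType.Exports.

Local Open Scope classical_set_scope.
Local Open Scope ring_scope.
Local Open Scope complex_scope.

Notation cabs := Normc.normc.

Definition finitely_supported (R : realType) (f : int -> R[i]) : Prop :=
  finite_set [set x | f x != 0].

(* The sum over the set of all integers is a finite sum as soon as one of the
   two functions is finitely supported, which is the only case used below. *)
Definition pairing (R : realType) (f g : int -> R[i]) : R[i] :=
  \sum_(x \in [set: int]) f x * (g x)^*.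

Definition int_interval (R : realType) (I : set int) : Prop :=
  I !=set0 /\ exists a b : R, I = [set x : int | a <= x%:~R <= b].

(* Only meaningful for finite sets (fset_set of an infinite set is empty). *)
Definition int_card (R : realType) (A : set int) : R := (#|` fset_set A|)%:R.

Definition average (R : realType) (r : R) (I : set int) (f : int -> R[i]) : R :=
  ((int_card R I)^-1 * \sum_(x \in I) cabs (f x) `^ r) `^ r^-1.

Definition sparse (R : realType) (S : set (set int)) : Prop :=
  (forall I, S I -> int_interval R I) /\
  exists E : set int -> set int,
    [/\ forall I, S I -> E I `<=` I,
        trivIset S E &
        forall I, S I -> 4^-1 * int_card R I <= int_card R (E I)].

Definition sparse_form (R : realType) (S : set (set int)) (r s : R)
    (f g : int -> R[i]) : \bar R :=
  \esum_(I in S) (int_card R I * average r I f * average s I g)%:E.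

(* The smallest B such that |<T f, g>| <= B * sup_S Lambda_{S,r,s}(f, g) for
   all finitely supported f and g; it is +oo if there is no such real B. *)
Definition sparse_norm (R : realType) (T : (int -> R[i]) -> int -> R[i])
    (r s : R) : \bar R :=
  ereal_inf [set B%:E | B in [set B : R |
    forall f g, finitely_supported f -> finitely_supported g ->
      ((cabs (pairing (T f) g))%:E <=
        B%:E * ereal_sup [set sparse_form S r s f g | S in sparse R])%E]].

(* The inner sum is a limit of partial sums in R[i]; the alias R[i]^o gives
   access to the topology of R[i] induced by its norm. For a finitely supported
   f, the set of which the real supremum is taken has finitely many elements. *)
Definition maximal_hilbert (R : realType) (a : nat -> R) (f : int -> R[i])
    (x : int) : R[i] :=
  (sup [set cabs (\big[+%R/0]_(N <= n <oo)
                   ((a n / n%:R)%:C * f (x - n%:Z) : R[i]^o))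
       | N in [set N : nat | (1 <= N)%N]])%:C.

Definition mutually_independent (I : choiceType) (d : measure_display)
    (T : measurableType d) (R : realType) (P : probability T R)
    (D : set I) (X : I -> {RV P >-> R}) : Prop :=
  forall (J : {fset I}) (A : I -> set R),
    [set` J] `<=` D -> (forall j, measurable (A j)) ->
    P (\bigcap_(j in [set` J]) (X j @^-1` A j)) =
    (\prod_(j <- J) P (X j @^-1` A j))%E.

(* Main.v *)
Require Import Defs.
From HB Require Import structures.
From mathcomp Require Import all_boot all_order all_algebra.
From mathcomp Require Import all_classical all_reals all_analysis.
From mathcomp Require Import complex.
From mathcomp Require Import finmap measurable_realfun.
From mathcomp Require Import zify ring lra.

(** Split the kernel [X n / n] into its dyadic pieces [2 ^ k <= n < 2 ^ k.+1].
    Deterministically, the correlation of the pieces of scales [j <= k], summed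
    over the blocks of length [2 ^ j] of a cell of length [2 ^ k], each block
    with its own translation, is [O(2 ^- j)]. By a Chernoff bound and a union
    bound over the translations and the signs, Borel-Cantelli improves this
    almost surely to [O((rho / 2) ^+ j)] for some [rho < 1]; the rest of the
    proof is deterministic.

    In a dyadic cell, a point [y] with [f y] about [2 ^ lev] times the average
    of [f] is a spike, which acts at the scales [lev + A]. The correlation
    bound makes the spikes of a given [A] almost orthogonal, so that their sum
    has square norm [O(decay ^ A)] times the expected size; the truncations
    [N <= n] chosen at each point cost only a factor polynomial in [A], because
    a truncation selects an initial segment of the spikes ordered by rank
    (Rademacher-Menshov). Splitting [g] at a height geometric in [A] and using
    the trivial bound on the large part of [g], the sum over [A] costs
    [1 / (r - 1)]. The estimate holds above the scales at which [f], [g] or the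
    number of spikes is too large; these stopping cells fill at most a quarter
    of the cell, and recursion into them produces the sparse family. *)
Set Implicit Arguments.
Unset Strict Implicit.
Unset Printing Implicit Defensive.

Import Order.TTheory GRing.Theory Num.Theory.
Import numFieldNormedType.Exports.

Local Open Scope ring_scope.

(** * Rank decomposition of truncated sums *)

(** The Gram estimate keeps in every block of length [2 ^ j] the spike with the worst correlation,
    so the random input must hold for all choices of translations at once. There are about
    [2 ^ ((j + 1) * 2 ^ (k - j))] of them, against a Chernoff exponent of order
    [rho ^ (2 * j) * 2 ^ k], which is [(2 * rho ^ 2) ^ j * 2 ^ (k - j)]: the union bound closes
    because [2 * rho ^ 2 > 1], and [3 / 2] is the value used. The powers of [decay] are a budget,
    with [rho = decay ^ 8]. Half of the square norm [rho ^ A] pays for the polynomial loss in [A],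
    which leaves a norm of order [decay ^ (2 * A)]. Splitting [g] at [decay ^ (- 2 * A)] times its
    mean spends one factor [decay ^ A] on the low part and leaves another. The high part gains only
    [decay ^ (2 * A * (r - 1))]; summing this over [A] is the one source of [1 / (r - 1)]. *)

Lemma sum_Cauchy_Schwarz (R : realFieldType) n (u v : 'I_n -> R) :
  (\sum_i u i * v i) ^+ 2 <= (\sum_i u i ^+ 2) * (\sum_i v i ^+ 2).
Proof.
have -> : (\sum_i u i * v i) ^+ 2 = \sum_i \sum_j (u i * v i) * (u j * v j).
  by rewrite expr2 mulr_suml; apply: eq_bigr => i _; rewrite mulr_sumr.
have E1 : (\sum_i u i ^+ 2) * (\sum_i v i ^+ 2) = \sum_i \sum_j u i ^+ 2 * v j ^+ 2.
  by rewrite mulr_suml; apply: eq_bigr => i _; rewrite mulr_sumr.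
have -> : (\sum_i u i ^+ 2) * (\sum_i v i ^+ 2) =
    \sum_i \sum_j (u i ^+ 2 * v j ^+ 2 + u j ^+ 2 * v i ^+ 2) / 2.
  transitivity ((\sum_i \sum_j u i ^+ 2 * v j ^+ 2 + \sum_i \sum_j u j ^+ 2 * v i ^+ 2) / 2).
    by rewrite [X in _ + X]exchange_big/= -E1; lra.
  rewrite -big_split/= mulr_suml; apply: eq_bigr => i _.
  by rewrite -big_split/= mulr_suml.
apply: ler_sum => i _; apply: ler_sum => j _.
by have := sqr_ge0 (u i * v j - u j * v i); nra.
Qed.

Section RankDecomposition.
Context {R : realFieldType} {I : finType}.

(* [rho] is read in binary: [beta l] is the sum over the block of ranks of
   length [2 ^ l] which the digit [l] of [rho] contributes, or [0]. *)
Lemma rank_decomposition (phi : I -> R) (P : pred I) m (rk : I -> nat) rho :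
  (forall i, P i -> rk i < 2 ^ m)%N ->
  exists beta : nat -> R,
    \sum_(i | P i && (rk i < rho)%N) phi i = \sum_(l < m.+1) beta l /\
    forall l, (l <= m)%N ->
      beta l ^+ 2 <=
      \sum_(c < 2 ^ m) (\sum_(i | P i && (rk i %/ 2 ^ l == c)%N) phi i) ^+ 2.
Proof.
elim: m rk rho => [|m IHm] rk rho rk_lt.
  exists (fun=> \sum_(i | P i && (rk i < rho)%N) phi i).
  split=> [|l]; first by rewrite big_ord1.
  rewrite leqn0 => /eqP->; rewrite big_ord1.
  case: rho => [|rho]; first by rewrite big_pred0 ?expr0n/= ?sqr_ge0// => i; rewrite andbF.
  rewrite [leLHS](_ : _ = (\sum_(i | P i) phi i) ^+ 2).
    rewrite le_eqVlt; apply/orP; left; apply/eqP; congr (_ ^+ 2).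
    apply: eq_bigl => i; case Pi: (P i) => //=.
    by move: (rk_lt i Pi); rewrite expn0 divn1 ltnS leqn0 => /eqP->.
  congr (_ ^+ 2); apply: eq_bigl => i; case Pi: (P i) => //=.
  by move: (rk_lt i Pi); rewrite expn0 ltnS leqn0 => /eqP->.
(* Consecutive ranks are merged in pairs: the ranks below [2 * (rho %/ 2)] are those whose half is
   below [rho %/ 2], and an odd [rho] leaves over the single rank [rho.-1], collected in [top]. *)
have [i Pi|beta [betaE beta_le]] := IHm (fun i => rk i %/ 2)%N (rho %/ 2)%N.
  by rewrite ltn_divLR// -expnSr rk_lt.
pose top := \sum_(i | P i && odd rho && (rk i == rho.-1)) phi i.
exists (fun l => if l is l'.+1 then beta l' else top); split.
  rewrite big_ord_recl -betaE /= (bigID (fun i => odd rho && (rk i == rho.-1))) /=.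
  congr (_ + _); apply: eq_bigl => i; case: (P i) => //=.
    by case: eqP; lia.
  have rhoE : rho = (rho %/ 2 * 2 + odd rho)%N by rewrite {1}(divn_eq rho 2) modn2.
  by have := divn_eq (rk i) 2; have := ltn_mod (rk i) 2; case: (odd rho) rhoE; case: eqP; lia.
case=> [_|l le_lm]; last first.
  apply: le_trans (beta_le l le_lm) _.
  rewrite -(big_mkord xpredT
    (fun c => (\sum_(i | P i && (rk i %/ 2 %/ 2 ^ l == c)%N) phi i) ^+ 2)).
  rewrite -(big_mkord xpredT
    (fun c => (\sum_(i | P i && (rk i %/ 2 ^ l.+1 == c)%N) phi i) ^+ 2)).
  rewrite [leRHS](big_cat_nat (n := (2 ^ m)%N)) ?leq_exp2l//=.
  rewrite ler_wpDr ?sumr_ge0// => [c _|]; first exact: sqr_ge0.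
  apply: ler_sum => c _; rewrite le_eqVlt; apply/orP; left; apply/eqP; congr (_ ^+ 2).
  by apply: eq_bigl => i; rewrite (expnS 2 l) divnMA.
have top0 : ~~ odd rho -> top = 0.
  by move=> /negbTE H; rewrite /top big_pred0// => i; rewrite H andbF.
have [/top0->|odd_rho] := boolP (~~ odd rho).
  by rewrite expr0n sumr_ge0// => c _; exact: sqr_ge0.
(* If [rho] exceeds all ranks, the block of [rho.-1] is outside the range of [c], but it is then
   empty. *)
have [lt_rho|ge_rho] := ltnP rho.-1 (2 ^ m.+1).
  rewrite (bigD1 (Ordinal lt_rho))//= ler_wpDr ?sumr_ge0// => [c _|]; first exact: sqr_ge0.
  rewrite le_eqVlt; apply/orP; left; apply/eqP; congr (_ ^+ 2).
  by apply: eq_bigl => i; rewrite (negbNE odd_rho) andbT divn1.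
rewrite /top big_pred0 => [|i]; first by rewrite expr0n sumr_ge0// => c _; exact: sqr_ge0.
case Pi: (P i) => //=; apply/negbTE; rewrite negb_and; apply/orP; right.
by move: (rk_lt i Pi); case: eqP => //; lia.
Qed.

Lemma sqr_sum_le n (u : 'I_n -> R) :
  (\sum_i u i) ^+ 2 <= n%:R * \sum_i u i ^+ 2.
Proof.
have := sum_Cauchy_Schwarz u (fun=> 1).
under eq_bigr do rewrite mulr1.
by rewrite expr1n sumr_const card_ord mulrC.
Qed.

(** Cauchy-Schwarz over the [m.+1] binary digits. The right side is free of [rho], so that the
    truncation may later vary with the point. *)
Lemma rank_partial_sum (phi : I -> R) (P : pred I) m (rk : I -> nat) rho :
  (forall i, P i -> rk i < 2 ^ m)%N ->
  (\sum_(i | P i && (rk i < rho)%N) phi i) ^+ 2 <=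
  m.+1%:R * \sum_(l < m.+1) \sum_(c < 2 ^ m)
    (\sum_(i | P i && (rk i %/ 2 ^ l == c)%N) phi i) ^+ 2.
Proof.
move=> /(rank_decomposition phi rho)[beta [-> beta_le]].
apply: le_trans (sqr_sum_le _) _; rewrite ler_wpM2l//.
by apply: ler_sum => l _; rewrite beta_le// -ltnS.
Qed.

End RankDecomposition.

(** * Dyadic cells *)

Section Cells.
Context {R : realFieldType}.
Implicit Types (h w : nat -> R) (k K Q T : nat).

Lemma sum_cells h Q D :
  \sum_(x < Q * D) h x = \sum_(q < Q) \sum_(u < D) h (q * D + u)%N.
Proof.
elim: Q => [|Q IHQ]; first by rewrite mul0n !big_ord0.
rewrite big_ord_recr/= -IHQ -(big_mkord xpredT h) -(big_mkord xpredT h).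
rewrite (big_cat_nat (n := (Q * D)%N)) ?leq_mul//=; congr (_ + _).
by rewrite -{1}[(Q * D)%N]add0n mulSn big_addn addnK big_mkord; apply: eq_bigr => u _; rewrite addnC.
Qed.

Lemma cell_index k q (u : 'I_(2 ^ k)) : ((q * 2 ^ k + u) %/ 2 ^ k)%N = q.
Proof. by rewrite divnMDl ?expn_gt0// divn_small ?addn0. Qed.

(** A cell belongs to at most one class [b], so the triangle inequality over cells counts no cell
    twice. In the Gram estimates the classes are the rank blocks, whose number thus costs
    nothing. *)
Lemma sum_norm_cells h k Q B (c : nat -> nat -> bool) (d : pred nat) :
  (forall b x x', (x %/ 2 ^ k = x' %/ 2 ^ k)%N -> c b x = c b x') ->
  (forall b b' x, c b x -> c b' x -> b = b') ->
  (forall b x, c b x -> d (x %/ 2 ^ k)%N) ->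
  \sum_(b < B) `|\sum_(x < Q * 2 ^ k | c b x) h x| <=
  \sum_(q < Q | d q) `|\sum_(u < 2 ^ k) h (q * 2 ^ k + u)%N|.
Proof.
move=> c_cell c_uniq c_d.
pose H q := `|\sum_(u < 2 ^ k) h (q * 2 ^ k + u)%N|.
apply: (@le_trans _ _ (\sum_(b < B) \sum_(q < Q | c b (q * 2 ^ k)%N) H q)).
  apply: ler_sum => b _; rewrite big_mkcond.
  rewrite (sum_cells (fun x => if c b x then h x else 0)).
  rewrite [leRHS]big_mkcond/=; apply: le_trans (ler_norm_sum _ _ _) _.
  apply: ler_sum => q _.
  have cE (u : 'I_(2 ^ k)) : c b (q * 2 ^ k + u)%N = c b (q * 2 ^ k)%N.
    by apply: c_cell; rewrite cell_index mulnK ?expn_gt0.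
  under eq_bigr => u _ do rewrite cE.
  by case: ifP => // _; rewrite big1// normr0.
rewrite (exchange_big_dep (fun q : 'I_Q => d q))/=; last first.
  by move=> b q _ /c_d; rewrite mulnK ?expn_gt0.
apply: ler_sum => q _.
have [b cb|no_b] := pickP (fun b : 'I_B => c b (q * 2 ^ k)%N); last first.
  by rewrite big_pred0// normr_ge0.
rewrite (big_pred1 b)// => b'; apply/idP/eqP => [cb'|->//].
by apply: val_inj; apply: c_uniq cb' cb.
Qed.

Lemma sum_interval_le a L T : \sum_(x < T | (a <= x < a + L)%N) (1 : R) <= L%:R.
Proof.
rewrite -(big_mkord (fun x => a <= x < a + L)%N (fun=> 1)) -big_filter.
rewrite big_const_seq count_predT iter_addr addr0 ler_nat -[leqRHS](size_iota a).
apply: uniq_leq_size; first by rewrite filter_uniq// iota_uniq.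
by move=> x; rewrite mem_filter mem_iota => /andP[].
Qed.

Definition heavy w T (al : R) k r :=
  (al * 2 ^+ k < \sum_(y < T | (y %/ 2 ^ k == r)%N) w y).

(** The kernel looks to the left only, so the points that see a heavy cell are its own and those of
    the next two cells on its right. *)
Definition shadow w T al K p x :=
  [exists k : 'I_K.+1, exists r : 'I_x.+1,
    [&& (r %/ 2 ^ (K - k) == p)%N, (r <= x %/ 2 ^ k <= r.+2)%N & heavy w T al k r]].

(* The dyadic maximal inequality: either the top cell is heavy, or one
   descends to its two halves. *)
Lemma shadow_count w T al K p : (forall y, 0 <= w y) -> 0 <= al ->
  \sum_(x < T | shadow w T al K p x) al <=
  3 * \sum_(y < T | (y %/ 2 ^ K == p)%N) w y.
Proof.
move=> w_ge0 al_ge0.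
have top_heavy K' p' : heavy w T al K' p' ->
    \sum_(x < T | shadow w T al K' p' x) al <=
    3 * \sum_(y < T | (y %/ 2 ^ K' == p')%N) w y.
  rewrite /heavy => hv; apply: (@le_trans _ _ (3 * (al * 2 ^+ K'))); last first.
    by rewrite ler_wpM2l// ltW.
  (* A heavy top cell settles its whole subtree: the shadows of all cells inside it stay within
     three cell lengths of its left end. *)
  apply: (@le_trans _ _ (\sum_(x < T | (p' * 2 ^ K' <= x < p' * 2 ^ K' + 3 * 2 ^ K')%N) al)).
    rewrite [leLHS]big_mkcond [leRHS]big_mkcond/=; apply: ler_sum => x _.
    case: ifP => [/existsP[k /existsP[r /and3P[/eqP r_p /andP[rx xr] _]]]|_]; last by case: ifP.
    suff -> : (p' * 2 ^ K' <= x < p' * 2 ^ K' + 3 * 2 ^ K')%N by [].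
    have KE : (2 ^ K' = 2 ^ (K' - k) * 2 ^ k)%N by rewrite -expnD subnK// -ltnS.
    have pk_gt0 : (0 < 2 ^ k)%N by rewrite expn_gt0.
    have r_lo : (p' * 2 ^ (K' - k) <= r)%N by rewrite -r_p leq_divM.
    have r_hi : (r < p'.+1 * 2 ^ (K' - k))%N by rewrite -r_p ltn_ceil// expn_gt0.
    have x_lo := leq_divM x (2 ^ k); have x_hi := ltn_ceil x pk_gt0.
    have qk_gt0 : (0 < 2 ^ (K' - k))%N by rewrite expn_gt0.
    rewrite KE; apply/andP; split; first by nia.
    by apply: leq_trans x_hi _; nia.
  rewrite (eq_bigr (fun=> al * 1)) => [|x _]; last by rewrite mulr1.
  rewrite -mulr_sumr [leRHS]mulrCA ler_wpM2l//.
  apply: le_trans (sum_interval_le _ _ _) _.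
  by rewrite natrM natrX.
elim: K p => [|K IHK] p.
  have [|nhv] := boolP (heavy w T al 0 p); first exact: top_heavy.
  rewrite big_pred0 ?mulr_ge0 ?sumr_ge0// => x.
  apply/negbTE; apply: contra nhv => /existsP[k /existsP[r /and3P[]]].
  have -> : nat_of_ord k = 0%N by case: k => [[]].
  by rewrite subn0 divn1 => /eqP->.
have [|nhv] := boolP (heavy w T al K.+1 p); first exact: top_heavy.
have cover x : shadow w T al K.+1 p x ->
    shadow w T al K (p * 2)%N x || shadow w T al K (p * 2).+1 x.
  move=> /existsP[k /existsP[r /and3P[/eqP r_p rx hv]]].
  have lt_k : (k < K.+1)%N.
    rewrite ltn_neqAle -ltnS ltn_ord andbT; apply: contra nhv => /eqP kE.
    by move: r_p hv; rewrite kE subnn divn1 => ->.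
  have : (r %/ 2 ^ (K - k) == p * 2)%N || (r %/ 2 ^ (K - k) == (p * 2).+1)%N.
    by move: r_p; rewrite subSn// expnSr divnMA; set z := (r %/ _)%N; lia.
  by case/orP => rE; apply/orP; [left|right]; apply/existsP; exists (Ordinal lt_k);
     apply/existsP; exists r; rewrite /= rE rx.
apply: (@le_trans _ _ (\sum_(x < T | shadow w T al K (p * 2)%N x) al +
   \sum_(x < T | shadow w T al K (p * 2).+1 x) al)).
  rewrite [leLHS]big_mkcond [X in _ <= X + _]big_mkcond [X in _ <= _ + X]big_mkcond/=.
  rewrite -big_split/=; apply: ler_sum => x _.
  have := cover x; case: ifP => [_ /(_ isT)|_ _]; last first.
    by do 2 case: ifP => _; rewrite ?addr0 ?add0r ?addr_ge0.
  by case/orP => ->; case: ifP => _; rewrite ?addr0 ?add0r ?lerDl ?lerDr.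
apply: le_trans (lerD (IHK _) (IHK _)) _; rewrite -mulrDr ler_wpM2l//.
rewrite [X in X + _]big_mkcond [X in _ + X]big_mkcond [leRHS]big_mkcond -big_split/=.
apply: ler_sum => y _; rewrite expnSr divnMA; set z := (y %/ _)%N.
have [->|] := eqVneq z (p * 2)%N; first by rewrite mulnK// eqxx ltn_eqF// addr0.
by move=> ne; have [->|_] := eqVneq z (p * 2).+1; rewrite ?add0r ?addr0; case: eqP => //; lia.
Qed.

End Cells.
Arguments heavy {R} w%_R T%_N al%_R (k r)%_N.
Arguments shadow {R} w%_R T%_N al%_R (K p x)%_N.

(** * Stopping rules *)

(* For [x] in the cell [q] of length [2 ^ k], the points [y < x] with
   [2 ^ k <= x - y < 2 ^ k.+1] are among those of the two cells before [q]. *)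
Definition left_near k q y := (y %/ 2 ^ k < q <= (y %/ 2 ^ k).+2)%N.

Arguments left_near (k q y)%_N.

Lemma lftP k q y : left_near k q y -> (y < q * 2 ^ k)%N /\ (q * 2 ^ k <= y + 2 * 2 ^ k)%N.
Proof.
move=> /andP[lo hi]; have pk : (0 < 2 ^ k)%N by rewrite expn_gt0.
have := leq_divM y (2 ^ k); have := ltn_ceil y pk.
by split; nia.
Qed.

Lemma divn_add2_le a d : (a.+2 %/ d <= (a %/ d).+2)%N.
Proof.
case: d => // d; rewrite -ltnS ltn_divLR//.
by have := ltn_ceil a (ltn0Sn d); set z := (a %/ _)%N; nia.
Qed.

Lemma lft_ancestor k K m x y : (k <= K)%N -> left_near k (x %/ 2 ^ k) y ->
  (x %/ 2 ^ K = m -> y %/ 2 ^ K <= m <= (y %/ 2 ^ K).+2)%N.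
Proof.
move=> /subnK KE /andP[lo hi] <-.
rewrite -KE expnD mulnC !divnMA; move: lo hi.
set a := (y %/ _)%N; set b := (x %/ 2 ^ k)%N => lo hi.
apply/andP; split; first by apply: leq_div2r; lia.
exact: leq_trans (leq_div2r _ hi) (divn_add2_le _ _).
Qed.

Section Stopping.
Context {R : archiRealFieldType} (f G : nat -> R) (K m : nat).
Hypotheses (f_ge0 : forall y, 0 <= f y) (G_ge0 : forall y, 0 <= G y).

Let T := (m.+1 * 2 ^ K)%N.

Definition near_top y := (y %/ 2 ^ K <= m <= (y %/ 2 ^ K).+2)%N.

Definition top_mass := \sum_(y < T | near_top y) f y.

(** The value 96 gives the first stopping rule a sixteenth of the top cell: a shadow costs a factor
    3, and choosing the heavier of two cells halves the height. *)
Definition threshold := 96 * top_mass / 2 ^+ K.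

(** Since [trunc_log 2 0 = 0], level 0 gathers all [y] with [f y < 2 * threshold], and every [y] if
    [threshold = 0], where the quotient is 0. *)
Definition level y := trunc_log 2 (Num.truncn (f y / threshold)).

Definition cell_average := (\sum_(y < T | (y %/ 2 ^ K == m)%N) G y) / 2 ^+ K.

(* The spikes which may act on the cell of [x] with parameter [A], at a scale at
   least [k]. *)
Definition crowding A k x : nat :=
  \sum_(k' < K.+1 | (k <= k')%N)
    \sum_(y < T | left_near k' (x %/ 2 ^ k') y && (level y + A == k')%N) 1.

(** Each of the three rules stops at most a sixteenth of the top cell. The mean crowding is of order
    [2 ^ A]; the limit [4 ^ A] is larger by a factor summable in [A], and only its logarithm will
    enter, through the number of binary digits of a rank. *)
Definition stopping k x :=
  [|| threshold * 2 ^+ k < \sum_(y < T | left_near k (x %/ 2 ^ k) y) f y,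
      heavy G T (48 * cell_average) k (x %/ 2 ^ k) |
      [exists A : 'I_K.+1, (2 ^ 8 * 4 ^ A < crowding A k x)%N] ].

Definition stopped x := (x %/ 2 ^ K == m)%N && [exists k : 'I_K.+1, stopping k x].

Lemma mass_ge0 : 0 <= top_mass. Proof. by apply: sumr_ge0. Qed.

Lemma lam_ge0 : 0 <= threshold.
Proof. by rewrite divr_ge0 ?mulr_ge0 ?mass_ge0 ?exprn_ge0. Qed.

Lemma lam_scale_ge0 k : 0 <= threshold * 2 ^+ k.
Proof. by apply: mulr_ge0; [exact: lam_ge0|exact: exprn_ge0]. Qed.

Lemma avgG_ge0 : 0 <= cell_average.
Proof. by rewrite divr_ge0 ?sumr_ge0 ?exprn_ge0. Qed.

Lemma lev_ge y : 0 < threshold -> f y <= threshold * 2 ^+ (level y).+1.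
Proof.
move=> lam_gt0; rewrite -ler_pdivrMl// mulrC.
apply: le_trans (ltW (truncnS_gt _)) _.
by rewrite -natrX ler_nat /level trunc_log_ltn.
Qed.

Lemma lev_le y : 2 ^+ (level y) <= 1 + f y / threshold.
Proof.
have q_ge0 : 0 <= f y / threshold by rewrite divr_ge0 ?lam_ge0.
rewrite /level; have [->|t_gt0] := posnP (Num.truncn (f y / threshold)).
  by rewrite trunc_log0 expr0 lerDl.
rewrite -natrX; apply: (@le_trans _ _ (Num.truncn (f y / threshold))%:R).
  by rewrite ler_nat trunc_logP.
by rewrite (le_trans (y := f y / threshold)) ?truncn_le// lerDr.
Qed.

Lemma lev_scale y k : f y <= threshold * 2 ^+ k -> (level y <= k)%N.
Proof.
move=> fy; have [lam0|lam_neq0] := eqVneq threshold 0.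
  by rewrite /level lam0 invr0 mulr0 truncn0 trunc_log0.
have lam_gt0 : 0 < threshold by rewrite lt0r lam_neq0; exact: lam_ge0.
have : (Num.truncn (f y / threshold) <= 2 ^ k)%N.
  by rewrite truncn_le_nat (le_lt_trans (y := 2 ^+ k))//
    ?ler_pdivrMr// 1?mulrC// -natrX ltr_nat.
by move=> /(leq_trunc_log 2); rewrite trunc_expnK.
Qed.

Lemma near_top_interval y : near_top y -> ((m - 2) * 2 ^ K <= y < (m - 2) * 2 ^ K + 3 * 2 ^ K)%N.
Proof.
move=> /andP[lo hi]; have pk : (0 < 2 ^ K)%N by rewrite expn_gt0.
have := leq_divM y (2 ^ K); have := ltn_ceil y pk; move: lo hi.
set q := (y %/ _)%N => lo hi y_hi y_lo.
have : (m - 2 <= q)%N by lia.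
by nia.
Qed.

Lemma sum_f_lft k x : (k <= K)%N -> (x %/ 2 ^ K = m)%N ->
  \sum_(y < T | left_near k (x %/ 2 ^ k) y) f y <= top_mass.
Proof.
move=> kK xm; rewrite /top_mass [leLHS]big_mkcond [leRHS]big_mkcond/=.
apply: ler_sum => y _; case: ifP => [/(lft_ancestor kK)/(_ xm)|_].
  by rewrite -/(near_top y) => ->.
by case: ifP.
Qed.

Lemma stop_f_count :
  \sum_(x < T | [exists k : 'I_K.+1, (x %/ 2 ^ K == m)%N &&
      (threshold * 2 ^+ k < \sum_(y < T | left_near k (x %/ 2 ^ k) y) f y)]) (1 : R) <= 2 ^+ K / 16.
Proof.
have [M0|M_neq0] := eqVneq top_mass 0.
  rewrite big_pred0 ?divr_ge0 ?exprn_ge0// => x.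
  apply/existsP => -[k /andP[/eqP xm]]; rewrite ltNge; apply/negP.
  by rewrite (le_trans (sum_f_lft (leq_ord k) xm))// M0 lam_scale_ge0.
have M_gt0 : 0 < top_mass by rewrite lt0r M_neq0; exact: mass_ge0.
have pK : (0 : R) < 2 ^+ K by rewrite exprn_gt0.
have lam_gt0 : 0 < threshold by rewrite divr_gt0// mulr_gt0.
have cover (x : 'I_T) k : (k <= K)%N -> (x %/ 2 ^ K = m)%N ->
    threshold * 2 ^+ k < \sum_(y < T | left_near k (x %/ 2 ^ k) y) f y ->
    exists p : 'I_m.+1, (m <= p.+2)%N && shadow f T (threshold / 2) K p x.
  move=> kK xm hv.
  (* One of the two cells to the left of [x] holds more than half of the mass: it is heavy at height
     [threshold / 2] and [x] lies in its shadow. *)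
  have [r r_x hr] : exists2 r, (r < x %/ 2 ^ k <= r.+2)%N & heavy f T (threshold / 2) k r.
    apply: contrapT => none.
    have light (r : nat) : (r < x %/ 2 ^ k <= r.+2)%N ->
        \sum_(y < T | (y %/ 2 ^ k == r)%N) f y <= threshold / 2 * 2 ^+ k.
      by move=> r_x; rewrite leNgt; apply/negP => ?; apply: none; exists r.
    move: hv; rewrite ltNge => /negP; apply.
    case q_def : (x %/ 2 ^ k)%N light => [|q] light.
      by rewrite big_pred0 ?lam_scale_ge0// => y; rewrite /left_near ltn0.
    apply: (@le_trans _ _ (\sum_(y < T | (y %/ 2 ^ k == q)%N) f y +
       (if q is q'.+1 then \sum_(y < T | (y %/ 2 ^ k == q')%N) f y else 0))).
      case: q {q_def light} => [|q].
        rewrite addr0 [leLHS]big_mkcond [leRHS]big_mkcond/=; apply: ler_sum => y _.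
        rewrite /left_near; case: ifP => [yq|_]; last by case: ifP.
        have [_|ne1] := eqVneq (y %/ 2 ^ k)%N 0%N; first by [].
        by move: yq ne1; set z := (_ %/ _)%N; lia.
      rewrite [leLHS]big_mkcond [X in X + _]big_mkcond [X in _ + X]big_mkcond -big_split/=.
      apply: ler_sum => y _; rewrite /left_near.
      case: ifP => [yq|_]; last by do 2 case: ifP => _; rewrite ?addr0 ?add0r ?addr_ge0.
      have [_|ne1] := eqVneq (y %/ 2 ^ k)%N q.+1; first by rewrite lerDl; case: ifP.
      have [_|ne2] := eqVneq (y %/ 2 ^ k)%N q; first by rewrite add0r.
      by move: yq ne1 ne2; set z := (_ %/ _)%N; lia.
    have half : threshold * 2 ^+ k = threshold / 2 * 2 ^+ k + threshold / 2 * 2 ^+ k by lra.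
    rewrite half; apply: lerD; first by apply: light; lia.
    case: q {q_def} light => [|q] light; last by apply: light; lia.
    by have := lam_scale_ge0 k; lra.
  have rE : (r <= x %/ 2 ^ k)%N by lia.
  have xE : (x %/ 2 ^ K = x %/ 2 ^ k %/ 2 ^ (K - k))%N by rewrite -divnMA -expnD subnKC.
  have p_le : (r %/ 2 ^ (K - k) <= m)%N by rewrite -xm xE leq_div2r.
  have p_ge : (m <= (r %/ 2 ^ (K - k)).+2)%N.
    rewrite -xm xE; apply: (@leq_trans (r.+2 %/ 2 ^ (K - k))); last exact: divn_add2_le.
    by apply: leq_div2r; lia.
  have r_lt : (r < x.+1)%N by rewrite ltnS (leq_trans rE)// leq_div.
  exists (Ordinal (p_le : r %/ 2 ^ (K - k) < m.+1)%N) => /=; rewrite p_ge/=.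
  apply/existsP; exists (Ordinal (kK : k < K.+1)%N); apply/existsP.
  by exists (Ordinal r_lt) => /=; rewrite eqxx hr andbT; lia.
have l2_gt0 : 0 < threshold / 2 by lra.
rewrite -(ler_pM2l l2_gt0).
rewrite mulr_sumr; apply: (@le_trans _ _ (\sum_(p < m.+1 | (m <= p.+2)%N)
    \sum_(x < T | shadow f T (threshold / 2) K p x) (threshold / 2))).
  rewrite (exchange_big_dep xpredT)//= [leLHS]big_mkcond; apply: ler_sum => x _.
  have l2 := ltW l2_gt0.
  case: ifP => [|_]; last by apply: sumr_ge0.
  move=> /existsP[k /andP[/eqP xm hv]].
  have [p hp] := cover x k (leq_ord k) xm hv.
  by rewrite mulr1 (bigD1 p)//= lerDl sumr_ge0.
apply: (@le_trans _ _ (\sum_(p < m.+1 | (m <= p.+2)%N)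
    3 * \sum_(y < T | (y %/ 2 ^ K == p)%N) f y)).
  apply: ler_sum => p _; apply: shadow_count => //.
  by have := lam_ge0; lra.
rewrite -mulr_sumr (exchange_big_dep (fun y : 'I_T => near_top y))/=; last first.
  by move=> p y pm /eqP yp; rewrite /near_top yp pm -ltnS ltn_ord.
apply: (@le_trans _ _ (3 * top_mass)).
  rewrite ler_wpM2l//; apply: ler_sum => y ny.
  rewrite (eq_bigl (fun p : 'I_m.+1 => (p == inord (y %/ 2 ^ K))%N)).
    by rewrite big_pred1_eq.
  move=> p; apply/andP/eqP => [[_ /eqP ->]|->]; first by rewrite inord_val.
  by case/andP: ny => lo hi; rewrite inordK ?ltnS.
by rewrite le_eqVlt; apply/orP; left; apply/eqP; rewrite /threshold; field; rewrite gt_eqF.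
Qed.

Lemma stop_g_count :
  \sum_(x < T | [exists k : 'I_K.+1, (x %/ 2 ^ K == m)%N &&
      heavy G T (48 * cell_average) k (x %/ 2 ^ k)]) (1 : R) <= 2 ^+ K / 16.
Proof.
have pK : (0 : R) < 2 ^+ K by rewrite exprn_gt0.
have [avg0|avg_neq0] := eqVneq cell_average 0.
  rewrite big_pred0 ?divr_ge0 ?exprn_ge0// => x.
  apply/existsP => -[k /andP[/eqP xm]].
  rewrite /heavy avg0 mulr0 mul0r ltNge; apply/negP/negPn.
  have S0 : \sum_(y < T | (y %/ 2 ^ K == m)%N) G y = 0.
    by move: avg0 => /eqP; rewrite /cell_average mulf_eq0 invr_eq0 (gt_eqF pK) orbF => /eqP.
  rewrite -[leRHS]S0 [leLHS]big_mkcond [leRHS]big_mkcond/=.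
  apply: ler_sum => y _; case: eqP => [yx|_]; last by case: ifP.
  have -> // : (y %/ 2 ^ K == m)%N.
  by rewrite -(subnKC (leq_ord k)) expnD divnMA yx -divnMA -expnD subnKC ?leq_ord// xm.
have avg_gt0 : 0 < cell_average by rewrite lt0r avg_neq0; exact: avgG_ge0.
have al_gt0 : 0 < 48 * cell_average by lra.
rewrite -(ler_pM2l al_gt0) mulr_sumr.
apply: (@le_trans _ _ (\sum_(x < T | shadow G T (48 * cell_average) K m x) 48 * cell_average)).
  rewrite [leLHS]big_mkcond [leRHS]big_mkcond/=; apply: ler_sum => x _.
  case: ifP => [/existsP[k /andP[/eqP xm hv]]|_]; last by case: ifP; lra.
  suff -> : shadow G T (48 * cell_average) K m x by rewrite mulr1.
  apply/existsP; exists k; apply/existsP.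
  have q_lt : (x %/ 2 ^ k < x.+1)%N by rewrite ltnS leq_div.
  exists (Ordinal q_lt) => /=; rewrite hv leqnn leqW//= andbT.
  by rewrite -divnMA -expnD subnKC ?leq_ord// xm.
apply: (le_trans (shadow_count T K m G_ge0 (ltW al_gt0))).
by rewrite le_eqVlt; apply/orP; left; apply/eqP; rewrite /cell_average; field; rewrite gt_eqF.
Qed.

(** The points near the top cell fill at most three cells, and the excess of [2 ^+ level y] over 1
    is paid by the mass of [f], worth at most [2 ^+ K / 96]. *)
Lemma sum_lev : \sum_(y < T | near_top y) 2 ^+ (level y) <= 4 * 2 ^+ K :> R.
Proof.
apply: (@le_trans _ _ (\sum_(y < T | near_top y) (1 + f y / threshold))).
  by apply: ler_sum => y _; exact: lev_le.
rewrite big_split/= -mulr_suml -/top_mass.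
have pK : (0 : R) < 2 ^+ K by rewrite exprn_gt0.
have -> : 4 * 2 ^+ K = 3 * 2 ^+ K + 2 ^+ K :> R by ring.
apply: lerD.
  rewrite -natrX -natrM.
  apply: le_trans (sum_interval_le ((m - 2) * 2 ^ K) _ T).
  rewrite [leLHS]big_mkcond [leRHS]big_mkcond/=; apply: ler_sum => y _.
  by case: ifP => [/near_top_interval->//|_]; case: ifP.
have [M0|M_neq0] := eqVneq top_mass 0; first by rewrite M0 mul0r ltW.
by rewrite /threshold; rewrite (_ : _ / _ = 2 ^+ K / 96); [lra|field; rewrite gt_eqF//= M_neq0].
Qed.

(** A spike of scale [k = level y + A] is seen from at most two cells of length [2 ^ k], that is
    from [2 * 2 ^+ A * 2 ^+ level y] points. *)
Lemma sum_cnt A :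
  \sum_(x < T | (x %/ 2 ^ K == m)%N) (crowding A 0 x)%:R <= 2 ^+ A * (8 * 2 ^+ K) :> R.
Proof.
have cntE x : (crowding A 0 x)%:R = \sum_(k < K.+1)
    \sum_(y < T | (level y + A == k)%N && left_near k (x %/ 2 ^ k) y) (1 : R).
  rewrite /crowding natr_sum; apply: eq_bigr => k _; rewrite natr_sum.
  by apply: eq_bigl => y; rewrite andbC.
under eq_bigr do rewrite cntE.
rewrite exchange_big/=.
apply: (@le_trans _ _ (\sum_(k < K.+1) \sum_(y < T | near_top y && (level y + A == k)%N)
    2 * 2 ^+ k)).
  apply: ler_sum => k _.
  rewrite (exchange_big_dep (fun y : 'I_T => near_top y && (level y + A == k)%N))/=; last first.
    move=> x y /eqP xm /andP[-> l]; rewrite andbT.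
    exact: lft_ancestor (leq_ord k) l xm.
  apply: ler_sum => y _; rewrite -natrX -natrM.
  apply: le_trans (sum_interval_le ((y %/ 2 ^ k).+1 * 2 ^ k) _ T).
  rewrite [leLHS]big_mkcond [leRHS]big_mkcond/=; apply: ler_sum => x _.
  case: ifP => [/and3P[_ _ /andP[lo hi]]|_]; last by case: ifP.
  suff -> : ((y %/ 2 ^ k).+1 * 2 ^ k <= x < (y %/ 2 ^ k).+1 * 2 ^ k + 2 * 2 ^ k)%N by [].
  have pk : (0 < 2 ^ k)%N by rewrite expn_gt0.
  have := leq_divM x (2 ^ k); have := ltn_ceil x pk; move: lo hi.
  by set a := (y %/ _)%N; set b := (x %/ _)%N; nia.
have -> : 2 ^+ A * (8 * 2 ^+ K) = 2 * 2 ^+ A * (4 * 2 ^+ K) :> R by ring.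
apply: (le_trans _ (ler_wpM2l _ sum_lev)); last by rewrite mulr_ge0 ?exprn_ge0.
rewrite mulr_sumr (exchange_big_dep (fun y : 'I_T => near_top y))/=; last by move=> k y _ /andP[].
apply: ler_sum => y ny.
rewrite (eq_bigl (fun k : 'I_K.+1 => (level y + A == k)%N)); last by move=> k; rewrite ny.
have [le_K|gt_K] := ltnP (level y + A) K.+1.
  rewrite (big_pred1 (Ordinal le_K)) => [|k]; first by rewrite exprD -!mulrA [_ ^+ A * _]mulrC.
  by rewrite /= eq_sym.
rewrite big_pred0 => [|k]; first by rewrite !mulr_ge0 ?exprn_ge0.
by apply/negbTE; rewrite neq_ltn orbC (leq_trans (ltn_ord k)).
Qed.

Lemma cnt_anti A k x : (crowding A k x <= crowding A 0 x)%N.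
Proof.
rewrite /crowding [leqLHS]big_mkcond [leqRHS]big_mkcond/=.
by apply: leq_sum => k' _; case: ifP.
Qed.

Lemma stop_cnt_count :
  \sum_(x < T | [exists k : 'I_K.+1, (x %/ 2 ^ K == m)%N &&
      [exists A : 'I_K.+1, (2 ^ 8 * 4 ^ A < crowding A k x)%N]]) (1 : R) <= 2 ^+ K / 16.
Proof.
(* Chebyshev for each [A]: the fractions [2 ^- A / 32] of the cell sum to at most a sixteenth. *)
apply: (@le_trans _ _ (\sum_(A < K.+1) \sum_(x < T | (x %/ 2 ^ K == m)%N)
    (crowding A 0 x)%:R / (2 ^+ 8 * 4 ^+ A))).
  rewrite exchange_big/= [leLHS]big_mkcond [leRHS]big_mkcond/=; apply: ler_sum => x _.
  have t_ge0 (A : 'I_K.+1) : 0 <= (crowding A 0 x)%:R / (2 ^+ 8 * 4 ^+ A) :> R.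
    by rewrite divr_ge0// mulr_ge0// exprn_ge0.
  case: ifP => [/existsP[k /andP[-> /existsP[A hA]]]|_]; last first.
    by case: ifP => // _; exact: sumr_ge0.
  rewrite (bigD1 A)//= ler_wpDr ?sumr_ge0//.
  rewrite ler_pdivlMr ?mulr_gt0 ?exprn_gt0// mul1r -!natrX -natrM ler_nat.
  exact: leq_trans (ltnW hA) (cnt_anti _ _ _).
apply: (@le_trans _ _ (\sum_(A < K.+1) 2 ^- A * (2 ^+ K / 32))).
  apply: ler_sum => A _; rewrite -mulr_suml.
  apply: le_trans (ler_wpM2r _ (sum_cnt A)) _; first by rewrite invr_ge0 mulr_ge0 ?exprn_ge0.
  have -> : 4 ^+ A = 2 ^+ A * 2 ^+ A :> R by rewrite -exprMn; congr (_ ^+ _); ring.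
  rewrite le_eqVlt; apply/orP; left; apply/eqP; field.
  by rewrite expf_neq0 ?pnatr_eq0.
rewrite -mulr_suml.
have geo n : \sum_(A < n) 2 ^- A <= 2 - 2 * 2 ^- n :> R.
  elim: n => [|n IHn]; first by rewrite big_ord0 expr0 invr1; lra.
  rewrite big_ord_recr/= exprS invfM; lra.
have pK : (0 : R) < 2 ^+ K by rewrite exprn_gt0.
have q : (0 : R) < 2 ^- K.+1 by rewrite invr_gt0 exprn_gt0.
by have := geo K.+1; nra.
Qed.

Lemma stopped_count : \sum_(x < T | stopped x) (1 : R) <= 2 ^+ K / 4.
Proof.
have pK : (0 : R) < 2 ^+ K by rewrite exprn_gt0.
apply: (@le_trans _ _ (2 ^+ K / 16 + 2 ^+ K / 16 + 2 ^+ K / 16)); last by lra.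
apply: le_trans (lerD (lerD stop_f_count stop_g_count) stop_cnt_count).
rewrite [leLHS]big_mkcond [X in X + _ + _]big_mkcond [X in _ + X + _]big_mkcond
  [X in _ + _ + X]big_mkcond -!big_split/=; apply: ler_sum => x _.
case: ifP => [/andP[xm /existsP[k /or3P[]]]|_]; last first.
- by do 3 case: ifP => _; rewrite ?addr0 ?add0r ?ler01 ?addr_ge0.
- move=> h; rewrite [X in _ <= _ + X](_ : _ = 1).
    by do 2 case: ifP => _; lra.
  by have -> // : [exists k : 'I_K.+1, (x %/ 2 ^ K == m)%N &&
     [exists A : 'I_K.+1, (2 ^ 8 * 4 ^ A < crowding A k x)%N]] by apply/existsP; exists k; rewrite xm.
- move=> h; rewrite [X in _ <= _ + X + _](_ : _ = 1).
    by do 2 case: ifP => _; lra.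
  by have -> // : [exists k : 'I_K.+1, (x %/ 2 ^ K == m)%N &&
      heavy G T (48 * cell_average) k (x %/ 2 ^ k)] by apply/existsP; exists k; rewrite xm.
- move=> h; rewrite [X in _ <= X + _ + _](_ : _ = 1).
    by do 2 case: ifP => _; lra.
  by have -> // : [exists k : 'I_K.+1, (x %/ 2 ^ K == m)%N &&
      (threshold * 2 ^+ k < \sum_(y < T | left_near k (x %/ 2 ^ k) y) f y)] by apply/existsP; exists k; rewrite xm.
Qed.

End Stopping.

(** * Dyadic pieces of the kernel *)

Section Kernel.
Context {R : realFieldType} (b : nat -> R).

Definition kern k n := if (2 ^ k <= n < 2 ^ k.+1)%N then b n else 0.

(** The condition on [t] makes the first index of each product smaller than the second, so that no
    square of a variable occurs. Bounding term by term gives the case [rho = 1]. *)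
Definition correlation_decay (C0 rho : R) :=
  forall j k delta (t : nat -> nat), (j <= k)%N ->
  (forall i, t i < delta + i * 2 ^ j)%N ->
  \sum_(i < 2 ^ (k - j)) `|\sum_(u < 2 ^ j)
     kern j (t i + u)%N * kern k (delta + i * 2 ^ j + u)%N| <= C0 * (rho / 2) ^+ j.

Lemma sum_one_cell (F : nat -> R) n p D : (0 < D)%N -> (forall q, 0 <= F q) ->
  \sum_(q < n | (q %/ D == p)%N) F q <= \sum_(i < D) F (p * D + i)%N.
Proof.
(* The cell [p] may stick out of the range; a longer range contains all of it. *)
move=> D_gt0 F_ge0.
have le_n : (n <= (n + p.+1) * D)%N by nia.
apply: (@le_trans _ _ (\sum_(q < (n + p.+1) * D | (q %/ D == p)%N) F q)).
  rewrite -(big_mkord (fun q => (q %/ D == p)%N)) -(big_mkord (fun q => (q %/ D == p)%N)).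
  by rewrite [leRHS](big_cat_nat (n := n))//= lerDl sumr_ge0.
rewrite big_mkcond (sum_cells (fun q => if (q %/ D == p)%N then F q else 0)).
have p_lt : (p < n + p.+1)%N by lia.
rewrite (bigD1 (Ordinal p_lt))//= [X in _ + X]big1 ?addr0 => [|r /negP r_p].
  by apply: ler_sum => i _; case: ifP.
rewrite big1// => u _; rewrite divnMDl// divn_small// addn0; case: eqP => // rp.
by case: r_p; apply/eqP/val_inj.
Qed.

Lemma sum_two_cells (F : nat -> R) n c D : (0 < D)%N -> (forall q, 0 <= F q) ->
  \sum_(q < n | (c < q %/ D <= c.+2)%N) F q <=
  \sum_(i < D) F (c.+1 * D + i)%N + \sum_(i < D) F (c.+2 * D + i)%N.
Proof.
move=> D_gt0 F_ge0.
apply: le_trans (lerD (sum_one_cell n _ D_gt0 F_ge0) (sum_one_cell n _ D_gt0 F_ge0)).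
rewrite [leLHS]big_mkcond [X in X + _]big_mkcond [X in _ + X]big_mkcond -big_split/=.
apply: ler_sum => q _; case: ifP => [cq|_]; last by do 2 case: ifP => _; rewrite ?addr0 ?add0r ?addr_ge0.
have [_|ne1] := eqVneq (q %/ D)%N c.+1; first by rewrite lerDl; case: ifP.
have [_|ne2] := eqVneq (q %/ D)%N c.+2; first by rewrite add0r.
by move: cq ne1 ne2; set z := (_ %/ _)%N; lia.
Qed.

Context (M C0 rho : R).
Hypothesis kern_bound : forall k n, `|kern k n| <= M / 2 ^+ k.
Hypothesis correlation : correlation_decay C0 rho.

(** At most two cells of length [2 ^ k] see [y0], hence the factor 2. Inside one of them [delta] is
    the distance of its left end to [y0], [t i] that of the block to its own spike [ys q], and
    [y0 < ys q] orders the two indices. *)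
Lemma correlation_cells j k y0 n (ys : nat -> nat) : (j <= k)%N ->
  \sum_(q < n | left_near k (q %/ 2 ^ (k - j)) y0 && (y0 < ys q < q * 2 ^ j)%N)
    `|\sum_(u < 2 ^ j) kern j (q * 2 ^ j + u - ys q)%N * kern k (q * 2 ^ j + u - y0)%N|
  <= 2 * C0 * (rho / 2) ^+ j.
Proof.
move=> jk.
pose Z q := if (y0 < ys q < q * 2 ^ j)%N then
  `|\sum_(u < 2 ^ j) kern j (q * 2 ^ j + u - ys q)%N * kern k (q * 2 ^ j + u - y0)%N| else 0.
have Z_ge0 q : 0 <= Z q by rewrite /Z; case: ifP.
have D_gt0 : (0 < 2 ^ (k - j))%N by rewrite expn_gt0.
have block p : (y0 < p * 2 ^ k)%N ->
    \sum_(i < 2 ^ (k - j)) Z (p * 2 ^ (k - j) + i)%N <= C0 * (rho / 2) ^+ j.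
  move=> y0p.
  pose t i := let q := (p * 2 ^ (k - j) + i)%N in
    if (y0 < ys q < q * 2 ^ j)%N then (q * 2 ^ j - ys q)%N else 0%N.
  have qE i : ((p * 2 ^ (k - j) + i) * 2 ^ j = p * 2 ^ k + i * 2 ^ j)%N.
    by rewrite mulnDl -mulnA -expnD subnK.
  have t_lt i : (t i < (p * 2 ^ k - y0) + i * 2 ^ j)%N.
    rewrite /t qE; case: ifP; last by lia.
    by move: y0p; set u := (p * 2 ^ k)%N; set v := (i * 2 ^ j)%N; lia.
  apply: le_trans (correlation jk t_lt); apply: ler_sum => i _.
  rewrite /Z /t; case: ifP => [ok|_]; last by [].
  rewrite le_eqVlt; apply/orP; left; apply/eqP; congr `|_|; apply: eq_bigr => u _.
  rewrite qE; move: ok y0p; rewrite qE.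
  set x := (p * 2 ^ k)%N; set v := (i * 2 ^ j)%N; set y := ys _ => ok y0p.
  by congr (kern _ _ * kern _ _); lia.
apply: (@le_trans _ _ (\sum_(q < n | (y0 %/ 2 ^ k < q %/ 2 ^ (k - j) <= (y0 %/ 2 ^ k).+2)%N) Z q)).
  rewrite [leLHS]big_mkcond [leRHS]big_mkcond/=; apply: ler_sum => q _.
  case: ifP => [/andP[l ok]|_]; last by case: ifP.
  by move: l; rewrite /left_near => ->; rewrite /Z ok.
apply: le_trans (sum_two_cells n _ D_gt0 Z_ge0) _.
have y_lt := ltn_ceil y0 (_ : 0 < 2 ^ k)%N; rewrite -mulrA mulr_natl mulr2n.
by apply: lerD; apply: block; have := y_lt (expn_gt0 _ _); set z := (y0 %/ _)%N; nia.
Qed.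

End Kernel.

(** * Square function of the active spikes *)

Section Local.
Context {R : archiRealFieldType} (f G : nat -> R) (K m : nat).
Hypotheses (f_ge0 : forall y, 0 <= f y) (G_ge0 : forall y, 0 <= G y).

Let T := (m.+1 * 2 ^ K)%N.
Let lev := level f K m.
Let stop := stopping f G K m.
Let lam := threshold f K m.
Let mass := top_mass f K m.
Let cnt := crowding f K m.

Lemma divn_cell k k' x x' : (k <= k' -> x %/ 2 ^ k = x' %/ 2 ^ k ->
  x %/ 2 ^ k' = x' %/ 2 ^ k')%N.
Proof. by move=> /subnKC <- xx'; rewrite expnD !divnMA xx'. Qed.

Lemma stop_cell k x x' : (x %/ 2 ^ k = x' %/ 2 ^ k)%N -> stop k x = stop k x'.
Proof.
move=> xx'; rewrite /stop /stopping xx'; congr [|| _, _ | _]; apply: eq_existsb => A.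
congr (_ < _)%N; apply: eq_bigr => k' kk'.
by rewrite (divn_cell kk' xx').
Qed.

(* [0] if no scale stops at [x], and otherwise the successor of the largest
   scale which does. *)
Definition exit_scale x := \max_(k < K.+1 | stop k x) k.+1.

Lemma exit_scale_le k x : (exit_scale x <= k)%N = [forall k' : 'I_K.+1, (k <= k')%N ==> ~~ stop k' x].
Proof.
apply/bigmax_leqP/forallP => [H k'|H k' st].
  by apply/implyP => kk'; apply/negP => /H; lia.
by move: (H k'); case: leqP => //=; rewrite st.
Qed.

Lemma exit_scale_cell k x x' : (x %/ 2 ^ k = x' %/ 2 ^ k)%N -> (exit_scale x <= k)%N = (exit_scale x' <= k)%N.
Proof.
move=> xx'; rewrite !exit_scale_le; apply: eq_forallb => k'.
by case: leqP => //= kk'; rewrite (stop_cell (divn_cell kk' xx')).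
Qed.

Lemma not_stop_f k x : (exit_scale x <= k <= K)%N ->
  \sum_(y < T | left_near k (x %/ 2 ^ k) y) f y <= lam * 2 ^+ k.
Proof.
case/andP; rewrite exit_scale_le => /forallP H kK.
move: (H (Ordinal (kK : k < K.+1)%N)); rewrite /= leqnn /= /stop /stopping.
by rewrite !negb_or -leNgt => /andP[].
Qed.

Lemma not_stop_g k x : (exit_scale x <= k <= K)%N ->
  \sum_(y < T | (y %/ 2 ^ k == x %/ 2 ^ k)%N) G y <= 48 * cell_average G K m * 2 ^+ k.
Proof.
case/andP; rewrite exit_scale_le => /forallP H kK.
move: (H (Ordinal (kK : k < K.+1)%N)); rewrite /= leqnn /= /stop /stopping.
by rewrite !negb_or => /and3P[_]; rewrite -leNgt.
Qed.

Lemma not_stop_cnt k x A : (exit_scale x <= k <= K)%N -> (A <= K)%N -> (cnt A k x <= 2 ^ 8 * 4 ^ A)%N.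
Proof.
case/andP; rewrite exit_scale_le => /forallP H kK AK.
move: (H (Ordinal (kK : k < K.+1)%N)); rewrite /= leqnn /= /stop /stopping.
rewrite !negb_or => /and3P[_ _]; rewrite negb_exists => /forallP/(_ (Ordinal (AK : A < K.+1)%N)).
by rewrite -leqNgt.
Qed.

(* Since the scale of [x - y] is [lev y + A], each spike [y] acts on two
   dyadic cells only. *)
Definition active A x y := [&& (x %/ 2 ^ K == m)%N, (y < x)%N,
  (exit_scale x <= lev y + A <= K)%N & (2 ^ (lev y + A) <= x - y < 2 ^ (lev y + A).+1)%N].

Lemma scale_lft k x y : (y < x)%N -> (2 ^ k <= x - y < 2 ^ k.+1)%N -> left_near k (x %/ 2 ^ k) y.
Proof.
move=> yx /andP[lo hi].
have pk : (0 < 2 ^ k)%N by rewrite expn_gt0.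
rewrite /left_near; move: lo hi; rewrite expnS.
have := leq_divM x (2 ^ k); have := ltn_ceil x pk.
have := leq_divM y (2 ^ k); have := ltn_ceil y pk.
set q := (x %/ _)%N; set p := (y %/ _)%N; move: yx pk; set d := (2 ^ k)%N.
move=> yx pk y1 y2 x1 x2 lo hi.
apply/andP; split; first by rewrite ltnNge; apply/negP => ?; nia.
by rewrite leqNgt; apply/negP => ?; nia.
Qed.

Lemma active_lft A x y : active A x y -> left_near (lev y + A) (x %/ 2 ^ (lev y + A)) y.
Proof.
by case/and4P => _ yx _; exact: scale_lft.
Qed.

Lemma active_near A x y : active A x y -> near_top K m y.
Proof.
move=> a; have := active_lft a; case/and4P: a => /eqP xm _ /andP[_ kK] _ l.
exact: lft_ancestor kK l xm.
Qed.

Lemma active_T A x y : active A x y -> (y < T)%N.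
Proof.
case/and4P => /eqP xm yx _ _; rewrite (ltn_trans yx)// /T -xm.
by rewrite ltn_ceil// expn_gt0.
Qed.

Lemma live_f k x y : (exit_scale x <= k <= K)%N -> left_near k (x %/ 2 ^ k) y -> (y < T)%N ->
  f y <= lam * 2 ^+ k.
Proof.
move=> live l yT; apply: le_trans (not_stop_f live).
by rewrite (bigD1 (Ordinal yT))//= lerDl sumr_ge0.
Qed.

Lemma near_f y : near_top K m y -> (y < T)%N -> f y <= lam * 2 ^+ (lev y).+1.
Proof.
move=> ny yT; have [lam_gt0|] := ltP 0 lam; first exact: lev_ge.
move=> lam_le0; have lam0 : lam = 0 by apply: le_anti; rewrite lam_le0; exact: lam_ge0.
rewrite lam0 mul0r; have -> // : f y <= 0.
have : mass = 0.
  move/eqP: lam0; rewrite /lam /threshold mulf_eq0 invr_eq0 expf_eq0 mulf_eq0 !pnatr_eq0/= andbF orbF.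
  by move/eqP.
by move=> <-; rewrite /mass /top_mass (bigD1 (Ordinal yT))//= lerDl sumr_ge0.
Qed.

(** Spikes are ordered by decreasing scale, then from left to right. Membership is tested by
    [left_near] and not by [active], so that the rank is constant on the cells of length
    [2 ^ (lev y + A)] and the Gram sums split along cells. *)
Definition rank_set A x k y := [set p : 'I_K.+1 * 'I_T |
  [&& left_near p.1 (x %/ 2 ^ p.1) p.2, (lev p.2 + A == p.1)%N &
      (k < p.1) || ((k == p.1) && (p.2 < y))]%N]%SET.

Definition spike_rank A x y := #|rank_set A x (lev y + A) y|.

Lemma spike_rank_cell A x x' y : (x %/ 2 ^ (lev y + A) = x' %/ 2 ^ (lev y + A))%N ->
  spike_rank A x y = spike_rank A x' y.
Proof.
move=> xx'; apply: eq_card => p; rewrite !inE.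
case: (boolP ((lev y + A < p.1) || _)%N) => [le_p|_]; last by rewrite !andbF.
by rewrite (divn_cell _ xx')//; case/orP: le_p => [/ltnW//|/andP[/eqP->]].
Qed.

Lemma active_ordinals A x y : active A x y -> {p : 'I_K.+1 * 'I_T |
  [/\ p.1 = (lev y + A)%N :> nat, p.2 = y :> nat & left_near p.1 (x %/ 2 ^ p.1) p.2]}.
Proof.
move=> a; have yT := active_T a; have l := active_lft a.
case/and4P: a => _ _ /andP[_ kK] _.
by exists (Ordinal (kK : _ < K.+1)%N, Ordinal yT).
Qed.

(** The rule on crowding does not stop [x] at the scale of [y]. The crowding counts [y] itself and
    the rank does not, hence the strict inequality. *)
Lemma spike_rank_lt A x y : active A x y -> (spike_rank A x y < 2 ^ (8 + 2 * A))%N.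
Proof.
move=> a; have [p [p1 p2 lp]] := active_ordinals a.
have /and4P[_ _ live _] := a.
have AK : (A <= K)%N by case/andP: live; lia.
rewrite expnD expnM; apply: leq_trans (not_stop_cnt live AK).
have -> : cnt A (lev y + A) x = #|[set p : 'I_K.+1 * 'I_T |
    [&& lev y + A <= p.1, left_near p.1 (x %/ 2 ^ p.1) p.2 & lev p.2 + A == p.1]%N]%SET|.
  rewrite /cnt /crowding pair_big_dep/= sum1dep_card; apply: eq_card => q.
  by rewrite !inE.
apply: proper_card; apply/properP; split; last first.
  exists p; first by move: lp; rewrite inE p1 p2 leqnn eqxx => ->.
  by rewrite inE p1 p2 !ltnn eqxx !andbF.
apply/fintype.subsetP => q; rewrite !inE => /and3P[-> ->]; rewrite !andbT.
by case/orP => [/ltnW//|/andP[/eqP->]].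
Qed.

(** The spike further left is at the larger distance from [x], so its scale is not smaller and it
    precedes the nearer one. *)
Lemma spike_rank_mono A x y y' : active A x y -> active A x y' -> (y' < y)%N ->
  (spike_rank A x y' < spike_rank A x y)%N.
Proof.
move=> a a' y'y; have [p [p1 p2 lp]] := active_ordinals a'.
have kk' : (lev y + A <= lev y' + A)%N.
  case/and4P: a => _ yx _ /andP[lo _]; case/and4P: a' => _ _ _ /andP[_ hi].
  rewrite -ltnS -(@ltn_exp2l 2)//; apply: leq_ltn_trans lo _.
  by apply: leq_ltn_trans hi; lia.
apply: proper_card; apply/properP; split; last first.
  exists p; last by rewrite inE p1 p2 !ltnn eqxx !andbF.
  by move: lp; rewrite inE p1 p2 eqxx => -> /=; rewrite y'y andbT orbC -leq_eqVlt.
apply/fintype.subsetP => q; rewrite !inE => /and3P[-> ->] /=.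
move: kk'; rewrite leq_eqVlt => /orP[/eqP->|kk'].
  case/orP => [->//|/andP[-> q_y]].
  by rewrite (ltn_trans q_y y'y) orbT.
case/orP => [/(ltn_trans kk')->//|/andP[/eqP<- _]].
by rewrite kk'.
Qed.

(** * Gram matrix of the spikes *)

Context (b : nat -> R) (M C0 rho : R).
Hypothesis kern_bound : forall k n, `|kern b k n| <= M / 2 ^+ k.
Hypothesis correlation : correlation_decay b C0 rho.
Hypothesis rho_itv : 2^-1 <= rho < 1.

Let M_ge0 : 0 <= M.
Proof. by have := le_trans (normr_ge0 _) (kern_bound 0 0); rewrite divr1. Qed.

Let C0_ge0 : 0 <= C0.
Proof.
have := @correlation 0 0 1 (fun=> 0%N) (leqnn 0); rewrite expr0 mulr1.
by move=> H; apply: le_trans (H _); [exact: sumr_ge0|move=> i; rewrite add1n].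
Qed.

Let phi x y := b (x - y)%N * f y.

Lemma phi_kern A x y : active A x y -> phi x y = f y * kern b (lev y + A) (x - y).
Proof. by case/and4P => _ _ _ H; rewrite /phi /kern H mulrC. Qed.

(** The absolute value is outside the sum over [x], to keep the cancellation, but inside the sum
    over [c], so that one entry serves all rank blocks of length [2 ^ l] together. *)
Definition gram A l y y' := \sum_(c < 2 ^ (8 + 2 * A)) `|\sum_(x < T |
  [&& active A x y, active A x y', spike_rank A x y %/ 2 ^ l == c & spike_rank A x y' %/ 2 ^ l == c]%N)
    phi x y * phi x y'|.

Let ncell k := (m.+1 * 2 ^ (K - k))%N.

Let Zc j k y y' q := `|\sum_(u < 2 ^ j)
  kern b j (q * 2 ^ j + u - y)%N * kern b k (q * 2 ^ j + u - y')%N|.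

Definition live_cell k q := [exists x : 'I_T, (x %/ 2 ^ k == q)%N && (exit_scale x <= k <= K)%N].

Lemma gram_ge0 A l y y' : 0 <= gram A l y y'.
Proof. by apply: sumr_ge0 => c _; exact: normr_ge0. Qed.

Lemma gram_offdiag A l y y' : (y' < y)%N ->
  gram A l y y' <= (if (lev y + A <= lev y' + A)%N then
   f y * f y' * \sum_(q < ncell (lev y + A) |
      [&& left_near (lev y' + A) (q %/ 2 ^ (lev y' + A - (lev y + A))) y',
          left_near (lev y + A) q y & live_cell (lev y + A) q])
      Zc (lev y + A) (lev y' + A) y y' q else 0).
Proof.
move=> y'y; set k := (lev y + A)%N; set k' := (lev y' + A)%N.
have [kk'|k'k] := leqP k k'; last first.
  rewrite /gram big1// => c _; rewrite big_pred0 ?normr0// => x.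
  apply/negP => /and3P[a a' _]; move: k'k; rewrite ltnNge => /negP; apply.
  case/and4P: a => _ yx _ /andP[lo _]; case/and4P: a' => _ _ _ /andP[_ hi].
  rewrite -ltnS -(@ltn_exp2l 2)//; apply: leq_ltn_trans lo _.
  by apply: leq_ltn_trans hi; lia.
(* [cc] replaces [active] by conditions constant on cells of length [2 ^ k]. Where it holds and
   [active] fails for one of the spikes, a kernel vanishes. *)
pose cc c x := [&& (x %/ 2 ^ K == m)%N, (exit_scale x <= k <= K)%N, (exit_scale x <= k' <= K)%N,
  left_near k (x %/ 2 ^ k) y, left_near k' (x %/ 2 ^ k') y',
  (spike_rank A x y %/ 2 ^ l == c)%N & (spike_rank A x y' %/ 2 ^ l == c)%N].
pose h x := kern b k (x - y)%N * kern b k' (x - y')%N.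
have [kK|Kk] := leqP k K; last first.
  rewrite /gram big1 => [|c _].
    by apply: mulr_ge0; [exact: mulr_ge0|apply: sumr_ge0 => q _; exact: normr_ge0].
  rewrite big_pred0 ?normr0// => x.
  by apply/negP => /and3P[/and4P[_ _ /andP[_ ?] _] _ _]; lia.
have TE : T = (ncell k * 2 ^ k)%N by rewrite /T /ncell -mulnA -expnD subnK.
have sumE (c : nat) : \sum_(x < T |
    [&& active A x y, active A x y', spike_rank A x y %/ 2 ^ l == c & spike_rank A x y' %/ 2 ^ l == c]%N)
    phi x y * phi x y' = f y * f y' * \sum_(x < T | cc c x) h x.
  rewrite mulr_sumr [LHS]big_mkcond [RHS]big_mkcond/=; apply: eq_bigr => x _.
  case: ifP => [/and4P[a a' r r']|].
    have -> : cc c x.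
      rewrite /cc r r' (active_lft a) (active_lft a') !andbT.
      by case/and4P: a => -> _ -> _; case/and4P: a' => _ _ ->.
    by rewrite (phi_kern a) (phi_kern a') mulrACA.
  case: ifP => // /and4P[xm kx k'x /and4P[lx l'x r r']]; rewrite r r' !andbT => nact.
  have yx : (y < x)%N.
    have [y_lt _] := lftP lx; apply: leq_trans y_lt _; exact: leq_divM.
  have y'x := ltn_trans y'y yx.
  move: nact; rewrite /active xm yx y'x -/k -/k' kx k'x /=.
  by rewrite /h /kern; do 2 case: ifP => //; rewrite ?mul0r ?mulr0.
rewrite /gram; under eq_bigr => c _ do rewrite sumE normrM ger0_norm ?mulr_ge0//.
rewrite -mulr_sumr ler_wpM2l ?mulr_ge0//.
rewrite TE; apply: (@sum_norm_cells _ h k (ncell k) _ cc (fun q =>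
  [&& left_near k' (q %/ 2 ^ (k' - k)) y', left_near k q y & live_cell k q])).
- move=> c x x' xx'; rewrite /cc xx' (divn_cell kK xx') (divn_cell kk' xx').
  rewrite (exit_scale_cell xx') (exit_scale_cell (divn_cell kk' xx')).
  by rewrite (spike_rank_cell xx') (@spike_rank_cell A x x' y') ?(divn_cell kk' xx').
- by move=> c c' x /and4P[_ _ _ /and4P[_ _ /eqP<- _]] /and4P[_ _ _ /and4P[_ _ /eqP<- _]].
- move=> c x /and4P[/eqP xm kx k'x /and4P[lx l'x _ _]].
  rewrite -divnMA -expnD subnKC// l'x lx /=.
  have xT : (x < T)%N by rewrite /T -xm ltn_ceil// expn_gt0.
  by apply/existsP; exists (Ordinal xT); rewrite /= eqxx.
Qed.

(* Only scales [j = lev y + A <= lev y' + A] matter. In each cell of length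
   [2 ^ j] the sum of [f] is bounded by the stopping rule, so the spikes of
   that cell may be replaced by the one with the largest correlation, to which
   the decay of correlations applies. *)
Lemma gram_row A l y' :
  \sum_(y < T | (y' < y)%N) gram A l y y' <=
  f y' * \sum_(j < K.+1 | (A <= j)%N) (lam * 2 * C0 * rho ^+ j).
Proof.
pose k' := (lev y' + A)%N.
(* The sum is sorted by the scale [j = lev y + A] of the nearer spike; as [j >= A], the geometric
   series in [j] will decay in [A]. *)
apply: (@le_trans _ _ (\sum_(y < T | (y' < y)%N)
    \sum_(j < K.+1 | (A <= j)%N && (lev y + A == j)%N) gram A l y y')).
  apply: ler_sum => y y'y; have [kK|Kk] := leqP (lev y + A) K.
    rewrite (bigD1 (Ordinal (kK : _ < K.+1)%N)) /= ?leq_addl ?eqxx//.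
    by rewrite lerDl sumr_ge0// => j _; exact: gram_ge0.
  apply: (@le_trans _ _ 0); last by apply: sumr_ge0 => j _; exact: gram_ge0.
  rewrite /gram big1// => c _; rewrite big_pred0 ?normr0// => x.
  by apply/negP => /and3P[/and4P[_ _ /andP[_ ?] _] _ _]; lia.
rewrite (exchange_big_dep (fun j : 'I_K.+1 => A <= j)%N)/=; last by move=> y j _ /andP[].
rewrite mulr_sumr; apply: ler_sum => j Aj.
have rho_ge0 : 0 <= rho by case/andP: rho_itv => + _; lra.
have lam0 : 0 <= lam by exact: lam_ge0.
have [jk'|k'j] := leqP j k'; last first.
  rewrite big1 => [|y /and3P[y'y _ /eqP yj]].
    by apply: mulr_ge0 => //; apply: mulr_ge0; [do 2 apply: mulr_ge0 => //|exact: exprn_ge0].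
  apply/le_anti; rewrite gram_ge0 andbT.
  apply: le_trans (gram_offdiag A l y'y) _.
  by rewrite ifF// yj; apply/negbTE; rewrite -ltnNge.
have Zc_ge0 y q : 0 <= Zc j k' y y' q by exact: normr_ge0.
pose valid q y := [&& (y' < y)%N, (lev y + A == j)%N, left_near j q y & live_cell j q].
have /boolp.choice[ys ysP] : forall q : nat, exists y0 : nat, forall y : 'I_T, valid q y ->
    valid q y0 /\ Zc j k' y y' q <= Zc j k' y0 y' q.
  move=> q; have [y1 v1|nov] := pickP (fun y : 'I_T => valid q y); last first.
    by exists 0%N => y; rewrite nov.
  case: (@arg_maxP _ _ _ y1 (fun y : 'I_T => valid q y) (fun y => Zc j k' y y' q) v1).
  by move=> y2 v2 max2; exists y2 => y v; split=> //; exact: max2.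
apply: (@le_trans _ _ (\sum_(y < T | [&& y' < y, A <= j & lev y + A == j]%N)
   \sum_(q < ncell j | left_near k' (q %/ 2 ^ (k' - j)) y' && valid q y)
      f y' * (f y * Zc j k' y y' q))).
  apply: ler_sum => y /and3P[y'y _ /eqP yj].
  apply: le_trans (gram_offdiag A l y'y) _; rewrite yj -/k' jk'.
  rewrite mulr_sumr [leLHS]big_mkcond [leRHS]big_mkcond/=; apply: ler_sum => q _.
  rewrite /valid y'y yj eqxx /=; case: ifP => // _.
  by rewrite mulrA [f y * f y']mulrC.
rewrite (exchange_big_dep (fun q : 'I_(ncell j) =>
   left_near k' (q %/ 2 ^ (k' - j)) y' && (y' < ys q < q * 2 ^ j)%N))/=; last first.
  move=> y q _ /andP[-> v] /=; have [/and4P[-> _ /lftP[-> _] _] _] := ysP q y v.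
  by [].
have cor := correlation_cells correlation y' (ncell j) ys jk'.
have sc_ge0 : 0 <= f y' * (lam * 2 ^+ j) by rewrite mulr_ge0// lam_scale_ge0.
(* The mass [lam * 2 ^+ j] seen from a live cell cancels the [2 ^- j] of the correlation and leaves
   [rho ^+ j]. *)
apply: (@le_trans _ _ (f y' * (lam * 2 ^+ j) * (2 * C0 * (rho / 2) ^+ j))); last first.
  rewrite le_eqVlt; apply/orP; left; apply/eqP; rewrite expr_div_n; field.
  by rewrite expf_neq0 ?pnatr_eq0.
apply: le_trans (ler_wpM2l sc_ge0 cor); rewrite mulr_sumr.
apply: ler_sum => q /andP[lq ysq].
apply: (@le_trans _ _ (\sum_(y < T | valid q y) f y' * (f y * Zc j k' (ys q) y' q))).
  rewrite [leLHS]big_mkcond [leRHS]big_mkcond/=; apply: ler_sum => y _.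
  case: ifP => [/andP[_ /andP[_ v]]|_]; last by case: ifP => // _; do 2 apply: mulr_ge0 => //.
  by rewrite v; have [_ le_Z] := ysP q y v; rewrite !ler_wpM2l.
rewrite -mulr_sumr -mulr_suml -mulrA ler_wpM2l// ler_wpM2r//.
have [y1 v1|nov] := pickP (fun y : 'I_T => valid q y); last first.
  by rewrite big_pred0// lam_scale_ge0.
have /and4P[_ _ _ /existsP[x /andP[/eqP xq live]]] := v1.
apply: le_trans (not_stop_f live).
rewrite [leLHS]big_mkcond [leRHS]big_mkcond/=; apply: ler_sum => y _.
by case: ifP => [/and4P[_ _ ly _]|_]; [rewrite xq ly|case: ifP].
Qed.

(** At most [2 ^ k] points contribute, each at most [(f y * M / 2 ^+ k) ^+ 2]. The gain [2 ^- A]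
    comes from [k = lev y + A], whereas [f y] is at most [2 * lam * 2 ^+ lev y]. *)
Lemma gram_diag A l (y : 'I_T) : near_top K m y ->
  gram A l y y <= 2 * M ^+ 2 * lam * 2 ^- A * f y.
Proof.
move=> ny; set k := (lev y + A)%N.
have p2 n : (0 : R) < 2 ^+ n by rewrite exprn_gt0.
apply: (@le_trans _ _ (\sum_(x < T | active A x y) (f y * M / 2 ^+ k) ^+ 2)).
  apply: (@le_trans _ _ (\sum_(c < 2 ^ (8 + 2 * A)) \sum_(x < T |
     active A x y && (spike_rank A x y %/ 2 ^ l == c)%N) (f y * M / 2 ^+ k) ^+ 2)).
    apply: ler_sum => c _; apply: le_trans (ler_norm_sum _ _ _) _.
    rewrite [leLHS]big_mkcond [leRHS]big_mkcond/=; apply: ler_sum => x _.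
    case: ifP => [/and3P[a _ /andP[-> _]]|_]; last by case: ifP => // _; exact: sqr_ge0.
    rewrite a (phi_kern a) -/k -expr2 normrX.
    rewrite lerXn2r// ?nnegrE ?divr_ge0 ?mulr_ge0 ?exprn_ge0//.
    by rewrite normrM ger0_norm// -mulrA ler_wpM2l.
  rewrite (exchange_big_dep (fun x : 'I_T => active A x y))/=; last by move=> c x _ /andP[].
  apply: ler_sum => x a.
  rewrite (eq_bigl (fun c : 'I_(2 ^ (8 + 2 * A)) => (spike_rank A x y %/ 2 ^ l == c)%N)); last first.
    by move=> c; rewrite a.
  have r_lt : (spike_rank A x y %/ 2 ^ l < 2 ^ (8 + 2 * A))%N.
    by rewrite (leq_ltn_trans (leq_div _ _))// spike_rank_lt.
  by rewrite (big_pred1 (Ordinal r_lt))// => c; rewrite /= eq_sym.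
apply: (@le_trans _ _ (2 ^+ k * (f y * M / 2 ^+ k) ^+ 2)).
  rewrite (eq_bigr (fun=> 1 * (f y * M / 2 ^+ k) ^+ 2)); last by move=> x _; rewrite mul1r.
  rewrite -mulr_suml ler_wpM2r ?sqr_ge0// -natrX.
  apply: le_trans (sum_interval_le (y + 2 ^ k) _ T).
  rewrite [leLHS]big_mkcond [leRHS]big_mkcond/=; apply: ler_sum => x _.
  case: ifP => [/and4P[_ yx _]|_]; last by case: ifP.
  rewrite -/k expnS => H; suff -> : (y + 2 ^ k <= x < y + 2 ^ k + 2 ^ k)%N by [].
  by move: H; set d := (2 ^ k)%N; lia.
have := near_f ny (ltn_ord y); rewrite exprS => fy.
have -> : 2 ^+ k * (f y * M / 2 ^+ k) ^+ 2 = M ^+ 2 * f y * 2 ^- k * f y.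
  by field; rewrite gt_eqF.
have -> : 2 * M ^+ 2 * lam * 2 ^- A * f y = M ^+ 2 * (lam * (2 * 2 ^+ lev y)) * 2 ^- k * f y.
  by rewrite /k exprD; field; rewrite !gt_eqF.
by rewrite ler_wpM2r// ler_wpM2r ?invr_ge0 ?exprn_ge0// ler_wpM2l// sqr_ge0.
Qed.

Lemma gram_near A l y y' : ~~ near_top K m y -> gram A l y' y = 0.
Proof.
move=> ny; rewrite /gram big1// => c _; rewrite big_pred0 ?normr0// => x.
by apply/negP => /and3P[_ /active_near]; rewrite (negbTE ny).
Qed.

Lemma gramC A l y y' : gram A l y y' = gram A l y' y.
Proof.
apply: eq_bigr => c _; congr `|_|; apply: eq_big => x; last by rewrite mulrC.
by case: (active A x y); case: (active A x y') => //=; rewrite andbC.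
Qed.

(** The square is expanded; by symmetry the row bound serves both triangles, and [2^-1 <= rho]
    absorbs the [2 ^- A] of the diagonal in [rho ^+ A]. *)
Lemma block_square_sum A l :
  \sum_(x < T) \sum_(c < 2 ^ (8 + 2 * A))
    (\sum_(y < T | active A x y && (spike_rank A x y %/ 2 ^ l == c)%N) phi x y) ^+ 2 <=
  (2 * M ^+ 2 + 4 * C0 / (1 - rho)) * rho ^+ A * lam * mass.
Proof.
have [rho_lo rho_hi] := andP rho_itv.
have rho_ge0 : 0 <= rho by lra.
apply: (@le_trans _ _ (\sum_(y < T) \sum_(y' < T) gram A l y y')).
  rewrite exchange_big/=.
  have -> : \sum_(y < T) \sum_(y' < T) gram A l y y' = \sum_(c < 2 ^ (8 + 2 * A))
     \sum_(y < T) \sum_(y' < T) `|\sum_(x < T | [&& active A x y, active A x y',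
         spike_rank A x y %/ 2 ^ l == c & spike_rank A x y' %/ 2 ^ l == c]%N) phi x y * phi x y'|.
    by rewrite [RHS]exchange_big/=; apply: eq_bigr => y _; rewrite [RHS]exchange_big.
  apply: ler_sum => c _.
  rewrite [leLHS](_ : _ = \sum_(y < T) \sum_(y' < T) \sum_(x < T | [&& active A x y, active A x y',
         spike_rank A x y %/ 2 ^ l == c & spike_rank A x y' %/ 2 ^ l == c]%N) phi x y * phi x y').
    by apply: ler_sum => y _; apply: ler_sum => y' _; exact: ler_norm.
  transitivity (\sum_(x < T) \sum_(y < T) \sum_(y' < T) if [&& active A x y, active A x y',
         spike_rank A x y %/ 2 ^ l == c & spike_rank A x y' %/ 2 ^ l == c]%N then phi x y * phi x y' else 0).
    apply: eq_bigr => x _; rewrite big_mkcond expr2 mulr_suml; apply: eq_bigr => y _.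
    rewrite mulr_sumr; apply: eq_bigr => y' _.
    by case: (active A x y); case: (active A x y'); case: (_ %/ _ == _)%N; case: (_ %/ _ == _)%N;
       rewrite /= ?mul0r ?mulr0.
  rewrite exchange_big/=; apply: eq_bigr => y _; rewrite exchange_big/=.
  by apply: eq_bigr => y' _; rewrite [RHS]big_mkcond.
have splitE : \sum_(y < T) \sum_(y' < T) gram A l y y' =
    \sum_(y < T) gram A l y y + 2 * \sum_(y' < T) \sum_(y < T | (y' < y)%N) gram A l y y'.
  transitivity (\sum_(y < T) \sum_(y' < T) ((if y == y' then gram A l y y else 0) +
      (if (y' < y)%N then gram A l y y' else 0) + (if (y < y')%N then gram A l y' y else 0))).
    apply: eq_bigr => y _; apply: eq_bigr => y' _.
    rewrite -(val_eqE y y')/=; case: (ltngtP y y') => [_|_|/val_inj<-]; rewrite ?addr0 ?add0r//.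
    exact: gramC.
  under eq_bigr => y _ do rewrite !big_split/=.
  rewrite !big_split/= -addrA; congr (_ + _).
    by apply: eq_bigr => y _; rewrite -big_mkcond (big_pred1 y)// => z; rewrite /= eq_sym.
  rewrite mulr_natl mulr2n; congr (_ + _); last first.
    by apply: eq_bigr => y _; rewrite -big_mkcond.
  by rewrite exchange_big/=; apply: eq_bigr => y _; rewrite -big_mkcond.
rewrite splitE.
have diag : \sum_(y < T) gram A l y y <= 2 * M ^+ 2 * lam * rho ^+ A * mass.
  apply: (@le_trans _ _ (\sum_(y < T | near_top K m y) 2 * M ^+ 2 * lam * 2 ^- A * f y)).
    rewrite [leRHS]big_mkcond; apply: ler_sum => y _.
    by case: ifP => [/gram_diag//|/negbT /gram_near->].
  rewrite -mulr_sumr; apply: ler_wpM2r; first exact: mass_ge0.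
  apply: ler_wpM2l; last by rewrite -exprVn lerXn2r// nnegrE invr_ge0.
  by apply: mulr_ge0; [rewrite mulr_ge0 ?sqr_ge0|exact: lam_ge0].
have geo : \sum_(j < K.+1 | (A <= j)%N) rho ^+ j <= rho ^+ A / (1 - rho).
  rewrite ler_pdivlMr ?subr_gt0// mulr_suml.
  suff -> n : \sum_(j < n | (A <= j)%N) rho ^+ j * (1 - rho) =
      if (A <= n)%N then rho ^+ A - rho ^+ n else 0.
    by case: ifP => _; rewrite ?exprn_ge0// gerBl exprn_ge0.
  elim: n => [|n IHn].
    by rewrite big_ord0 leqn0; case: eqP => // ->; rewrite subrr.
  rewrite big_mkcond big_ord_recr -big_mkcond/= IHn.
  have [An|An] := leqP A n; first by rewrite leqW// exprS; ring.
  rewrite addr0; have [->|ne] := eqVneq A n.+1; first by rewrite leqnn subrr.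
  by rewrite leqNgt ltn_neqAle eq_sym ne An.
have lam0 : 0 <= lam by exact: lam_ge0.
have mass0 : 0 <= mass by exact: mass_ge0.
have off : \sum_(y' < T) \sum_(y < T | (y' < y)%N) gram A l y y' <=
    mass * (lam * 2 * C0 * (rho ^+ A / (1 - rho))).
  apply: (@le_trans _ _ (\sum_(y' < T | near_top K m y')
     f y' * (lam * 2 * C0 * (rho ^+ A / (1 - rho))))); last by rewrite -mulr_suml.
  rewrite [leRHS]big_mkcond; apply: ler_sum => y' _; case: ifP => [_|/negbT ny]; last first.
    by rewrite big1// => y _; rewrite gram_near.
  apply: le_trans (gram_row _ _ _) _; rewrite ler_wpM2l// -mulr_sumr ler_wpM2l//.
  by do 2 apply: mulr_ge0 => //.
apply: le_trans (lerD diag (ler_wpM2l _ off)) _ => //.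
by rewrite le_eqVlt; apply/orP; left; apply/eqP; field; rewrite subr_eq0 gt_eqF.
Qed.

(** * Truncated sums over the active spikes *)

Context (N : nat -> nat).

Definition scale_part A x := `|\sum_(y < T | active A x y && (N x <= x - y)%N) phi x y|.

(** Among the active spikes the rank falls as the distance to [x] grows, so keeping the distances at
    least [n] keeps the smallest ranks. *)
Lemma truncation_rank A x n : exists rho',
  \sum_(y < T | active A x y && (n <= x - y)%N) phi x y =
  \sum_(y < T | active A x y && (spike_rank A x y < rho')%N) phi x y.
Proof.
exists (\max_(y < T | active A x y && (n <= x - y)%N) (spike_rank A x y).+1).
apply: eq_bigl => y; case a: (active A x y) => //=; apply/idP/idP => [ny|].
  by apply: (leq_bigmax_cond (F := fun y : 'I_T => (spike_rank A x y).+1)); rewrite a.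
apply: contraLR; rewrite -ltnNge -leqNgt => yn; apply/bigmax_leqP => y1 /andP[a1 n1].
by apply: spike_rank_mono => //; move: yn n1; set u := nat_of_ord y; set v := nat_of_ord y1; lia.
Qed.

(** One factor [9 + 2 * A] is the Cauchy-Schwarz loss over the binary digits of the rank, the other
    the number of block lengths. *)
Lemma part_square_sum A : \sum_(x < T) scale_part A x ^+ 2 <=
  (9 + 2 * A)%:R ^+ 2 * ((2 * M ^+ 2 + 4 * C0 / (1 - rho)) * rho ^+ A * lam * mass).
Proof.
apply: (@le_trans _ _ (\sum_(x < T) (9 + 2 * A)%:R * \sum_(l < 9 + 2 * A)
    \sum_(c < 2 ^ (8 + 2 * A))
    (\sum_(y < T | active A x y && (spike_rank A x y %/ 2 ^ l == c)%N) phi x y) ^+ 2)).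
  apply: ler_sum => x _; rewrite /scale_part real_normK ?num_real//.
  have [rho' ->] := truncation_rank A x (N x).
  by apply: rank_partial_sum => y; exact: spike_rank_lt.
rewrite -mulr_sumr expr2 -mulrA ler_wpM2l// exchange_big/=.
apply: (@le_trans _ _ (\sum_(l < 9 + 2 * A)
   (2 * M ^+ 2 + 4 * C0 / (1 - rho)) * rho ^+ A * lam * mass)).
  by apply: ler_sum => l _; exact: block_square_sum.
by rewrite sumr_const card_ord -[leLHS]mulr_natl.
Qed.

(** No cancellation is used: a spike acts on at most two cells, each of weight at most [W * 2 ^+ k],
    through a kernel of size [M / 2 ^+ k]. The weight will be the part of [g] above the splitting
    height. *)
Lemma part_weighted_sum A (w : nat -> R) W : (forall x, 0 <= w x) -> 0 <= W ->
  (forall k x, (x %/ 2 ^ K = m)%N -> (exit_scale x <= k <= K)%N ->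
    \sum_(x' < T | (x' %/ 2 ^ k == x %/ 2 ^ k)%N) w x' <= W * 2 ^+ k) ->
  \sum_(x < T) w x * scale_part A x <= 2 * M * W * mass.
Proof.
move=> w_ge0 W_ge0 w_cell.
have p2 n : (0 : R) < 2 ^+ n by rewrite exprn_gt0.
apply: (@le_trans _ _ (\sum_(x < T) \sum_(y < T | active A x y)
    w x * (f y * (M / 2 ^+ (lev y + A))))).
  apply: ler_sum => x _; rewrite -mulr_sumr ler_wpM2l//.
  apply: le_trans (ler_norm_sum _ _ _) _.
  rewrite [leLHS]big_mkcond [leRHS]big_mkcond/=; apply: ler_sum => y _.
  have t_ge0 : 0 <= f y * (M / 2 ^+ (lev y + A)) by rewrite mulr_ge0// divr_ge0// ltW.
  case: ifP => [/andP[a _]|_]; last by case: ifP.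
  by rewrite a (phi_kern a) normrM ger0_norm// ler_wpM2l.
rewrite (exchange_big_dep (fun y : 'I_T => near_top K m y))/=; last first.
  by move=> x y _; exact: active_near.
rewrite /mass /top_mass mulr_sumr; apply: ler_sum => y _.
set k := (lev y + A)%N; rewrite -mulr_suml.
have -> : 2 * M * W * f y = (2 * W * 2 ^+ k) * (f y * (M / 2 ^+ k)).
  by field; rewrite gt_eqF.
apply: ler_wpM2r; first by rewrite mulr_ge0// divr_ge0// ltW.
have cell q : \sum_(x < T | active A x y && (x %/ 2 ^ k == q)%N) w x <= W * 2 ^+ k.
  have [x0 /andP[a0 /eqP q0]|none] := pickP (fun x : 'I_T => active A x y && (x %/ 2 ^ k == q)%N).
    have /and4P[/eqP xm _ live _] := a0.
    apply: le_trans (w_cell k x0 xm live); rewrite [leLHS]big_mkcond [leRHS]big_mkcond/=.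
    by apply: ler_sum => x _; case: ifP => [/andP[_ /eqP->]|_]; [rewrite q0 eqxx|case: ifP].
  by rewrite big_pred0// mulr_ge0// ltW.
apply: (@le_trans _ _ (W * 2 ^+ k + W * 2 ^+ k)); last by lra.
apply: le_trans (lerD (cell (y %/ 2 ^ k).+1) (cell (y %/ 2 ^ k).+2)).
rewrite [leLHS]big_mkcond [X in X + _]big_mkcond [X in _ + X]big_mkcond -big_split/=.
apply: ler_sum => x _; case a: (active A x y); last by rewrite addr0.
have := active_lft a; rewrite -/k /left_near => /andP[lo hi].
have [_|ne1] := eqVneq (x %/ 2 ^ k)%N (y %/ 2 ^ k).+1; first by rewrite lerDl; case: ifP.
have [_|ne2] := eqVneq (x %/ 2 ^ k)%N (y %/ 2 ^ k).+2; first by rewrite add0r.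
by move: lo hi ne1 ne2; set z := (x %/ _)%N; set z' := (y %/ _)%N; lia.
Qed.

Definition live_sum x := `|\sum_(y < T | [&& y < x, N x <= x - y &
  exit_scale x <= trunc_log 2 (x - y) <= K]%N) phi x y|.

(** A pair at scale [k] belongs to the parameter [A = k - lev y] alone. The natural subtraction is
    exact, because [f y <= lam * 2 ^+ k] where the scale [k] is live. *)
Lemma live_sum_parts x : (x %/ 2 ^ K = m)%N -> live_sum x <= \sum_(A < K.+1) scale_part A x.
Proof.
move=> xm; apply: le_trans (ler_norm_sum _ _ _).
rewrite le_eqVlt; apply/orP; left; apply/eqP; congr `|_|.
under [RHS]eq_bigr => A _ do rewrite big_mkcond.
rewrite exchange_big big_mkcond/=; apply: eq_bigr => y _.
have [yx|xy] := ltnP y x; last first.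
  by rewrite big1// => A _; rewrite /active ltnNge xy/= !andbF.
have [Nx|] := leqP (N x) (x - y); last by move=> _; rewrite big1// => A _; rewrite andbF.
have d_gt0 : (0 < x - y)%N by lia.
have /andP[lo hi] := trunc_log_bounds (isT : 1 < 2)%N d_gt0.
move: lo hi; set k := trunc_log 2 (x - y) => lo hi.
have act_k A : active A x y -> (lev y + A = k)%N.
  by case/and4P => _ _ _ d_itv; rewrite /k (trunc_log_eq _ d_itv).
rewrite /=; case: ifP => [live|nlive]; last first.
  rewrite big1// => A _; rewrite andbT; case: ifP => // a.
  by move: (a) nlive => /and4P[_ _ + _]; rewrite (act_k _ a) => ->.
have yT : (y < T)%N by [].
have l : left_near k (x %/ 2 ^ k) y by apply: scale_lft => //; rewrite lo hi.
have lk : (lev y <= k)%N by apply: lev_scale => //; exact: live_f live l yT.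
have A_lt : (k - lev y < K.+1)%N by case/andP: live; lia.
rewrite (bigD1 (Ordinal A_lt))//= big1 ?addr0 => [|A neA].
  by rewrite /active xm eqxx yx subnKC// live lo hi.
rewrite andbT; case: ifP => // /act_k kE; case/eqP: neA; apply: val_inj => /=.
by rewrite -kE addKn.
Qed.

End Local.

(** * The local estimate *)

Section Geometric.
Context {R : realType}.

Lemma geometric_sum_le (q : R) n : 0 <= q < 1 -> \sum_(A < n) q ^+ A <= (1 - q)^-1.
Proof.
move=> /andP[q_ge0 q_lt1]; rewrite -[leRHS]mul1r ler_pdivlMr ?subr_gt0//.
suff -> : (\sum_(A < n) q ^+ A) * (1 - q) = 1 - q ^+ n by rewrite gerBl exprn_ge0.
elim: n => [|n IHn]; first by rewrite big_ord0 mul0r expr0 subrr.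
by rewrite big_ord_recr/= mulrDl IHn exprS; ring.
Qed.

Lemma linear_geometric (q : R) A : 0 <= q < 1 -> A.+1%:R * q ^+ A <= (1 - q)^-1.
Proof.
move=> q01; apply: le_trans (geometric_sum_le A.+1 q01).
rewrite mulr_natl -[in leLHS](card_ord A.+1) -sumr_const; apply: ler_sum => i _.
by case/andP: q01 => q0 q1; rewrite ler_wiXn2l ?(ltW q1)// -ltnS.
Qed.

Lemma powR_mulD (a x y : R) : a != 0 -> a `^ x * a `^ y = a `^ (x + y).
Proof. by move=> a0; rewrite powRD// a0 implybT. Qed.

(** With [v = (r - 1) * ln t] one has [1 - expR (- v) >= v / (1 + v)], and [v <= ln t] because
    [r < 2]. *)
Lemma powR_geometric (t r : R) : 1 < t -> 1 < r < 2 ->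
  (1 - t `^ (1 - r))^-1 <= (1 + ln t) / ln t / (r - 1).
Proof.
move=> t1 /andP[r1 r2]; have t0 : 0 < t by lra.
have L0 : 0 < ln t by rewrite ln_gt0.
rewrite /powR gt_eqF//; set v := (r - 1) * ln t.
have -> : (1 - r) * ln t = - v by rewrite /v; ring.
have v0 : 0 < v by rewrite mulr_gt0// subr_gt0.
have ev : 1 + v <= expR v by exact: expR_ge1Dx.
have e0 : 0 < expR v by exact: expR_gt0.
have : v / (1 + v) <= 1 - expR (- v).
  rewrite expRN ler_pdivrMr; last by lra.
  have : (expR v)^-1 * (1 + v) <= 1 by rewrite mulrC ler_pdivrMr// mul1r.
  lra.
move=> H; have h0 : 0 < v / (1 + v) by rewrite divr_gt0//; lra.
apply: (@le_trans _ _ (v / (1 + v))^-1).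
  by rewrite lef_pV2 ?posrE//; apply: lt_le_trans H.
rewrite invf_div ler_pdivrMr//.
have -> : (1 + ln t) / ln t / (r - 1) * v = 1 + ln t.
  by rewrite /v; field; rewrite subr_eq0 !gt_eqF.
rewrite lerD2l /v -[leRHS]mul1r ler_wpM2r//; [exact: ltW|lra].
Qed.

End Geometric.

Section LocalBound.
Context {R : realType} (f g : nat -> R) (K m : nat) (r : R).
Hypotheses (f_ge0 : forall y, 0 <= f y) (g_ge0 : forall y, 0 <= g y).
Hypothesis r_itv : 1 < r < 2.
Context (b : nat -> R) (M C0 : R).

(* Any value below [1] with [3 / 4 <= decay ^+ 16] would do. *)
Definition decay : R := 63 / 64.

Hypothesis kern_bound : forall k n, `|kern b k n| <= M / 2 ^+ k.
Hypothesis correlation : correlation_decay b C0 (decay ^+ 8).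
Context (N : nat -> nat).

Let T := (m.+1 * 2 ^ K)%N.
Let G x := g x `^ r.
Let mu := cell_average G K m `^ r^-1.
Let tau : R := decay ^- 2.

Definition bessel_const : R := 2 * M ^+ 2 + 4 * C0 / (1 - decay ^+ 8).

(** Here [64] is [1 / (1 - decay)], and [96] is the 2 of [part_weighted_sum] times the 48 of the
    stopping rule on [G]. *)
Definition local_const : R :=
  64 * (576 * (96 * bessel_const + 1)) + 96 * M * ((1 + ln tau) / ln tau).

Let G_ge0 x : 0 <= G x. Proof. exact: powR_ge0. Qed.

Let decay_itv : 0 <= decay < 1. Proof. by rewrite /decay; apply/andP; split; lra. Qed.

Let decay_gt0 : 0 < decay. Proof. by rewrite /decay; lra. Qed.

Let decay8_itv : 2^-1 <= decay ^+ 8 < 1.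
Proof.
apply/andP; split; last by rewrite exprn_ilt1//; case/andP: decay_itv => *; lra.
have : 2^-1 <= decay ^+ 2 ^+ 4 by rewrite /decay; lra.
by rewrite -exprM.
Qed.

Let tau_gt1 : 1 < tau.
Proof.
rewrite /tau invf_gt1 ?exprn_gt0// exprn_ilt1//; case/andP: decay_itv => *; lra.
Qed.

Let M_ge0 : 0 <= M.
Proof. by have := le_trans (normr_ge0 _) (kern_bound 0 0); rewrite divr1. Qed.

Let C0_ge0 : 0 <= C0.
Proof.
have := @correlation 0 0 1 (fun=> 0%N) (leqnn 0); rewrite expr0 mulr1.
by move=> H; apply: le_trans (H _); [exact: sumr_ge0|move=> i; rewrite add1n].
Qed.

Let mass0 : 0 <= top_mass f K m. Proof. exact: mass_ge0. Qed.

Lemma bessel_const_ge0 : 0 <= bessel_const.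
Proof.
case/andP: decay8_itv => _ s1; rewrite addr_ge0 ?mulr_ge0 ?sqr_ge0// invr_ge0; lra.
Qed.

Lemma local_const_ge0 : 0 <= local_const.
Proof.
have B0 := bessel_const_ge0; have L0 : 0 < ln tau by rewrite ln_gt0.
rewrite /local_const; apply: addr_ge0; first by lra.
by apply: mulr_ge0; [exact: mulr_ge0|apply: divr_ge0; lra].
Qed.

Let part A x := scale_part f G K m b N A x.

(** The constant is [576 = 9 * 64], from [9 + 2 * A <= 9 * A.+1] and [linear_geometric]. The 96 is
    that of [threshold], and [96 * B <= (96 * B + 1) ^+ 2] avoids a square root. *)
Lemma part_square_decay A : 2 ^+ K * \sum_(x < T) part A x ^+ 2 <=
  (576 * (96 * bessel_const + 1) * decay ^+ (2 * A) * top_mass f K m) ^+ 2.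
Proof.
have B0 := bessel_const_ge0; case/andP: decay8_itv => _ s1.
have := part_square_sum G K m f_ge0 kern_bound correlation decay8_itv N A.
rewrite -/bessel_const => H.
apply: le_trans (ler_wpM2l _ H) _; first exact: exprn_ge0.
have lin : (9 + 2 * A)%:R * decay ^+ (2 * A) <= 576.
  apply: (@le_trans _ _ (9 * (A.+1%:R * decay ^+ A))).
    rewrite mulrA; apply: ler_pM => //; first by rewrite exprn_ge0// ltW.
      by rewrite -natrM ler_nat mulnS leq_add2l leq_mul2r orbT.
    by rewrite mulnC exprM expr2 ler_piMr ?exprn_ge0 ?(ltW decay_gt0)//
      exprn_ile1// ltW//; case/andP: decay_itv.
  have := linear_geometric A decay_itv.
  have -> : (1 - decay)^-1 = 64 by rewrite /decay; field.
  by lra.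
have lin0 : 0 <= (9 + 2 * A)%:R * decay ^+ (2 * A) by rewrite mulr_ge0// exprn_ge0// ltW.
have E : 2 ^+ K * ((9 + 2 * A)%:R ^+ 2 *
    (bessel_const * (decay ^+ 8) ^+ A * threshold f K m * top_mass f K m)) =
   ((9 + 2 * A)%:R * decay ^+ (2 * A)) ^+ 2 * (96 * bessel_const) * (decay ^+ (2 * A) * top_mass f K m) ^+ 2.
  rewrite /threshold -exprM (_ : (8 * A = 2 * A + 2 * A + (2 * A + 2 * A))%N); last by rewrite -!mulnDl.
  rewrite !exprD; have p0 : 2 ^+ K != 0 :> R by rewrite expf_neq0 ?pnatr_eq0.
  move: p0; set p := 2 ^+ K; set D := decay ^+ (2 * A); set n := (9 + 2 * A)%:R.
  set B := bessel_const; set W := top_mass f K m; move: p D n B W => p D n B W p0.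
  by field.
rewrite E; set D := decay ^+ (2 * A) * _.
have -> : (576 * (96 * bessel_const + 1) * decay ^+ (2 * A) * top_mass f K m) ^+ 2 =
   576 ^+ 2 * (96 * bessel_const + 1) ^+ 2 * D ^+ 2 by rewrite /D; ring.
apply: ler_wpM2r; first exact: sqr_ge0.
apply: ler_pM; [exact: sqr_ge0|by rewrite mulr_ge0| |].
  by apply: lerXn2r; [rewrite nnegrE; exact: lin0|rewrite nnegrE; exact: ler0n|exact: lin].
by nra.
Qed.

(** Below the height [th], [g ^ 2 <= th ^ (2 - r) * g ^ r], and the sum of [g ^ r] over the cell is
    [mu ^ r * 2 ^ K]. *)
Lemma low_height_sum A :
  \sum_(x < T) (if (x %/ 2 ^ K == m)%N && (g x <= mu * tau ^+ A) then g x else 0) ^+ 2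
  <= mu ^+ 2 * tau ^+ A * 2 ^+ K.
Proof.
have [r1 r2] := andP r_itv; have r0 : 0 < r by lra.
have mu0 : 0 <= mu by exact: powR_ge0.
have t0 : 0 < tau by exact: lt_trans tau_gt1.
have tA : 1 <= tau ^+ A by rewrite exprn_ege1// ltW.
have a0 : 0 <= cell_average G K m by exact: avgG_ge0.
have muE : mu `^ r = cell_average G K m by rewrite /mu -powRrM mulVf ?gt_eqF// powRr1.
set th := mu * tau ^+ A; have th0 : 0 <= th by rewrite mulr_ge0// (le_trans ler01).
apply: (@le_trans _ _ (\sum_(x < T | (x %/ 2 ^ K == m)%N) th `^ (2 - r) * G x)).
  rewrite [leRHS]big_mkcond; apply: ler_sum => x _; case: ifP => [/andP[-> gx]|_]; last first.
    by rewrite expr0n; case: ifP => // _; rewrite mulr_ge0 ?powR_ge0.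
  have [->|g_neq0] := eqVneq (g x) 0; first by rewrite expr0n mulr_ge0// powR_ge0.
  have -> : g x ^+ 2 = g x `^ (2 - r) * G x.
    by rewrite /G powR_mulD// subrK powR_mulrn.
  by rewrite ler_wpM2r ?powR_ge0// ge0_ler_powR// ?nnegrE//; lra.
rewrite -mulr_sumr (_ : \sum_(x < T | _) G x = cell_average G K m * 2 ^+ K); last first.
  by rewrite /cell_average divfK// expf_neq0 ?pnatr_eq0.
rewrite mulrA; apply: ler_wpM2r; first exact: exprn_ge0.
have tA0 : 0 <= tau ^+ A by lra.
rewrite -muE /th (powRM _ mu0 tA0) mulrAC.
have [->|mu_neq0] := eqVneq mu 0.
  by rewrite powR0 ?gt_eqF ?mul0r ?expr0n ?mul0r//; lra.
rewrite powR_mulD// subrK powR_mulrn// ler_wpM2l ?sqr_ge0//.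
by rewrite -[leRHS](powRr1 tA0) ler_powR//; lra.
Qed.

(** Above the height [th], [g <= th ^ (1 - r) * g ^ r] since [1 - r < 0]; the stopping rule on [G]
    bounds the sum of [g ^ r]. *)
Lemma high_height_cell A k x : mu != 0 -> (exit_scale f G K m x <= k <= K)%N ->
  \sum_(x' < T | (x' %/ 2 ^ k == x %/ 2 ^ k)%N)
    (if g x' <= mu * tau ^+ A then 0 else g x') <=
  48 * mu * (tau `^ (1 - r)) ^+ A * 2 ^+ k.
Proof.
move=> mu_neq0 live.
have [r1 r2] := andP r_itv; have r0 : 0 < r by lra.
have mu0 : 0 <= mu by exact: powR_ge0.
have t0 : 0 < tau by exact: lt_trans tau_gt1.
have tA : 0 < tau ^+ A by rewrite exprn_gt0.
have a0 : 0 <= cell_average G K m by exact: avgG_ge0.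
have muE : mu `^ r = cell_average G K m by rewrite /mu -powRrM mulVf ?gt_eqF// powRr1.
set th := mu * tau ^+ A; have th0 : 0 < th by rewrite mulr_gt0// lt0r mu_neq0.
apply: (@le_trans _ _ (\sum_(x' < T | (x' %/ 2 ^ k == x %/ 2 ^ k)%N) th `^ (1 - r) * G x')).
  apply: ler_sum => x' _; case: ifP => [_|/negbT]; first by rewrite mulr_ge0 ?powR_ge0.
  rewrite -ltNge => gth; have g0 : 0 < g x' by exact: lt_trans gth.
  have {1}-> : g x' = g x' `^ (1 - r) * G x'.
    by rewrite /G powR_mulD ?gt_eqF// subrK powRr1// ltW.
  rewrite ler_wpM2r ?powR_ge0//.
  have -> : 1 - r = - (r - 1) by ring.
  by rewrite !powRN lef_pV2 ?posrE ?powR_gt0// ge0_ler_powR ?nnegrE ?(ltW th0) ?(ltW g0) ?(ltW gth)//; lra.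
rewrite -mulr_sumr; apply: le_trans (ler_wpM2l _ (not_stop_g live)) _; first exact: powR_ge0.
rewrite -muE /th powRM ?(ltW tA)//.
have -> : (tau ^+ A) `^ (1 - r) = (tau `^ (1 - r)) ^+ A.
  by rewrite -(powR_mulrn _ (ltW t0)) -powRrM mulrC powRrM powR_mulrn// powR_ge0.
have -> : mu `^ (1 - r) * (tau `^ (1 - r)) ^+ A * (48 * mu `^ r * 2 ^+ k) =
   48 * (mu `^ (1 - r) * mu `^ r) * (tau `^ (1 - r)) ^+ A * 2 ^+ k by ring.
by rewrite powR_mulD// subrK powRr1.
Qed.

Lemma local_bound :
  \sum_(x < T | (x %/ 2 ^ K == m)%N) g x * live_sum f G K m b N x <=
  local_const / (r - 1) * top_mass f K m * mu.
Proof.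
have [r1 r2] := andP r_itv; have r0 : 0 < r by lra.
have mu0 : 0 <= mu by exact: powR_ge0.
have B0 := bessel_const_ge0.
have t0 : 0 < tau by exact: lt_trans tau_gt1.
(* If [mu = 0], then [g] vanishes on the cell and there is no height to split at. *)
have [mu_eq0|mu_neq0] := eqVneq mu 0.
  rewrite mu_eq0 mulr0 big1// => x /eqP xm; suff -> : g x = 0 by rewrite mul0r.
  have avg0 : cell_average G K m = 0.
    by move/eqP: mu_eq0; rewrite /mu powR_eq0 invr_eq0 => /andP[/eqP].
  have G0 : G x <= 0.
    rewrite -(mul0r (2 ^+ K)) -avg0 /cell_average divfK ?expf_neq0 ?pnatr_eq0//.
    by rewrite (bigD1 x) ?xm ?eqxx//= lerDl sumr_ge0.
  by have /eqP := le_anti (andb_true_intro (conj G0 (G_ge0 x))); rewrite powR_eq0 => /andP[/eqP].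
pose q := tau `^ (1 - r).
have q_ge0 : 0 <= q by exact: powR_ge0.
have q_lt1 : q < 1.
  by rewrite /q /powR gt_eqF// expR_lt1 pmulr_llt0 ?ln_gt0// subr_lt0.
pose C2 : R := 576 * (96 * bessel_const + 1).
have C2_ge0 : 0 <= C2 by rewrite /C2; lra.
have term A : \sum_(x < T | (x %/ 2 ^ K == m)%N) g x * part A x <=
    (C2 * decay ^+ A + 96 * M * q ^+ A) * (top_mass f K m * mu).
  set th := mu * tau ^+ A.
  pose w1 x := if (x %/ 2 ^ K == m)%N && (g x <= th) then g x else 0.
  pose w2 x := if g x <= th then 0 else g x.
  have w1_ge0 x : 0 <= w1 x by rewrite /w1; case: ifP.
  have w2_ge0 x : 0 <= w2 x by rewrite /w2; case: ifP.
  apply: (@le_trans _ _ (\sum_(x < T) w1 x * part A x + \sum_(x < T) w2 x * part A x)).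
    rewrite -big_split/= [leLHS]big_mkcond; apply: ler_sum => x _.
    rewrite -mulrDl /w1 /w2; case: ifP => xm /=; last by rewrite add0r mulr_ge0 ?normr_ge0//; case: ifP.
    by case: ifP => _; rewrite ?add0r ?addr0.
  rewrite mulrDl; apply: lerD.
    rewrite -(ler_pXn2r (ltn0Sn 1)) ?nnegrE; last 2 first.
    - by apply: sumr_ge0 => x _; rewrite mulr_ge0 ?normr_ge0.
    - by apply: mulr_ge0; [apply: mulr_ge0 => //; apply: exprn_ge0; exact: ltW|exact: mulr_ge0].
    apply: le_trans (sum_Cauchy_Schwarz _ _) _.
    have S0 : 0 <= \sum_(x < T) part A x ^+ 2 by apply: sumr_ge0 => x _; exact: sqr_ge0.
    apply: le_trans (ler_wpM2r S0 (low_height_sum A)) _.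
    rewrite -(mulrA (mu ^+ 2 * tau ^+ A)).
    apply: le_trans (ler_wpM2l _ (part_square_decay A)) _.
      by apply: mulr_ge0; [exact: sqr_ge0|apply: exprn_ge0; exact: ltW].
    rewrite le_eqVlt; apply/orP; left; apply/eqP.
    have -> : tau ^+ A = (decay ^+ A) ^- 2 by rewrite /tau exprVn -!exprM mulnC.
    have -> : decay ^+ (2 * A) = (decay ^+ A) ^+ 2 by rewrite mulnC exprM.
    have : decay ^+ A != 0 by rewrite expf_neq0// gt_eqF.
    rewrite -/C2; move: (decay ^+ A) (top_mass f K m) (C2) (mu) => D W C mu' D0.
    by field.
  have := @part_weighted_sum _ f G K m f_ge0 _ _ _ _ kern_bound correlation decay8_itv N A w2
    (48 * mu * q ^+ A) w2_ge0.
  have W0 : 0 <= 48 * mu * q ^+ A by apply: mulr_ge0; [exact: mulr_ge0|exact: exprn_ge0].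
  move=> /(_ W0 (fun k x _ live => high_height_cell A mu_neq0 live)) H.
  by apply: le_trans H _; rewrite le_eqVlt; apply/orP; left; apply/eqP; ring.
apply: (@le_trans _ _ (\sum_(A < K.+1) \sum_(x < T | (x %/ 2 ^ K == m)%N) g x * part A x)).
  rewrite exchange_big/=; apply: ler_sum => x /eqP xm; rewrite -mulr_sumr ler_wpM2l//.
  exact: live_sum_parts kern_bound correlation decay8_itv N _ xm.
apply: (@le_trans _ _ (\sum_(A < K.+1)
    (C2 * decay ^+ A + 96 * M * q ^+ A) * (top_mass f K m * mu))).
  by apply: ler_sum => A _; exact: term.
rewrite -mulr_suml -[leRHS]mulrA ler_wpM2r ?mulr_ge0//.
rewrite big_split/= -!mulr_sumr.
have s1 := geometric_sum_le K.+1 decay_itv.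
have q1 : \sum_(A < K.+1) q ^+ A <= (1 + ln tau) / ln tau / (r - 1).
  apply: le_trans (powR_geometric tau_gt1 r_itv).
  by apply: geometric_sum_le; rewrite q_ge0 q_lt1.
have sgE : (1 - decay)^-1 = 64 by rewrite /decay; field.
rewrite sgE in s1.
have rr : 1 <= (r - 1)^-1 by rewrite invf_ge1 ?subr_gt0//; lra.
rewrite /local_const -/C2 [leRHS]mulrDl; apply: lerD.
  apply: (@le_trans _ _ (C2 * 64)); first by rewrite ler_wpM2l.
  by rewrite [C2 * _]mulrC ler_peMr// mulr_ge0.
by rewrite -!mulrA ler_wpM2l// ler_wpM2l// mulrA.
Qed.

End LocalBound.

(** * Selection of the cells *)

Lemma sum_cell_widen (R : nmodType) (h : nat -> R) k p T : (p.+1 * 2 ^ k <= T)%N ->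
  \sum_(x < T | (x %/ 2 ^ k == p)%N) h x =
  \sum_(x < p.+1 * 2 ^ k | (x %/ 2 ^ k == p)%N) h x.
Proof.
move=> le_T; rewrite [RHS](big_ord_widen_cond T (fun x => x %/ 2 ^ k == p)%N)//.
apply: eq_bigl => x; case: eqP => //= xp; symmetry.
by rewrite -xp ltn_ceil// expn_gt0.
Qed.

Lemma cell_end k K x m : (k <= K -> x %/ 2 ^ K = m ->
  (x %/ 2 ^ k).+1 * 2 ^ k <= m.+1 * 2 ^ K)%N.
Proof.
move=> kK xm; rewrite -(subnK kK) expnD mulnA leq_mul2r; apply/orP; right.
by rewrite ltn_divLR ?expn_gt0// -mulnA -expnD subnK// -xm ltn_ceil// expn_gt0.
Qed.

Section Children.
Context {R : archiRealFieldType} (f G : nat -> R).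
Hypotheses (f_ge0 : forall y, 0 <= f y) (G_ge0 : forall y, 0 <= G y).

Definition major K m x := (x %/ 2 ^ K == m)%N && (exit_scale f G K m x == 0)%N.

Lemma exit_scale_gt0 K m x : (0 < exit_scale f G K m x)%N = [exists k : 'I_K.+1, stopping f G K m k x].
Proof.
rewrite ltnNge exit_scale_le negb_forall; apply: eq_existsb => k.
by rewrite negb_imply leq0n negbK.
Qed.

Lemma major_count K m :
  3 / 4 * 2 ^+ K <= \sum_(x < m.+1 * 2 ^ K | major K m x) (1 : R).
Proof.
have cellE : \sum_(x < m.+1 * 2 ^ K | (x %/ 2 ^ K == m)%N) (1 : R) = 2 ^+ K.
  rewrite big_mkcond (sum_cells (fun x => if (x %/ 2 ^ K == m)%N then 1 else 0)).
  rewrite big_ord_recr/= big1 => [|q _]; last first.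
    by rewrite big1// => u _; rewrite cell_index ltn_eqF.
  rewrite add0r -natrX -[X in X%:R]card_ord -sumr_const.
  by apply: eq_bigr => u _; rewrite cell_index eqxx.
have := stopped_count K m f_ge0 G_ge0.
suff -> : \sum_(x < m.+1 * 2 ^ K | major K m x) (1 : R) =
    2 ^+ K - \sum_(x < m.+1 * 2 ^ K | stopped f G K m x) 1 by lra.
rewrite -cellE; apply/eqP; rewrite eq_sym subr_eq; apply/eqP.
rewrite [LHS]big_mkcond [X in X + _]big_mkcond [X in _ + X]big_mkcond -big_split/=.
apply: eq_bigr => x _; rewrite /major /stopped -exit_scale_gt0 lt0n.
by do 2 case: eqP; rewrite /= ?addr0 ?add0r.
Qed.

(** A stop at the top scale would stop every point of the cell, against [major_count]. Hence the
    children have smaller scale and the recursion ends. *)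
Lemma exit_scale_le_top K m x : (x %/ 2 ^ K = m)%N -> (exit_scale f G K m x <= K)%N.
Proof.
move=> xm; rewrite exit_scale_le; apply/forallP => k; apply/implyP => Kk; apply/negP => st.
have := major_count K m; rewrite leNgt => /negP; apply.
rewrite big_pred0; first by rewrite mulr_gt0 ?exprn_gt0 ?divr_gt0.
move=> x'; apply/andP => -[/eqP x'm]; rewrite eqn0Ngt exit_scale_gt0 => /negP; apply.
apply/existsP; exists k; rewrite -(@stop_cell _ _ _ _ _ _ x)//.
by rewrite (_ : nat_of_ord k = K) ?x'm//; apply/eqP; rewrite eqn_leq Kk -ltnS ltn_ord.
Qed.

Lemma exit_scale_same_cell K m k x x' : (x %/ 2 ^ k = x' %/ 2 ^ k)%N -> exit_scale f G K m x = k.+1 ->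
  exit_scale f G K m x' = k.+1.
Proof.
move=> xx' kx; apply/eqP; rewrite eqn_leq -(@exit_scale_cell _ _ _ _ _ _ x); last first.
  exact: divn_cell (leqnSn k) xx'.
by rewrite kx leqnn ltnNge -(@exit_scale_cell _ _ _ _ _ _ x)// kx ltnn.
Qed.

(** The maximal stopping cells: the largest scale that stops at [x] is [(exit_scale x).-1]. *)
Definition is_child K m (c : nat * nat) := [exists x : 'I_(m.+1 * 2 ^ K),
  [&& x %/ 2 ^ K == m, exit_scale f G K m x == c.1.+1 & x %/ 2 ^ c.1 == c.2]%N].

Definition children K m : seq (nat * nat) :=
  [seq c <- allpairs pair (iota 0 K) (iota 0 (m.+1 * 2 ^ K)) | is_child K m c].

Lemma children_scale K m c : c \in children K m -> (c.1 < K)%N.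
Proof.
by rewrite mem_filter => /andP[_ /allpairsP[p [+ _ ->]]]; rewrite mem_iota.
Qed.

Lemma children_uniq K m : uniq (children K m).
Proof.
by rewrite filter_uniq// allpairs_uniq ?iota_uniq// => -[? ?] [? ?] _ _ /= [-> ->].
Qed.

Lemma children_mem K m x c : (x %/ 2 ^ c.1 == c.2)%N && (c \in children K m) =
  [&& x %/ 2 ^ K == m, 0 < exit_scale f G K m x &
      c == ((exit_scale f G K m x).-1, x %/ 2 ^ (exit_scale f G K m x).-1)]%N.
Proof.
apply/andP/and3P => [[/eqP xc]|[/eqP xm k_gt0 /eqP->]]; last first.
  rewrite eqxx mem_filter; split=> //; apply/andP; split.
    have xT : (x < m.+1 * 2 ^ K)%N by rewrite -xm ltn_ceil// expn_gt0.
    apply/existsP; exists (Ordinal xT) => /=.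
    by rewrite prednK// xm !eqxx.
  apply/allpairsP; exists ((exit_scale f G K m x).-1, (x %/ 2 ^ (exit_scale f G K m x).-1))%N.
  split=> //=; rewrite mem_iota /= add0n; first by rewrite prednK// exit_scale_le_top.
  by rewrite (leq_ltn_trans (leq_div _ _))// -xm ltn_ceil// expn_gt0.
rewrite mem_filter => /andP[/existsP[x0 /and3P[/eqP x0m /eqP kx0 /eqP x0c]]].
case/allpairsP => p [+ _ cE]; rewrite mem_iota /= add0n => pK.
have cK : (c.1 <= K)%N by rewrite cE ltnW.
have x0x : (x0 %/ 2 ^ c.1 = x %/ 2 ^ c.1)%N by rewrite x0c.
have kx := exit_scale_same_cell x0x kx0.
rewrite kx /= xc -(divn_cell cK x0x) x0m; split=> //.
by case: (c).
Qed.

Lemma sum_children (V : nmodType) K m x (h : nat * nat -> V) :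
  \sum_(c <- children K m | (x %/ 2 ^ c.1 == c.2)%N) h c =
  if (x %/ 2 ^ K == m)%N && (0 < exit_scale f G K m x)%N
  then h ((exit_scale f G K m x).-1, x %/ 2 ^ (exit_scale f G K m x).-1)%N else 0.
Proof.
set c0 := ((exit_scale f G K m x).-1, _)%N.
have [x_in|x_out] := boolP ((x %/ 2 ^ K == m) && (0 < exit_scale f G K m x))%N; last first.
  rewrite big_seq_cond big_pred0// => c.
  by rewrite andbC children_mem andbA (negbTE x_out).
have /andP[_ c0_in] : (x %/ 2 ^ c0.1 == c0.2)%N && (c0 \in children K m).
  by rewrite children_mem andbA x_in eqxx.
rewrite big_mkcond (bigD1_seq c0) ?children_uniq//= eqxx big_seq_cond big1 ?addr0// => c.
move=> /andP[c_in c_neq]; case: ifP => // xc.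
have : (x %/ 2 ^ c.1 == c.2)%N && (c \in children K m) by rewrite xc.
by rewrite children_mem (negbTE c_neq) !andbF.
Qed.

End Children.

Section Selection.
Context {R : realType} (f g : nat -> R) (r : R).
Hypotheses (f_ge0 : forall y, 0 <= f y) (g_ge0 : forall y, 0 <= g y).
Hypothesis r_itv : 1 < r < 2.
Context (b : nat -> R) (M C0 : R).
Hypothesis kern_bound : forall k n, `|kern b k n| <= M / 2 ^+ k.
Hypothesis correlation : correlation_decay b C0 (decay ^+ 8).
Context (N : nat -> nat).

Let G x := g x `^ r.
Let G_ge0 x : 0 <= G x. Proof. exact: powR_ge0. Qed.

Definition scale_sum K x := `|\sum_(y < x | (N x <= x - y)%N && (trunc_log 2 (x - y) <= K)%N)
  b (x - y)%N * f y|.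

(** The scales below the exit scale are exactly those left to the child containing [x]. *)
Lemma scale_sum_split K m x : (x %/ 2 ^ K = m)%N ->
  scale_sum K x <= live_sum f G K m b N x +
    (if (0 < exit_scale f G K m x)%N then scale_sum (exit_scale f G K m x).-1 x else 0).
Proof.
move=> xm; set kx := exit_scale f G K m x.
have xT : (x <= m.+1 * 2 ^ K)%N by rewrite -xm ltnW// ltn_ceil// expn_gt0.
have kxK : (kx <= K)%N by exact: exit_scale_le_top.
rewrite /scale_sum (bigID (fun y : 'I_x => kx <= trunc_log 2 (x - y))%N)/=.
apply: le_trans (ler_normD _ _) _; apply: lerD.
  rewrite (big_ord_widen_cond _ (fun y => (N x <= x - y) && (trunc_log 2 (x - y) <= K) &&
    (kx <= trunc_log 2 (x - y)))%N (fun y => b (x - y)%N * f y) xT).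
  rewrite le_eqVlt; apply/orP; left; apply/eqP; congr `|_|; apply: eq_bigl => y.
  by rewrite -/kx; case: (y < x)%N; rewrite ?andbF//= andbT -andbA [X in _ && X]andbC.
case: ifP => [k_gt0|/negbT]; last first.
  by rewrite -eqn0Ngt => /eqP->; rewrite big_pred0 ?normr0// => y; rewrite leq0n andbF.
rewrite le_eqVlt; apply/orP; left; apply/eqP; congr `|_|; apply: eq_bigl => y.
rewrite -ltnNge -andbA; congr (_ && _).
by rewrite -[in RHS]ltnS prednK//; apply: andb_idl => H; rewrite ltnW// (leq_trans H).
Qed.

Definition cell_mu (c : nat * nat) := cell_average G c.1 c.2 `^ r^-1.

(** Counting major parts with multiplicity expresses in one inequality that they are disjoint and
    lie in the top cell; it will also exclude repeated cells. *)
Lemma selection K m : exists cs : seq (nat * nat),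
  (forall x, \sum_(c <- cs) (major f G c.1 c.2 x : nat) <= (x %/ 2 ^ K == m))%N /\
  \sum_(x < m.+1 * 2 ^ K | (x %/ 2 ^ K == m)%N) g x * scale_sum K x <=
  local_const M C0 / (r - 1) * \sum_(c <- cs) top_mass f c.1 c.2 * cell_mu c.
Proof.
elim/ltn_ind: K m => K IHK m.
pose ok (c : nat * nat) cs :=
  (forall x, \sum_(c <- cs) (major f G c.1 c.2 x : nat) <= (x %/ 2 ^ c.1 == c.2))%N /\
  \sum_(x < c.2.+1 * 2 ^ c.1 | (x %/ 2 ^ c.1 == c.2)%N) g x * scale_sum c.1 x <=
  local_const M C0 / (r - 1) * \sum_(c <- cs) top_mass f c.1 c.2 * cell_mu c.
have /choice[sel sel_ok] : forall c : nat * nat, exists cs, (c.1 < K)%N -> ok c cs.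
  by move=> c; have [/IHK/(_ c.2)[cs ?]|] := ltnP c.1 K; [exists cs|exists [::]].
pose ch := children f G K m.
exists ((K, m) :: flatten [seq sel c | c <- ch]); split=> [x|].
  rewrite big_cons big_flatten big_map/=.
  apply: (@leq_trans (major f G K m x + \sum_(c <- ch) (x %/ 2 ^ c.1 == c.2)))%N.
    rewrite leq_add2l big_seq [leqRHS]big_seq; apply: leq_sum => c c_in.
    by have [/(_ x)] := sel_ok c (children_scale c_in).
  rewrite (eq_bigr (fun c : nat * nat => if (x %/ 2 ^ c.1 == c.2)%N then 1%N else 0%N)); last first.
    by move=> c _; case: eqP.
  rewrite -big_mkcond/= (sum_children f_ge0 G_ge0 K m x (fun=> 1%N)) /major.
  by rewrite eqn0Ngt; do 2 case: (_ %/ _ == _)%N => //=; case: (0 < _)%N.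
rewrite big_cons mulrDr.
set T := (m.+1 * 2 ^ K)%N.
apply: (@le_trans _ _ (\sum_(x < T | (x %/ 2 ^ K == m)%N) g x * live_sum f G K m b N x +
    \sum_(c <- ch) \sum_(x < c.2.+1 * 2 ^ c.1 | (x %/ 2 ^ c.1 == c.2)%N) g x * scale_sum c.1 x)).
  have -> : \sum_(c <- ch) \sum_(x < c.2.+1 * 2 ^ c.1 | (x %/ 2 ^ c.1 == c.2)%N) g x * scale_sum c.1 x =
      \sum_(x < T) \sum_(c <- ch | (x %/ 2 ^ c.1 == c.2)%N) g x * scale_sum c.1 x.
    rewrite [RHS](exchange_big_dep xpredT)//= big_seq [RHS]big_seq; apply: eq_bigr => c c_in.
    symmetry; apply: (sum_cell_widen (fun x => g x * scale_sum c.1 x)).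
    have cK := children_scale c_in.
    move: c_in; rewrite mem_filter => /andP[/existsP[x0 /and3P[/eqP x0m _ /eqP <-]] _].
    exact: cell_end (ltnW cK) x0m.
  rewrite [X in X + _]big_mkcond -big_split/= [leLHS]big_mkcond; apply: ler_sum => x _.
  rewrite (sum_children f_ge0 G_ge0 K m x (fun c => g x * scale_sum c.1 x)).
  case: ifP => [/eqP xm|_]; last by rewrite addr0.
  apply: le_trans (ler_wpM2l (g_ge0 x) (scale_sum_split xm)) _.
  by rewrite mulrDr /=; case: ifP; rewrite ?mulr0.
apply: lerD.
  rewrite mulrA; exact: local_bound.
rewrite big_flatten big_map/= mulr_sumr big_seq [leRHS]big_seq; apply: ler_sum => c c_in.
by have [_] := sel_ok c (children_scale c_in).
Qed.

End Selection.

Local Open Scope classical_set_scope.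
Local Open Scope ring_scope.

(** * Means of bounded random variables *)

Section Bounded.
Context {d : measure_display} {Omega : measurableType d} {R : realType}
  (P : probability Omega R).

Definition bounded_rv (h : Omega -> R) :=
  measurable_fun setT h /\ exists c, forall w, `|h w| <= c.

Lemma bounded_rv_integrable h : bounded_rv h -> P.-integrable setT (EFin \o h).
Proof.
move=> [mh [c hc]]; apply: measurable_bounded_integrable => //.
  exact: le_lt_trans (probability_le1 P measurableT) (ltry 1).
by exists c; split=> [|x cx w _]; [exact: num_real|exact: le_trans (hc w) (ltW cx)].
Qed.

Lemma bounded_rvD h1 h2 : bounded_rv h1 -> bounded_rv h2 ->
  bounded_rv (fun w => h1 w + h2 w).
Proof.
move=> [m1 [c1 b1]] [m2 [c2 b2]]; split; first exact: measurable_funD.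
by exists (c1 + c2) => w; rewrite (le_trans (ler_normD _ _))// lerD.
Qed.

Lemma bounded_rvM h1 h2 : bounded_rv h1 -> bounded_rv h2 ->
  bounded_rv (fun w => h1 w * h2 w).
Proof.
move=> [m1 [c1 b1]] [m2 [c2 b2]]; split; first exact: measurable_funM.
by exists (c1 * c2) => w; rewrite normrM ler_pM.
Qed.

Lemma bounded_rv_cst (c : R) : bounded_rv (fun=> c).
Proof. by split=> //; exists `|c|. Qed.

Lemma bounded_rv_indic (A : set Omega) : measurable A -> bounded_rv (\1_A : Omega -> R).
Proof.
move=> mA; split; first exact: measurable_indic.
by exists 1 => w; rewrite indicE; case: (_ \in _); rewrite ?normr1 ?normr0.
Qed.

Lemma bounded_rv_sum (I : Type) (s : seq I) (Q : pred I) (h : I -> Omega -> R) :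
  (forall i, Q i -> bounded_rv (h i)) -> bounded_rv (fun w => \sum_(i <- s | Q i) h i w).
Proof.
move=> bh; elim: s => [|i s IHs].
  by under eq_fun do rewrite big_nil; exact: bounded_rv_cst.
under eq_fun do rewrite big_cons.
by case Qi: (Q i) => //; apply: bounded_rvD => //; exact: bh.
Qed.

Lemma bounded_rv_prod (I : Type) (s : seq I) (h : I -> Omega -> R) :
  (forall i, bounded_rv (h i)) -> bounded_rv (fun w => \prod_(i <- s) h i w).
Proof.
move=> bh; elim: s => [|i s IHs].
  by under eq_fun do rewrite big_nil; exact: bounded_rv_cst.
by under eq_fun do rewrite big_cons; apply: bounded_rvM.
Qed.

Definition mean (h : Omega -> R) : R := \int[P]_w h w.

Lemma eq_mean h1 h2 : h1 =1 h2 -> mean h1 = mean h2.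
Proof. by move=> /funext ->. Qed.

Lemma meanD h1 h2 : bounded_rv h1 -> bounded_rv h2 ->
  mean (fun w => h1 w + h2 w) = mean h1 + mean h2.
Proof. by move=> b1 b2; rewrite /mean RintegralD//; exact: bounded_rv_integrable. Qed.

Lemma meanZ c h : bounded_rv h -> mean (fun w => c * h w) = c * mean h.
Proof. by move=> bh; rewrite /mean RintegralZl//; exact: bounded_rv_integrable. Qed.

Lemma mean_cst c : mean (fun=> c) = c.
Proof. by rewrite /mean Rintegral_cst// [X in fine X]probability_setT mulr1. Qed.

Lemma mean_sum (I : Type) (s : seq I) (Q : pred I) (h : I -> Omega -> R) :
  (forall i, Q i -> bounded_rv (h i)) ->
  mean (fun w => \sum_(i <- s | Q i) h i w) = \sum_(i <- s | Q i) mean (h i).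
Proof.
move=> bh; elim: s => [|i s IHs].
  by rewrite big_nil -[RHS](mean_cst 0); apply: eq_mean => w; rewrite big_nil.
rewrite big_cons -IHs; case: ifPn => Qi.
  rewrite -meanD; [|exact: bh|exact: bounded_rv_sum].
  by apply: eq_mean => w; rewrite big_cons Qi.
by apply: eq_mean => w; rewrite big_cons (negbTE Qi).
Qed.

Lemma le_mean h1 h2 : bounded_rv h1 -> bounded_rv h2 -> (forall w, h1 w <= h2 w) ->
  mean h1 <= mean h2.
Proof.
by move=> b1 b2 h12; apply: le_Rintegral => //; exact: bounded_rv_integrable.
Qed.

Lemma mean_norm_le h c : bounded_rv h -> (forall w, `|h w| <= c) -> `|mean h| <= c.
Proof.
move=> bh hc; rewrite ler_norml -{1}(mean_cst (- c)) -{2}(mean_cst c).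
by apply/andP; split; apply: le_mean => //; [exact: bounded_rv_cst| |exact: bounded_rv_cst|];
   move=> w; have := hc w; rewrite ler_norml => /andP[].
Qed.

Lemma mean_indic A : measurable A -> mean \1_A = fine (P A).
Proof. by move=> mA; rewrite /mean /Rintegral integral_indic// setIT. Qed.

(** The sum is the integer part of [t]. *)
Lemma staircase (t : R) n : 0 <= t <= n%:R ->
  t - 1 <= \sum_(i < n) (i.+1%:R <= t)%R%:R <= t.
Proof.
elim: n => [|n IHn] /andP[t0 tn].
  by rewrite big_ord0 t0 andbT; move: tn; lra.
rewrite big_ord_recr/=; have [le_tn|lt_nt] := lerP t n%:R.
  rewrite (_ : (n.+1%:R <= t) = false) ?addr0 ?IHn ?t0//.
  by apply/negbTE; rewrite -ltNge (le_lt_trans le_tn)// ltr_nat.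
rewrite (eq_bigr (fun=> 1)) => [|i _]; last first.
  by rewrite (le_trans _ (ltW lt_nt))// ler_nat.
rewrite sumr_const card_ord; have := mulrSr (1 : R) n.
by case: (lerP n.+1%:R t) => /=; lra.
Qed.

(* Functions of [Z] are uniformly approximated by combinations of indicators
   of events on [Z]. *)
Lemma mean_comp0 (H : Omega -> R) (Z : {mfun Omega >-> R}) (tau : R -> R) (M : R) :
  bounded_rv H -> measurable_fun setT tau -> (forall x, `|tau x| <= M) ->
  (forall B : set R, measurable B -> mean (fun w => H w * \1_(Z @^-1` B) w) = 0) ->
  mean (fun w => H w * tau (Z w)) = 0.
Proof.
move=> bH mtau tauM H0; have [c Hc] := bH.2.
have M0 : 0 <= M by exact: le_trans (tauM 0).
have c0 : 0 <= c by apply: le_trans (Hc point).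
have btau : bounded_rv (fun w => tau (Z w)).
  split; last by exists M => w; exact: tauM.
  by apply: measurableT_comp => //; exact: measurable_funP.
(* Adding [M] makes the function nonnegative, as the staircase requires; it is harmless because [H]
   has mean 0, by the event [setT]. *)
have shift : mean (fun w => H w * tau (Z w)) = mean (fun w => H w * (tau (Z w) + M)).
  rewrite -[LHS]addr0 -(mulr0 M) -(H0 setT measurableT) -meanZ -?meanD.
  - by apply: eq_mean => w; rewrite preimage_setT indicT /=; ring.
  - exact: bounded_rvM.
  - apply: bounded_rvM; first exact: bounded_rv_cst.
    by apply: bounded_rvM => //; apply: bounded_rv_indic; rewrite preimage_setT.
  - by apply: bounded_rvM => //; apply: bounded_rv_indic; rewrite preimage_setT.
have bound q : `|mean (fun w => H w * (tau (Z w) + M))| <= c / q.+1%:R.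
  have q0 : 0 < q.+1%:R :> R by [].
  pose n := Num.bound (2 * M * q.+1%:R).
  pose B i := [set x | i.+1%:R <= (tau x + M) * q.+1%:R].
  have mB i : measurable (B i).
    rewrite /B -[X in measurable X]setTI.
    apply: measurable_fun_ler => //; apply: measurable_funM => //.
    exact: measurable_funD.
  pose S w : R := \sum_(i < n) q.+1%:R^-1 * \1_(Z @^-1` B i) w.
  have bS : bounded_rv S.
    apply: bounded_rv_sum => i _; apply: bounded_rvM; first exact: bounded_rv_cst.
    apply: bounded_rv_indic; exact: measurable_funPTI.
  have S0 : mean (fun w => H w * S w) = 0.
    transitivity (\sum_(i < n) q.+1%:R^-1 * mean (fun w => H w * \1_(Z @^-1` B i) w)).
      have bi (i : 'I_n) : bounded_rv (fun w => H w * \1_(Z @^-1` B i) w).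
        by apply: bounded_rvM => //; apply: bounded_rv_indic; exact: measurable_funPTI.
      under [RHS]eq_bigr => i _ do rewrite -(meanZ _ (bi i)).
      rewrite -mean_sum; last by move=> i _; apply: bounded_rvM => //; exact: bounded_rv_cst.
      by apply: eq_mean => w; rewrite /S mulr_sumr; apply: eq_bigr => i _; ring.
    by rewrite big1// => i _; rewrite H0// mulr0.
  have -> : mean (fun w => H w * (tau (Z w) + M)) =
      mean (fun w => H w * (tau (Z w) + M - S w)).
    rewrite -[LHS]addr0 -(mulr0 (-1)) -S0 -meanZ -?meanD.
    - by apply: eq_mean => w; ring.
    - apply: bounded_rvM => //; apply: bounded_rvD => //; exact: bounded_rv_cst.
    - by apply: bounded_rvM; [exact: bounded_rv_cst|exact: bounded_rvM].
    - exact: bounded_rvM.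
  apply: mean_norm_le => [|w].
    apply: bounded_rvM => //; apply: bounded_rvD; first by apply: bounded_rvD => //; exact: bounded_rv_cst.
    have -> : (fun w => - S w) = (fun w => -1 * S w) by apply/funext => w; ring.
    by apply: bounded_rvM => //; exact: bounded_rv_cst.
  rewrite normrM ler_pM//.
  set t := (tau (Z w) + M) * q.+1%:R.
  have tM := tauM (Z w); rewrite ler_norml in tM; case/andP: tM => tM1 tM2.
  have t0 : 0 <= t by rewrite mulr_ge0//; lra.
  have tn : t <= n%:R.
    apply: (@le_trans _ _ (2 * M * q.+1%:R)); first by rewrite ler_pM2r//; lra.
    by rewrite ltW// archi_boundP// mulr_ge0// mulr_ge0.
  have := @staircase t n; rewrite t0 tn => /(_ isT).
  have -> : \sum_(i < n) (i.+1%:R <= t)%R%:R = q.+1%:R * S w.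
    rewrite /S mulr_sumr; apply: eq_bigr => i _.
    rewrite mulrA divff ?gt_eqF// mul1r indicE; congr (nat_of_bool _)%:R.
    by apply/idP/idP => [h|/set_mem//]; apply/mem_set.
  have -> : tau (Z w) + M = t / q.+1%:R by rewrite /t mulfK// gt_eqF.
  set z := S w => /andP[h1 h2].
  have -> : t / q.+1%:R - z = (t - q.+1%:R * z) / q.+1%:R by field; rewrite gt_eqF.
  rewrite normrM (ger0_norm (_ : 0 <= q.+1%:R^-1)) ?invr_ge0//.
  by rewrite -[leRHS]mul1r ler_pM2r ?invr_gt0// ger0_norm; lra.
rewrite shift; apply/eqP; rewrite -normr_le0; apply/ler_addgt0Pr => e e0; rewrite add0r.
apply: le_trans (bound (Num.bound (c / e))) _.
rewrite ler_pdivrMr// mulrC -ler_pdivrMr// ltW// (lt_trans (archi_boundP _))//.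
  by rewrite divr_ge0// ltW.
by rewrite ltr_nat.
Qed.

End Bounded.

(** * Truncated independent variables *)

Section Independent.
Context {d : measure_display} {Omega : measurableType d} {R : realType}
  (P : probability Omega R) (X : nat -> {RV P >-> R}) (M : R).
Hypothesis M_gt0 : 0 < M.
Hypothesis X_bounded : forall n, (1 <= n)%N -> {ae P, forall w, `|X n w| <= M}.
Hypothesis X_indep : mutually_independent [set n : nat | (1 <= n)%N] X.
Hypothesis X_mean0 : forall n, (1 <= n)%N -> ('E_P[X n] = 0)%E.

(** The variables are bounded by [M] only almost surely; their truncations are so everywhere, and
    agree with them almost surely. *)
Definition truncate (x : R) : R := x * \1_[set y | `|y| <= M] x.

Lemma truncateE x : `|x| <= M -> truncate x = x.
Proof. by move=> xM; rewrite /truncate indicE mem_set// mulr1. Qed.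

Lemma truncate_bound x : `|truncate x| <= M.
Proof.
rewrite /truncate indicE; case: (boolP (x \in _)) => [/set_mem|_] /=.
  by rewrite mulr1.
by rewrite mulr0 normr0 ltW.
Qed.

Lemma measurable_truncate : measurable_fun setT truncate.
Proof.
apply: measurable_funM => //; apply: measurable_indic.
by rewrite -[X in measurable X]setTI; apply: measurable_fun_ler.
Qed.

(** Independence and mean zero are given from index 1 on; the value 0 at index 0 extends the moment
    identities to all indices. *)
Definition truncated n w : R := if n is 0%N then 0 else truncate (X n w).

Lemma truncated_bound n w : `|truncated n w| <= M.
Proof. by case: n => [|n]; rewrite /truncated ?normr0 ?(ltW M_gt0)// truncate_bound. Qed.

Lemma bounded_truncated n : bounded_rv (truncated n).
Proof.
split; last by exists M; exact: truncated_bound.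
case: n => [|n]; first exact: measurable_cst.
rewrite (_ : truncated n.+1 = truncate \o X n.+1)//.
by apply: measurableT_comp => //; exact: measurable_truncate.
Qed.

Lemma mean_truncated n : mean P (truncated n) = 0.
Proof.
case: n => [|n]; first exact: mean_cst.
rewrite /mean /Rintegral -[RHS]/(fine 0%E) -(X_mean0 (ltn0Sn n)) unlock; congr fine.
apply: ae_eq_integral => //.
- by apply/measurable_EFinP; case: (bounded_truncated n.+1).
- by apply/measurable_EFinP.
apply: filterS (X_bounded (ltn0Sn n)) => w Xw _.
by rewrite /truncated truncateE.
Qed.

Let ev (J : {fset nat}) (A : nat -> set R) := \bigcap_(j in [set` J]) (X j @^-1` A j).

Let measurable_ev J A : (forall j, measurable (A j)) -> measurable (ev J A).
Proof.
move=> mA; apply: fin_bigcap_measurable; first exact: finite_fset.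
by move=> j _; exact: measurable_funPTI.
Qed.

Let ev_add (J : {fset nat}) (A : nat -> set R) n B : n \notin J ->
  ev (n |` J)%fset (fun j => if j == n then B else A j) = X n @^-1` B `&` ev J A.
Proof.
move=> nJ; apply/seteqP; split=> w /=.
  move=> H; split; first by have := H n; rewrite /= fset1U1 eqxx; apply.
  move=> j jJ /=; have := H j; rewrite /= fset1Ur// => /(_ isT).
  by case: eqP => // jn; rewrite jn in jJ; rewrite jJ in nJ.
move=> [Bn HJ] j /=; rewrite in_fset1U => /orP[/eqP->|jJ]; first by rewrite eqxx.
by case: eqP => [->//|_]; exact: HJ.
Qed.

Let ev_cut (J : {fset nat}) (A : nat -> set R) n B : n \in J ->
  ev J (fun j => if j == n then A j `&` B else A j) = X n @^-1` B `&` ev J A.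
Proof.
move=> nJ; apply/seteqP; split=> w /=.
  move=> H; split; first by have := H n nJ; rewrite /= eqxx => -[].
  by move=> j jJ /=; have := H j jJ; rewrite /=; case: eqP => // _ [].
move=> [Bn HJ] j jJ /=; case: eqP => [jn|_]; last exact: HJ.
by split; [exact: HJ|rewrite /= jn].
Qed.

Let P_ev J A : (forall j, j \in J -> (1 <= j)%N) -> (forall j, measurable (A j)) ->
  P (ev J A) = (\prod_(j <- J) P (X j @^-1` A j))%E.
Proof. by move=> J1 mA; rewrite X_indep. Qed.

(** Centring the indicator at [p] turns the product formula into orthogonality to all events on
    [X n], which is what [mean_comp0] asks for. *)
Lemma mean_event_truncated (J : {fset nat}) A n : (1 <= n)%N -> n \notin J ->
  (forall j, j \in J -> (1 <= j)%N) -> (forall j, measurable (A j)) ->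
  mean P (fun w => \1_(ev J A) w * truncated n w) = 0.
Proof.
move=> n1 nJ J1 mA; have mE := measurable_ev J mA.
have bE : bounded_rv (\1_(ev J A) : Omega -> R) by exact: bounded_rv_indic.
set p := fine (P (ev J A)).
have bH : bounded_rv (fun w => \1_(ev J A) w - p).
  by apply: bounded_rvD => //; exact: bounded_rv_cst.
suff : mean P (fun w => (\1_(ev J A) w - p) * truncate (X n w)) = 0.
  move=> H; transitivity (mean P (fun w => \1_(ev J A) w * truncated n w) + (- p) * mean P (truncated n)).
    by rewrite mean_truncated mulr0 addr0.
  rewrite -meanZ; last exact: bounded_truncated.
  rewrite -meanD; last 2 first.
  - exact: bounded_rvM (bounded_truncated n).
  - by apply: bounded_rvM; [exact: bounded_rv_cst|exact: bounded_truncated].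
  rewrite -[RHS]H; apply: eq_mean => w.
  by case: (n) n1 => // n' _; rewrite /truncated; ring.
apply: (mean_comp0 bH measurable_truncate truncate_bound) => B mB.
have mXB : measurable (X n @^-1` B) by exact: measurable_funPTI.
have bB : bounded_rv (\1_(X n @^-1` B) : Omega -> R) by exact: bounded_rv_indic.
transitivity (mean P (\1_(X n @^-1` B `&` ev J A)) + (- p) * mean P \1_(X n @^-1` B)).
  rewrite -meanZ// -meanD; last 2 first.
  - by apply: bounded_rv_indic; exact: measurableI.
  - by apply: bounded_rvM => //; exact: bounded_rv_cst.
  by apply: eq_mean => w; rewrite indicI /=; ring.
rewrite !mean_indic//; last exact: measurableI.
rewrite -ev_add// P_ev; last 2 first.
- by move=> j; rewrite in_fset1U => /orP[/eqP->|/J1].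
- by move=> j; case: eqP.
rewrite big_fsetU1//= eqxx.
rewrite (_ : (\prod_(j <- J) _)%E = P (ev J A)); last first.
  rewrite P_ev//; apply: eq_big_seq => j jJ.
  by case: eqP => // jn; rewrite -jn jJ in nJ.
by rewrite fineM ?fin_num_measure// /p; ring.
Qed.

Lemma mean_monomial n (ms : seq nat) : all (fun m => m != n) ms ->
  mean P (fun w => truncated n w * \prod_(m <- ms) truncated m w) = 0.
Proof.
case: n => [_|n].
  by rewrite -[RHS](mean_cst P 0); apply: eq_mean => w; rewrite mul0r.
have bprod ms' : bounded_rv (fun w => \prod_(m <- ms') truncated m w).
  by apply: bounded_rv_prod => m; exact: bounded_truncated.
(* With a general cylinder event in front, [mean_comp0] trades one factor after another for the
   indicator of an event on [X m], which joins the cylinder as a new coordinate or cuts an existing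
   one if [m] is repeated. *)
suff main : all (fun m => m != n.+1) ms -> forall J A, n.+1 \notin J ->
    (forall j, j \in J -> (1 <= j)%N) -> (forall j, measurable (A j)) ->
    mean P (fun w => \1_(ev J A) w * (truncated n.+1 w * \prod_(m <- ms) truncated m w)) = 0.
  move=> /main/(_ fset0 (fun=> setT)) H; rewrite -[RHS]H//.
  apply: eq_mean => w; rewrite indicE mem_set ?mul1r// => j.
elim: ms => [_ J A nJ J1 mA|m ms IHms /= /andP[mn msn] J A nJ J1 mA].
  rewrite -[RHS](mean_event_truncated (ltn0Sn n) nJ J1 mA); apply: eq_mean => w.
  by rewrite big_nil mulr1.
case: m mn => [_|m mn].
  by rewrite -[RHS](mean_cst P 0); apply: eq_mean => w; rewrite big_cons mul0r !mulr0.
have bE : bounded_rv (\1_(ev J A) : Omega -> R).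
  by apply: bounded_rv_indic; exact: measurable_ev.
have bH : bounded_rv (fun w => \1_(ev J A) w * (truncated n.+1 w * \prod_(m <- ms) truncated m w)).
  by apply: bounded_rvM => //; apply: bounded_rvM => //; exact: bounded_truncated.
rewrite -[RHS](mean_comp0 (P := P) (Z := X m.+1) bH measurable_truncate truncate_bound); last first.
  move=> B mB; have [mJ|mJ] := boolP (m.+1 \in J).
    rewrite -[RHS](IHms msn J (fun j => if j == m.+1 then A j `&` B else A j))//; last first.
      by move=> j; case: eqP => // _; exact: measurableI.
    by apply: eq_mean => w; rewrite ev_cut// indicI /=; ring.
  rewrite -[RHS](IHms msn (m.+1 |` J)%fset (fun j => if j == m.+1 then B else A j)).
  - by apply: eq_mean => w; rewrite ev_add// indicI /=; ring.
  - by rewrite in_fset1U negb_or eq_sym mn.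
  - by move=> j; rewrite in_fset1U => /orP[/eqP->|/J1].
  - by move=> j; case: eqP.
by apply: eq_mean => w; rewrite big_cons /=; ring.
Qed.

(* Expanding the product produces monomials in which [n] is not repeated. *)
Lemma mean_monomial_prod (al : R) (be : nat -> R) (p q : nat -> nat) L n ms :
  all (fun m => m < n)%N ms ->
  (forall v, v < L -> q v < n)%N ->
  (forall v, (v < L)%N -> be v = 0 \/ (p v < n)%N) ->
  mean P (fun w => truncated n w * \prod_(m <- ms) truncated m w *
    \prod_(v < L) (al + be v * (truncated (p v) w * truncated (q v) w))) = 0.
Proof.
have bfac v : bounded_rv (fun w => al + be v * (truncated (p v) w * truncated (q v) w)).
  apply: bounded_rvD; first exact: bounded_rv_cst.
  by apply: bounded_rvM; [exact: bounded_rv_cst|apply: bounded_rvM; exact: bounded_truncated].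
elim: L ms => [|L IHL] ms ms_lt q_lt p_lt.
  rewrite -[RHS](@mean_monomial n ms).
    by apply: eq_mean => w; rewrite big_ord0 mulr1.
  by apply/allP => m /(allP ms_lt); rewrite neq_ltn => ->.
have q_lt' v : (v < L)%N -> (q v < n)%N by move=> vL; apply: q_lt; exact: leqW.
have p_lt' v : (v < L)%N -> be v = 0 \/ (p v < n)%N by move=> vL; apply: p_lt; exact: leqW.
have bterm ms' : bounded_rv (fun w => truncated n w * \prod_(m <- ms') truncated m w *
    \prod_(v < L) (al + be v * (truncated (p v) w * truncated (q v) w))).
  apply: bounded_rvM; last exact: bounded_rv_prod.
  by apply: bounded_rvM; [exact: bounded_truncated|apply: bounded_rv_prod => m; exact: bounded_truncated].
transitivity (al * mean P (fun w => truncated n w * \prod_(m <- ms) truncated m w *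
      \prod_(v < L) (al + be v * (truncated (p v) w * truncated (q v) w))) +
   be L * mean P (fun w => truncated n w * \prod_(m <- [:: p L, q L & ms]) truncated m w *
      \prod_(v < L) (al + be v * (truncated (p v) w * truncated (q v) w)))).
  rewrite -meanZ// -meanZ// -meanD; last 2 first.
  - by apply: bounded_rvM => //; exact: bounded_rv_cst.
  - by apply: bounded_rvM => //; exact: bounded_rv_cst.
  by apply: eq_mean => w; rewrite big_ord_recr/= !big_cons; ring.
rewrite IHL// mulr0 add0r.
case: (p_lt L (ltnSn L)) => [->|pL]; first by rewrite mul0r.
by rewrite IHL ?mulr0//= pL q_lt.
Qed.

(** When [be L] is not 0, the index [q L] exceeds [p L] and all earlier indices, so the term that
    the last factor adds has mean zero. *)
Lemma mean_martingale_prod (al : R) (be : nat -> R) (p q : nat -> nat) L :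
  (forall v v', (v < v')%N -> (q v < q v')%N) ->
  (forall v, be v = 0 \/ (p v < q v)%N) ->
  mean P (fun w => \prod_(v < L) (al + be v * (truncated (p v) w * truncated (q v) w))) = al ^+ L.
Proof.
move=> q_mono p_lt.
have bfac v : bounded_rv (fun w => al + be v * (truncated (p v) w * truncated (q v) w)).
  apply: bounded_rvD; first exact: bounded_rv_cst.
  by apply: bounded_rvM; [exact: bounded_rv_cst|apply: bounded_rvM; exact: bounded_truncated].
elim: L => [|L IHL].
  by rewrite expr0 -[RHS](mean_cst P 1); apply: eq_mean => w; rewrite big_ord0.
transitivity (al * mean P (fun w => \prod_(v < L) (al + be v * (truncated (p v) w * truncated (q v) w))) +
   be L * mean P (fun w => truncated (q L) w * \prod_(m <- [:: p L]) truncated m w *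
      \prod_(v < L) (al + be v * (truncated (p v) w * truncated (q v) w)))).
  rewrite -meanZ; last exact: bounded_rv_prod.
  rewrite -meanZ; last first.
    apply: bounded_rvM; last exact: bounded_rv_prod.
    by apply: bounded_rvM; [exact: bounded_truncated|apply: bounded_rv_prod => m; exact: bounded_truncated].
  rewrite -meanD; last 2 first.
  - by apply: bounded_rvM; [exact: bounded_rv_cst|exact: bounded_rv_prod].
  - apply: bounded_rvM; first exact: bounded_rv_cst.
    apply: bounded_rvM; last exact: bounded_rv_prod.
    by apply: bounded_rvM; [exact: bounded_truncated|apply: bounded_rv_prod => m; exact: bounded_truncated].
  by apply: eq_mean => w; rewrite big_ord_recr/= big_cons big_nil; ring.
rewrite IHL exprS; case: (p_lt L) => [->|pL]; first by rewrite mul0r addr0.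
rewrite mean_monomial_prod ?mulr0 ?addr0//= ?pL// => v vL; first exact: q_mono.
by case: (p_lt v) => [|pv]; [left|right; exact: ltn_trans pv (q_mono _ _ vL)].
Qed.

End Independent.

(** * Exponential moments of correlations *)

Section Exponential.
Context {R : realType}.

Lemma expR_le_quadratic (u : R) : `|u| <= 2^-1 -> expR u <= 1 + 2 * u ^+ 2 + u.
Proof.
rewrite ler_norml => /andP[u1 u2].
have h : 1 - u <= expR (- u) by have := expR_ge1Dx (- u).
have h0 : 0 < 1 - u by lra.
have : expR u <= (1 - u)^-1.
  by rewrite -[u in expR u]opprK expRN lef_pV2// posrE expR_gt0.
move/le_trans; apply; rewrite -[leLHS]mul1r ler_pdivrMr//.
have -> : (1 + 2 * u ^+ 2 + u) * (1 - u) = 1 + u ^+ 2 * (1 - 2 * u) by ring.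
by rewrite lerDl mulr_ge0 ?sqr_ge0//; lra.
Qed.

End Exponential.

Section Coefficients.
Context {R : realType} (M rho : R).

(* The signed, normalised correlation of one block per cell [i], written as a
   sum over [v = i * 2 ^ j + u]. *)
Definition chernoff_coef j k delta (t : nat -> nat) (e : nat -> bool) v : R :=
  let i := (v %/ 2 ^ j)%N in let p := (t i + v %% 2 ^ j)%N in let q := (delta + v)%N in
  if [&& t i < delta + i * 2 ^ j, 2 ^ j <= p < 2 ^ j.+1 & 2 ^ k <= q < 2 ^ k.+1]%N
  then rho ^+ j / 2 * (-1) ^+ e i * (2 ^+ (j + k) / M ^+ 2) / (p%:R * q%:R) else 0.

Definition lower_index j (t : nat -> nat) v := (t (v %/ 2 ^ j) + v %% 2 ^ j)%N.

Lemma chernoff_coef_lower_index j k delta t e v :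
  chernoff_coef j k delta t e v = 0 \/ (lower_index j t v < delta + v)%N.
Proof.
rewrite /chernoff_coef /lower_index; case: ifP => [/and3P[t_lt _ _]|_]; last by left.
right; rewrite {3}(divn_eq v (2 ^ j)) addnA ltn_add2r//.
Qed.

Hypotheses (M_gt0 : 0 < M) (rho_itv : 0 < rho <= 1).

Section Pointwise.
Variables (y : nat -> R) (y_bound : forall n, `|y n| <= M).
Let b n := y n / n%:R.

(** Each exponential is replaced by its quadratic majorant, with the square frozen at its largest
    value. The result is a polynomial in the variables whose mean can be computed exactly. *)
Definition chernoff_prod j k delta t e : R := \prod_(v < 2 ^ k)
  (1 + 2 * (rho ^+ j / 2) ^+ 2 +
   chernoff_coef j k delta t e v * (y (lower_index j t v) * y (delta + v)%N)).

Lemma chernoff_coef_kern j k delta t e v : (t (v %/ 2 ^ j) < delta + v %/ 2 ^ j * 2 ^ j)%N ->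
  chernoff_coef j k delta t e v * (y (lower_index j t v) * y (delta + v)%N) =
  rho ^+ j / 2 * (2 ^+ (j + k) / M ^+ 2) *
   ((-1) ^+ e (v %/ 2 ^ j)%N * (kern b j (lower_index j t v) * kern b k (delta + v)%N)).
Proof.
move=> t_lt; rewrite /chernoff_coef t_lt /= /kern -/(lower_index j t v).
case: ifP => [/andP[-> ->]|/negbT]; last first.
  by rewrite negb_and => /orP[]/negbTE ->; rewrite ?mulr0 !mul0r ?mulr0.
rewrite /b (invfM (lower_index j t v)%:R); move: (lower_index j t v)%:R^-1 (delta + v)%:R^-1 => a c; ring.
Qed.

Lemma kern_norm_le k n : `|kern b k n| <= M / 2 ^+ k.
Proof.
rewrite /kern; case: ifP => [/andP[lo _]|_]; last first.
  by rewrite normr0 divr_ge0 ?exprn_ge0// ltW.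
have n0 : (0 < n)%N by apply: leq_trans lo; rewrite expn_gt0.
rewrite /b normrM normfV normr_nat; apply: ler_pM => //.
by rewrite lef_pV2 ?posrE ?exprn_gt0 ?ltr0n// -natrX ler_nat.
Qed.

Lemma chernoff_coef_small j k delta t e v :
  `|chernoff_coef j k delta t e v * (y (lower_index j t v) * y (delta + v)%N)| <= rho ^+ j / 2.
Proof.
have [r0 r1] := andP rho_itv.
have z0 : 0 <= rho ^+ j / 2 by rewrite divr_ge0// exprn_ge0// ltW.
have [t_lt|t_ge] := boolP (t (v %/ 2 ^ j) < delta + v %/ 2 ^ j * 2 ^ j)%N; last first.
  by rewrite /chernoff_coef (negbTE t_ge) mul0r normr0.
have sgE : `|(-1) ^+ e (v %/ 2 ^ j)%N| = 1 :> R by rewrite normrX normrN1 expr1n.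
have c0 : 0 <= 2 ^+ (j + k) / M ^+ 2 by rewrite divr_ge0 ?exprn_ge0// ltW.
rewrite chernoff_coef_kern// normrM (ger0_norm (mulr_ge0 z0 c0)) normrM sgE mul1r normrM.
rewrite -mulrA [leRHS](_ : _ = rho ^+ j / 2 * 1); last by rewrite mulr1.
apply: ler_wpM2l => //.
have H := ler_pM (normr_ge0 _) (normr_ge0 _) (kern_norm_le j (lower_index j t v))
   (kern_norm_le k (delta + v)).
apply: le_trans (ler_wpM2l c0 H) _.
rewrite exprD le_eqVlt; apply/orP; left; apply/eqP; field.
by rewrite !expf_neq0 ?gt_eqF.
Qed.

Lemma expR_le_chernoff j k delta t e :
  expR (\sum_(v < 2 ^ k) chernoff_coef j k delta t e v * (y (lower_index j t v) * y (delta + v)%N)) <=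
  chernoff_prod j k delta t e.
Proof.
have [r0 r1] := andP rho_itv.
rewrite expR_sum /chernoff_prod; apply: ler_prod => v _; rewrite expR_ge0/=.
have small := chernoff_coef_small j k delta t e v; set x := chernoff_coef _ _ _ _ _ _ * _ in small *.
have z1 : rho ^+ j / 2 <= 2^-1 by rewrite ler_pdivrMr// mulVf// exprn_ile1// ltW.
apply: le_trans (expR_le_quadratic (le_trans small z1)) _.
rewrite lerD2r lerD2l ler_pM2l// -real_normK ?num_real//.
by rewrite lerXn2r// nnegrE// divr_ge0// exprn_ge0// ltW.
Qed.

Lemma chernoff_prod_ge0 j k delta t e : 0 <= chernoff_prod j k delta t e.
Proof. exact: le_trans (expR_ge0 _) (expR_le_chernoff j k delta t e). Qed.

(* Testing the signs that realise the absolute values. *)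
Lemma chernoff_correlation j k delta t th : (j <= k)%N ->
  (forall i, (i < 2 ^ (k - j))%N -> t i < delta + i * 2 ^ j)%N ->
  (forall e, chernoff_prod j k delta t e <= expR th) ->
  rho ^+ j / 2 * (2 ^+ (j + k) / M ^+ 2) * \sum_(i < 2 ^ (k - j)) `|\sum_(u < 2 ^ j)
     kern b j (t i + u)%N * kern b k (delta + i * 2 ^ j + u)%N| <= th.
Proof.
move=> jk t_lt H.
pose Z i := \sum_(u < 2 ^ j) kern b j (t i + u)%N * kern b k (delta + i * 2 ^ j + u)%N.
pose e i := Z i < 0.
have := le_trans (expR_le_chernoff j k delta t e) (H e).
rewrite ler_expR; apply: le_trans.
rewrite le_eqVlt; apply/orP; left; apply/eqP.
have kE : (2 ^ k = 2 ^ (k - j) * 2 ^ j)%N by rewrite -expnD subnK.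
rewrite kE (sum_cells (fun v => chernoff_coef j k delta t e v * (y (lower_index j t v) * y (delta + v)%N))).
rewrite mulr_sumr; apply: eq_bigr => i _.
have -> : `|Z i| = (-1) ^+ e i * Z i.
  rewrite /e; have [Zi|Zi] := ltrP (Z i) 0.
    by rewrite expr1 mulN1r ltr0_norm.
  by rewrite expr0 mul1r ger0_norm.
rewrite /Z !mulr_sumr; apply: eq_bigr => u _.
rewrite chernoff_coef_kern; last by rewrite cell_index t_lt.
rewrite /lower_index !cell_index modnMDl modn_small// addnA; ring.
Qed.

End Pointwise.
End Coefficients.

(** * Almost sure decay of correlations *)

Section Numeric.
Context {R : realType} (rho : R).
Hypotheses (rho_itv : 0 < rho <= 1) (rho_large : 3 / 2 <= 2 * rho ^+ 2).

Definition chernoff_rate j k : R := rho ^+ (2 * j) * 2 ^+ k.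

Lemma Bernoulli_half n : 1 + n%:R / 2 <= (3 / 2) ^+ n :> R.
Proof.
elim: n => [|n IHn]; first by rewrite expr0 mul0r addr0.
by rewrite exprS -natr1; have n0 : 0 <= n%:R :> R by []; nra.
Qed.

Lemma chernoff_rate_ge j k : (j <= k)%N -> 2 ^+ (k - j) * (3 / 2) ^+ j <= chernoff_rate j k.
Proof.
move=> jk; rewrite /chernoff_rate -[in 2 ^+ k](subnK jk) exprD mulrCA ler_wpM2l ?exprn_ge0//.
rewrite exprM -exprMn; apply: lerXn2r; rewrite ?nnegrE.
- lra.
- by rewrite mulr_ge0 ?sqr_ge0.
- by rewrite [leRHS]mulrC; exact: rho_large.
Qed.

(** The first left side is the binary logarithm of the number of triples [delta], [t], [e]. It is
    small enough because [j + 2 <= 2 * (3 / 2) ^ j], by [Bernoulli_half]. *)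
Lemma chernoff_rate_entropy j k : (j <= k)%N ->
  k.+1%:R + j.+2%:R * 2 ^+ (k - j) <= 4 * chernoff_rate j k /\ k.+1%:R <= 2 * chernoff_rate j k.
Proof.
move=> jk; have H := chernoff_rate_ge jk.
have e0 : 0 < 2 ^+ (k - j) :> R by rewrite exprn_gt0.
have hk : (3 / 2) ^+ k <= 2 ^+ (k - j) * (3 / 2) ^+ j :> R.
  rewrite -[in leLHS](subnK jk) exprD; apply: ler_wpM2r; first by apply: exprn_ge0; lra.
  by apply: lerXn2r; rewrite ?nnegrE; lra.
have bk := Bernoulli_half k; have bj := Bernoulli_half j.
have k0 : 0 <= k%:R :> R by []. have j0 : 0 <= j%:R :> R by [].
rewrite -[k.+1%:R]natr1 -[j.+2%:R]natr1 -[j.+1%:R]natr1; move: e0 H hk bk bj k0 j0.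
move: (2 ^+ (k - j)) ((3 / 2) ^+ j) ((3 / 2) ^+ k) (chernoff_rate j k) k%:R j%:R => e q q' G k' j'.
move=> e0 H hk bk bj k0 j0; split; last by lra.
by have := ler_wpM2l (ltW e0) bj; lra.
Qed.

Lemma exprn_two_le n : 2 ^+ n <= expR (n%:R) :> R.
Proof.
rewrite -[n%:R]mulr1 expRM_natl lerXn2r// ?nnegrE ?expR_ge0//.
by have := expR_ge1Dx (1 : R).
Qed.

(* The first three factors count the [delta], [t] and [e] of [chernoff_sum]. *)
Lemma union_bound_le j k : (j <= k)%N ->
  2 ^+ k.+1 * (2 ^+ j.+1) ^+ (2 ^ (k - j)) * 2 ^+ (2 ^ (k - j)) *
    (expR (- (17 / 2 * chernoff_rate j k)) * (1 + 2 * (rho ^+ j / 2) ^+ 2) ^+ (2 ^ k)) <=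
  expR (- (2 * k.+1%:R)).
Proof.
move=> jk; have [ent lin] := chernoff_rate_entropy jk.
have -> : 2 ^+ k.+1 * (2 ^+ j.+1) ^+ (2 ^ (k - j)) * 2 ^+ (2 ^ (k - j)) =
    2 ^+ (k.+1 + j.+2 * 2 ^ (k - j)) :> R.
  by rewrite -exprM -mulrA -exprD -exprD; congr (_ ^+ _); rewrite -mulSnr.
have m_le : (1 + 2 * (rho ^+ j / 2) ^+ 2) ^+ (2 ^ k) <= expR (chernoff_rate j k / 2).
  have -> : chernoff_rate j k / 2 = (2 ^ k)%:R * (2 * (rho ^+ j / 2) ^+ 2).
    by rewrite natrX /chernoff_rate mulnC exprM; field.
  rewrite expRM_natl lerXn2r// ?nnegrE ?expR_ge0//; last exact: expR_ge1Dx.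
  by rewrite addr_ge0// mulr_ge0// sqr_ge0.
apply: le_trans (ler_pM _ _ (exprn_two_le _) (ler_wpM2l (expR_ge0 _) m_le)) _.
- by rewrite exprn_ge0.
- by rewrite mulr_ge0 ?expR_ge0// exprn_ge0// addr_ge0// mulr_ge0// sqr_ge0.
(* The constant is [17 / 2 = 4 + 1 / 2 + 4]: entropy, quadratic term, and room for [2 * k.+1]. *)
rewrite -!expRD ler_expR natrD natrM natrX; lra.
Qed.

End Numeric.

Definition ext_ffun n (A : Type) (a : A) (t : {ffun 'I_n -> A}) i :=
  if insub i is Some o then t o else a.

Lemma ext_ffunE n (A : Type) (a : A) (t : nat -> A) i : (i < n)%N ->
  ext_ffun a [ffun o : 'I_n => t o] i = t i.
Proof. by move=> i_n; rewrite /ext_ffun insubT ffunE. Qed.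

Section AlmostSure.
Context {d : measure_display} {Omega : measurableType d} {R : realType}
  (P : probability Omega R) (X : nat -> {RV P >-> R}) (M rho : R).
Hypothesis M_gt0 : 0 < M.
Hypothesis X_bounded : forall n, (1 <= n)%N -> {ae P, forall w, `|X n w| <= M}.
Hypothesis X_indep : mutually_independent [set n : nat | (1 <= n)%N] X.
Hypothesis X_mean0 : forall n, (1 <= n)%N -> ('E_P[X n] = 0)%E.
Hypotheses (rho_itv : 0 < rho <= 1) (rho_large : 3 / 2 <= 2 * rho ^+ 2).

Let y w n := truncated X M n w.

(* If this is below [1], so is each term, which bounds every correlation at
   scale [k]: only finitely many [delta], [t] and [e] matter. *)
Definition chernoff_sum k w : R := \sum_(j < k.+1) \sum_(delta < 2 ^ k.+1)
  \sum_(t : {ffun 'I_(2 ^ (k - j)) -> 'I_(2 ^ j.+1)})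
  \sum_(e : {ffun 'I_(2 ^ (k - j)) -> bool})
    expR (- (17 / 2 * chernoff_rate rho j k)) * chernoff_prod M rho (y w) j k delta
      (ext_ffun 0%N [ffun i => val (t i)]) (ext_ffun false e).

Let chernoff_bounded j k delta t e :
  bounded_rv (fun w => chernoff_prod M rho (y w) j k delta t e).
Proof.
apply: bounded_rv_prod => v; apply: bounded_rvD; first exact: bounded_rv_cst.
by apply: bounded_rvM; [exact: bounded_rv_cst|apply: bounded_rvM; exact: bounded_truncated].
Qed.

Let term_bounded c j k delta t e :
  bounded_rv (fun w => c * chernoff_prod M rho (y w) j k delta t e).
Proof. by apply: bounded_rvM => //; exact: bounded_rv_cst. Qed.

Lemma chernoff_sum_bounded k : bounded_rv (chernoff_sum k).
Proof. by do 4 (apply: bounded_rv_sum => ? _); exact: term_bounded. Qed.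

Lemma chernoff_mean j k delta t e :
  mean P (fun w => chernoff_prod M rho (y w) j k delta t e) =
  (1 + 2 * (rho ^+ j / 2) ^+ 2) ^+ (2 ^ k).
Proof.
apply: (mean_martingale_prod M_gt0 X_bounded X_indep X_mean0).
  by move=> v v' vv'; rewrite ltn_add2l.
exact: chernoff_coef_lower_index.
Qed.

Lemma chernoff_sum_mean k : mean P (chernoff_sum k) <= 2^-1 ^+ k.+1.
Proof.
apply: (@le_trans _ _ (\sum_(j < k.+1) expR (- (2 * k.+1%:R)))); last first.
  rewrite sumr_const card_ord -[leLHS]mulr_natl.
  apply: (@le_trans _ _ (expR k.+1%:R * expR (- (2 * k.+1%:R)))).
    rewrite ler_wpM2r ?expR_ge0//; apply: le_trans (expR_ge1Dx _).
    by rewrite lerDr.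
  rewrite -expRD exprVn (_ : _ + _ = - k.+1%:R); last by ring.
  by rewrite expRN lef_pV2 ?posrE ?expR_gt0 ?exprn_gt0// exprn_two_le.
rewrite /chernoff_sum mean_sum; last first.
  by move=> j _; do 3 (apply: bounded_rv_sum => ? _); exact: term_bounded.
apply: ler_sum => j _; have jk : (j <= k)%N by rewrite -ltnS.
apply: le_trans (union_bound_le rho_large jk).
rewrite mean_sum; last by move=> ? _; do 2 (apply: bounded_rv_sum => ? _); exact: term_bounded.
under eq_bigr => delta _.
  rewrite mean_sum; last by move=> ? _; apply: bounded_rv_sum => ? _; exact: term_bounded.
  under eq_bigr => t _.
    rewrite mean_sum; last by move=> ? _; exact: term_bounded.
    under eq_bigr => e _ do rewrite meanZ// chernoff_mean.
    rewrite sumr_const card_ffun card_bool card_ord.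
    over.
  rewrite sumr_const card_ffun !card_ord.
  over.
rewrite sumr_const card_ord -!mulrnA.
rewrite -[leLHS]mulr_natl !natrM !natrX.
by rewrite le_eqVlt; apply/orP; left; apply/eqP; ring.
Qed.

Lemma chernoff_sum_correlation k w : chernoff_sum k w < 1 ->
  forall j delta (t : nat -> nat), (j <= k)%N -> (forall i, t i < delta + i * 2 ^ j)%N ->
  \sum_(i < 2 ^ (k - j)) `|\sum_(u < 2 ^ j)
     kern (fun n => y w n / n%:R) j (t i + u)%N *
     kern (fun n => y w n / n%:R) k (delta + i * 2 ^ j + u)%N| <=
  17 * M ^+ 2 * (rho / 2) ^+ j.
Proof.
move=> chern1 j delta t jk t_lt; have [r0 r1] := andP rho_itv.
have rhs0 : 0 <= 17 * M ^+ 2 * (rho / 2) ^+ j.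
  by apply: mulr_ge0; [rewrite mulr_ge0 ?sqr_ge0|apply: exprn_ge0; rewrite divr_ge0// ltW].
(* For [delta] or [t i] beyond the ranges of [chernoff_sum] one of the kernels vanishes on the whole
   block. *)
have [d_lt|d_ge] := ltnP delta (2 ^ k.+1); last first.
  rewrite big1// => i _; rewrite big1 ?normr0// => u _.
  rewrite [X in _ * X]/kern ifF ?mulr0//; apply/negbTE; rewrite negb_and -leqNgt; apply/orP; right.
  by rewrite -addnA (leq_trans d_ge)// leq_addr.
pose t' i := if (t i < 2 ^ j.+1)%N then t i else 0%N.
have t'_lt i : (t' i < delta + i * 2 ^ j)%N.
  by rewrite /t'; case: ifP => // _; apply: leq_ltn_trans (t_lt i).
apply: (@le_trans _ _ (\sum_(i < 2 ^ (k - j)) `|\sum_(u < 2 ^ j)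
     kern (fun n => y w n / n%:R) j (t' i + u)%N *
     kern (fun n => y w n / n%:R) k (delta + i * 2 ^ j + u)%N|)).
  apply: ler_sum => i _; rewrite /t'; case: ifP => // /negbT; rewrite -leqNgt => t_ge.
  rewrite [X in `|X|]big1 ?normr0// => u _.
  rewrite [X in X * _]/kern ifF ?mul0r//; apply/negbTE; rewrite negb_and -leqNgt; apply/orP; right.
  by rewrite (leq_trans t_ge)// leq_addr.
have c0 : 0 < rho ^+ j / 2 * (2 ^+ (j + k) / M ^+ 2).
  by rewrite mulr_gt0 ?divr_gt0 ?exprn_gt0.
rewrite -(ler_pM2l c0).
have -> : rho ^+ j / 2 * (2 ^+ (j + k) / M ^+ 2) * (17 * M ^+ 2 * (rho / 2) ^+ j) =
   17 / 2 * chernoff_rate rho j k.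
  rewrite /chernoff_rate exprD expr_div_n mulnC exprM; field.
  by rewrite !expf_neq0 ?gt_eqF.
apply: (chernoff_correlation M_gt0 rho_itv (fun n => truncated_bound X M_gt0 n w)) => // e.
have t'_small i : (t' i < 2 ^ j.+1)%N by rewrite /t'; case: ifP => // _; rewrite expn_gt0.
pose tf := [ffun i : 'I_(2 ^ (k - j)) => Ordinal (t'_small i)].
pose ef := [ffun i : 'I_(2 ^ (k - j)) => e i].
have prodE : chernoff_prod M rho (y w) j k delta t' e = chernoff_prod M rho (y w) j k delta
    (ext_ffun 0%N [ffun i => val (tf i)]) (ext_ffun false ef).
  apply: eq_bigr => v _.
  have v_lt : (v %/ 2 ^ j < 2 ^ (k - j))%N by rewrite ltn_divLR ?expn_gt0// -expnD subnK.
  have tE : ext_ffun 0%N [ffun i => val (tf i)] (v %/ 2 ^ j) = t' (v %/ 2 ^ j)%N.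
    by rewrite /ext_ffun insubT !ffunE.
  by rewrite /chernoff_coef /lower_index tE /ef ext_ffunE.
have nn c j' d' t1 e1 : 0 <= expR c * chernoff_prod M rho (y w) j' k d' t1 e1.
  apply: mulr_ge0; first exact: expR_ge0.
  by apply: chernoff_prod_ge0 => // n; exact: truncated_bound.
move: chern1; rewrite /chernoff_sum.
rewrite (bigD1 (Ordinal (jk : j < k.+1)%N))//= (bigD1 (Ordinal d_lt))//= (bigD1 tf)//= (bigD1 ef)//=.
rewrite -prodE -!addrA => H.
have {H} : expR (- (17 / 2 * chernoff_rate rho j k)) * chernoff_prod M rho (y w) j k delta t' e < 1.
  apply: le_lt_trans H; rewrite lerDl; do 3 (apply: addr_ge0; first by
    [apply: sumr_ge0 => *; do ?[apply: sumr_ge0 => *]; exact: nn]).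
  by apply: sumr_ge0 => *; do ?[apply: sumr_ge0 => *]; exact: nn.
by rewrite expRN mulrC ltr_pdivrMr ?expR_gt0// mul1r => /ltW.
Qed.

Let B k := [set w | 1 <= chernoff_sum k w].

Let measurable_B k : measurable (B k).
Proof.
rewrite /B -[X in measurable X]setTI; apply: measurable_fun_ler => //.
by have [] := chernoff_sum_bounded k.
Qed.

Lemma chernoff_sum_ge0 k w : 0 <= chernoff_sum k w.
Proof.
do 4 (apply: sumr_ge0 => ? _); apply: mulr_ge0; first exact: expR_ge0.
by apply: chernoff_prod_ge0 => // n; exact: truncated_bound.
Qed.

Lemma chernoff_sum_tail k : (P (B k) <= (1 / (2 ^ k.+1)%:R)%:E)%E.
Proof.
rewrite -[leLHS]fineK ?fin_num_measure// lee_fin -mean_indic//.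
apply: (@le_trans _ _ (mean P (chernoff_sum k))); last first.
  by rewrite div1r natrX -exprVn; exact: chernoff_sum_mean.
apply: le_mean; [exact: bounded_rv_indic|exact: chernoff_sum_bounded|move=> w].
rewrite indicE; case: (boolP (w \in B k)) => [/set_mem //|_] /=.
exact: chernoff_sum_ge0.
Qed.

Lemma ae_chernoff_sum : {ae P, forall w, exists k0, forall k, (k0 <= k)%N -> chernoff_sum k w < 1}.
Proof.
have lim0 : P (lim_sup_set B) = 0%E.
  apply: lim_sup_set_cvg0 => //; apply: (@le_lt_trans _ _ 1%:E); last exact: ltry.
  apply: le_trans (epsilon_trick0 xpredT (@ler01 R)).
  by apply: lee_nneseries => *; [exact: measure_ge0|exact: chernoff_sum_tail].
exists (lim_sup_set B); split=> //.
  by apply: bigcapT_measurable => n; exact: bigcup_measurable.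
move=> w /= nH k _ /=; apply: contrapT => none; apply: nH; exists k => k' kk'.
by rewrite ltNge; apply/negP => c1; apply: none; exists k'.
Qed.

Lemma ae_correlation : {ae P, forall w, exists C0 : R,
  (forall k n, `|kern (fun n => X n w / n%:R) k n| <= M / 2 ^+ k) /\
  correlation_decay (fun n => X n w / n%:R) C0 rho}.
Proof.
have : {ae P, forall w, forall n, (1 <= n)%N -> `|X n w| <= M}.
  apply/ae_foralln => n; case: n => [|n]; first by apply/aeW => w.
  by apply: filterS (X_bounded (ltn0Sn n)) => w Xw _.
have := ae_chernoff_sum; apply: filterS2 => w [k0 chern1] Xw.
have kernE k : kern (fun n => X n w / n%:R) k = kern (fun n => y w n / n%:R) k.
  apply/funext => -[|n]; rewrite /kern; case: ifP => // _; first by rewrite !invr0 !mulr0.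
  by rewrite /y /truncated truncateE// Xw.
have [r0 r1] := andP rho_itv.
have kb k n : `|kern (fun n => X n w / n%:R) k n| <= M / 2 ^+ k.
  by rewrite kernE; apply: kern_norm_le => // m; exact: truncated_bound.
(* The second summand covers the scales [k < k0] by the trivial bound [M ^+ 2 * 2 ^+ k], using
   [j <= k]. As [k0] depends on [w], so does the final constant. *)
exists (17 * M ^+ 2 + M ^+ 2 * 2 ^+ k0 / (rho / 2) ^+ k0); split=> // j k delta t jk t_lt.
have q0 : 0 < rho / 2 by rewrite divr_gt0.
have M2 : 0 <= M ^+ 2 by exact: sqr_ge0.
rewrite mulrDl; have [le_k|lt_k] := leqP k0 k.
  rewrite !kernE; apply: ler_wpDr; last exact: chernoff_sum_correlation (chern1 k le_k) j delta t jk t_lt.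
  have e0 n : 0 <= (rho / 2) ^+ n by apply: exprn_ge0; exact: ltW.
  by apply: mulr_ge0 => //; apply: divr_ge0 => //; apply: mulr_ge0 => //; exact: exprn_ge0.
apply: ler_wpDl.
  by apply: mulr_ge0; [exact: mulr_ge0|apply: exprn_ge0; exact: ltW].
apply: (@le_trans _ _ (M ^+ 2 * 2 ^+ k)).
  apply: (@le_trans _ _ (\sum_(i < 2 ^ (k - j)) \sum_(u < 2 ^ j) M ^+ 2)).
    apply: ler_sum => i _; apply: le_trans (ler_norm_sum _ _ _) _; apply: ler_sum => u _.
    have k1 k' n : `|kern (fun n => X n w / n%:R) k' n| <= M.
      apply: le_trans (kb k' n) _; rewrite ler_pdivrMr ?exprn_gt0// ler_peMr ?(ltW M_gt0)//.
      by rewrite exprn_ege1// ler1n.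
    by rewrite normrM expr2 ler_pM.
  rewrite !sumr_const !card_ord -mulrnA -expnD subnKC// -[leLHS]mulr_natr natrX.
  exact: lexx.
rewrite -(mulrA (M ^+ 2 * _)) -(mulrA (M ^+ 2)); apply: ler_wpM2l => //.
apply: (@le_trans _ _ (2 ^+ k0 * 1)).
  by rewrite mulr1 ler_eXn2l ?ltr1n// ltnW.
rewrite ler_wpM2l ?exprn_ge0//.
rewrite mulrC ler_pdivlMr ?exprn_gt0// mul1r ler_wiXn2l ?(ltW q0)//.
- by rewrite ler_pdivrMr// mul1r; lra.
- by rewrite (leq_trans jk)// ltnW.
Qed.

End AlmostSure.

(** * The sparse family *)

Section Intervals.
Context {R : realType} (o : int).

Definition pt (u : nat) : int := o + u%:Z.

Definition ival_lo (c : nat * nat) : int := o + (c.2%:Z - 2) * (2 ^ c.1)%:Z.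

Definition ival_seq (c : nat * nat) : seq int :=
  [seq ival_lo c + u%:Z | u <- iota 0 (3 * 2 ^ c.1)].

(* The cell [c] together with its two left neighbours. *)
Definition ival c : set int := [set` ival_seq c].

Lemma mem_ival c x : (x \in ival_seq c) =
  (ival_lo c <= x < ival_lo c + (3 * 2 ^ c.1)%:Z).
Proof.
apply/mapP/andP => [[u]|[lo hi]].
  rewrite mem_iota /= add0n => u_lt ->; lia.
exists `|x - ival_lo c|%N; last by lia.
by rewrite mem_iota /= add0n; lia.
Qed.

Lemma ival_seq_uniq c : uniq (ival_seq c).
Proof. by rewrite map_inj_uniq ?iota_uniq// => u v /addrI []. Qed.

Lemma int_card_seq (s : seq int) : uniq s -> int_card R [set` s] = (size s)%:R.
Proof.
move=> s_uniq; rewrite /int_card; congr _%:R.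
apply: perm_size; apply: uniq_perm => // x.
by rewrite in_fset_set ?mem_setE//; exact: finite_seq.
Qed.

Lemma int_card_ival c : int_card R (ival c) = 3 * 2 ^+ c.1.
Proof. by rewrite int_card_seq ?ival_seq_uniq// size_map size_iota natrM natrX. Qed.

Lemma int_card_ival_gt0 c : 0 < int_card R (ival c).
Proof. by rewrite int_card_ival mulr_gt0// exprn_gt0. Qed.

Lemma ival_interval c : int_interval R (ival c).
Proof.
have p0 : (0 < 2 ^ c.1)%N by rewrite expn_gt0.
split; first by exists (ival_lo c); rewrite /ival /= mem_ival; lia.
exists (ival_lo c)%:~R, (ival_lo c + (3 * 2 ^ c.1)%:Z - 1)%:~R.
apply/seteqP; split=> x; rewrite /ival /= mem_ival !ler_int; lia.
Qed.

(** The length gives the scale, then the left end gives the position. A sparse collection is a set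
    of intervals, so distinct cells must yield distinct ones. *)
Lemma ival_inj : injective ival.
Proof.
move=> c c' cc'.
have k_eq : c.1 = c'.1.
  have : int_card R (ival c) = int_card R (ival c') by rewrite cc'.
  rewrite !int_card_ival => /(mulfI _); rewrite pnatr_eq0 => /(_ isT) /eqP.
  by rewrite -!natrX eqr_nat eqn_exp2l// => /eqP.
have p0 : (0 < 2 ^ c'.1)%N by rewrite expn_gt0.
have mem x : (x \in ival_seq c) = (x \in ival_seq c').
  by apply/idP/idP => h; [change (ival c' x); rewrite -cc'|change (ival c x); rewrite cc'].
have := mem (ival_lo c); have := mem (ival_lo c'); rewrite !mem_ival k_eq.
move=> h1 h2; have : ival_lo c = ival_lo c' by lia.
have pz : (2 ^ c'.1)%:Z != 0 by lia.
rewrite /ival_lo k_eq => /addrI /(mulIf pz)/addIr [] m_eq.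
by case: c c' k_eq m_eq {cc' mem h1 h2 p0 pz} => [k m] [k' m'] /= -> ->.
Qed.

Section Form.
Context (f g : int -> R[i]) (r : R).
Hypothesis r_itv : 1 < r < 2.

Let G (u : nat) : R := cabs (g (pt u)) `^ r.

Lemma average_ge0 s (A : set int) (h : int -> R[i]) : 0 <= average s A h.
Proof. exact: powR_ge0. Qed.

Lemma sum_pt_le (h : int -> R) c T (Q : pred nat) : (forall x, 0 <= h x) ->
  (forall u, (u < T)%N -> Q u -> pt u \in ival_seq c) ->
  \sum_(u < T | Q u) h (pt u) <= \sum_(x \in ival c) h x.
Proof.
move=> h_ge0 Q_in; rewrite -fsbig_seq ?ival_seq_uniq//.
rewrite -(big_mkord Q (fun u => h (pt u))) -big_filter -(big_map pt xpredT h).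
apply: (@le_trans _ _ (\sum_(x <- ival_seq c | x \in map pt [seq u <- index_iota 0 T | Q u]) h x)).
  rewrite -[leRHS]big_filter le_eqVlt; apply/orP; left; apply/eqP; apply: perm_big; apply: uniq_perm.
  - by rewrite map_inj_uniq ?filter_uniq ?iota_uniq// => u v /addrI [].
  - by rewrite filter_uniq// ival_seq_uniq.
  move=> x; rewrite mem_filter; case x_in: (x \in map _ _) => //=; symmetry.
  case/mapP: x_in => u; rewrite mem_filter mem_index_iota => /andP[Qu /andP[_ uT]] ->.
  exact: Q_in.
by rewrite [leRHS](bigID (fun x => x \in map pt [seq u <- index_iota 0 T | Q u]))/= lerDl sumr_ge0.
Qed.

Lemma cell_in_ival c u : (u %/ 2 ^ c.1 <= c.2 <= (u %/ 2 ^ c.1).+2)%N -> pt u \in ival_seq c.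
Proof.
have p0 : (0 < 2 ^ c.1)%N by rewrite expn_gt0.
have := leq_divM u (2 ^ c.1); have := ltn_ceil u p0.
rewrite mem_ival /pt /ival_lo; case: c p0 => k m /=.
by set d := (2 ^ k)%N; set q := (u %/ d)%N => *; nia.
Qed.

Lemma cabs_ge0 (z : R[i]) : 0 <= cabs z.
Proof. by case: z => a b; exact: sqrtr_ge0. Qed.

Lemma average1 c : int_card R (ival c) * average 1 (ival c) f = \sum_(x \in ival c) cabs (f x).
Proof.
rewrite /average invr1 powRr1; last first.
  rewrite mulr_ge0 ?invr_ge0 ?(ltW (int_card_ival_gt0 c))//.
  by apply: fsumr_ge0 => x _; exact: powR_ge0.
rewrite mulrA divff ?mul1r ?gt_eqF ?int_card_ival_gt0//.
by apply: eq_fsbigr => x _; rewrite powRr1 ?cabs_ge0.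
Qed.

Definition sparse_term c : R :=
  int_card R (ival c) * average 1 (ival c) f * average r (ival c) g.

Lemma sparse_term_ge0 c : 0 <= sparse_term c.
Proof. by rewrite !mulr_ge0 ?average_ge0// ltW// int_card_ival_gt0. Qed.

(** The cell is a third of [ival c], which costs [3 ^ (1 / r) <= 3] in the mean of [g]; [top_mass]
    already extends over all three cells. *)
Lemma sparse_term_ge (fn : nat -> R) c : (forall u, 0 <= fn u <= cabs (f (pt u))) ->
  top_mass fn c.1 c.2 * cell_average G c.1 c.2 `^ r^-1 <= 3 * sparse_term c.
Proof.
move=> fn_le; have [r1 r2] := andP r_itv; have r0 : 0 < r by lra.
have p0 : 0 < 2 ^+ c.1 :> R by rewrite exprn_gt0.
have avg0 : 0 <= cell_average G c.1 c.2 by apply: avgG_ge0 => u; exact: powR_ge0.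
rewrite /sparse_term average1 mulrCA; apply: ler_pM.
- by apply: mass_ge0 => u; case/andP: (fn_le u).
- exact: powR_ge0.
- rewrite /top_mass; apply: (@le_trans _ _ (\sum_(y < c.2.+1 * 2 ^ c.1 | near_top c.1 c.2 y) cabs (f (pt y)))).
    by apply: ler_sum => u _; case/andP: (fn_le u).
  apply: (sum_pt_le (Q := near_top c.1 c.2)) => [x|u _]; first exact: cabs_ge0.
  exact: cell_in_ival.
have third : cell_average G c.1 c.2 / 3 <= (int_card R (ival c))^-1 * \sum_(x \in ival c) cabs (g x) `^ r.
  have -> : (int_card R (ival c))^-1 = (2 ^+ c.1)^-1 / 3.
    by rewrite int_card_ival invfM mulrC.
  have inv0 : 0 <= (2 ^+ c.1)^-1 / 3 :> R by rewrite divr_ge0 ?invr_ge0 ?ltW.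
  rewrite /cell_average -mulrA [leLHS]mulrC; apply: ler_wpM2l => //.
  apply: (sum_pt_le (h := fun x => cabs (g x) `^ r) (Q := fun u => (u %/ 2 ^ c.1 == c.2)%N)).
    by move=> x; exact: powR_ge0.
  by move=> u _ /eqP um; apply: cell_in_ival; rewrite um leqnn /= leqW.
have ri : 0 <= r^-1 by rewrite invr_ge0 ltW.
apply: (@le_trans _ _ (3 * (cell_average G c.1 c.2 / 3) `^ r^-1)); last first.
  have a0 : 0 <= cell_average G c.1 c.2 / 3 by rewrite divr_ge0.
  rewrite ler_wpM2l// /average.
  by apply: ge0_ler_powR => //; rewrite nnegrE//; exact: le_trans a0 third.
have third0 : 0 <= 3^-1 :> R by rewrite invr_ge0.
rewrite (powRM _ avg0 third0) mulrCA ler_peMr ?powR_ge0//.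
have -> : 3 * 3^-1 `^ r^-1 = 3 `^ (1 - r^-1) :> R.
  rewrite -[in RHS](powR_mulD _ _ (_ : 3 != 0)) ?powRr1// powRN.
  by congr (_ * _); rewrite -powR_inv1// -powRrM mulN1r powRN.
rewrite -[leLHS](powRr0 3) ler_powR ?ler1n// subr_ge0 invf_le1//; lra.
Qed.

Context (fG : nat -> R) (cs : seq (nat * nat)).
Hypothesis fG_ge0 : forall u, 0 <= fG u.
Hypothesis major_le1 : forall u, (\sum_(c <- cs) (major fG G c.1 c.2 u : nat) <= 1)%N.

Let G_ge0 u : 0 <= G u. Proof. exact: powR_ge0. Qed.

Lemma major_exists c : exists u, major fG G c.1 c.2 u.
Proof.
apply: contrapT => /forallNP none; have := major_count fG_ge0 G_ge0 c.1 c.2.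
rewrite leNgt => /negP; apply; rewrite big_pred0 ?mulr_gt0 ?exprn_gt0// => u.
by apply/negP; exact: none.
Qed.

Lemma major_count_mem c u : major fG G c.1 c.2 u -> (count_mem c cs <= 1)%N.
Proof.
move=> mu; apply: leq_trans (major_le1 u).
elim: cs => [|c' s IHs]; first by rewrite big_nil.
by rewrite big_cons /= leq_add//; case: eqP => // ->; rewrite mu.
Qed.

(** A repeated cell would count its major points twice, and every cell has some. *)
Lemma cells_uniq : uniq cs.
Proof.
have : forall c, (count_mem c cs <= 1)%N by move=> c; have [u /major_count_mem] := major_exists c.
elim: cs => // c s IHs crowding /=; rewrite IHs ?andbT => [|c']; last first.
  by apply: leq_trans (crowding c'); rewrite /= leq_addl.
by have := crowding c; rewrite /= eqxx add1n ltnS leqn0 => /eqP/count_memPn.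
Qed.

Lemma major_inj c c' u : c \in cs -> c' \in cs ->
  major fG G c.1 c.2 u -> major fG G c'.1 c'.2 u -> c = c'.
Proof.
move=> c_in c'_in mc mc'; apply/eqP; apply: contraT => ne.
have := major_le1 u; rewrite (bigD1_seq c)/= ?cells_uniq// mc.
rewrite big_mkcond (bigD1_seq c')/= ?cells_uniq// eq_sym ne mc'; lia.
Qed.

Definition sparse_family : set (set int) := [set` [seq ival c | c <- cs]].

Definition major_set (I : set int) : set int :=
  [set x | exists c u, [/\ c \in cs, I = ival c, x = pt u & major fG G c.1 c.2 u]].

Lemma major_set_ival c : c \in cs -> major_set (ival c) =
  [set` [seq pt u | u <- iota 0 (c.2.+1 * 2 ^ c.1) & major fG G c.1 c.2 u]].
Proof.
move=> c_in; apply/seteqP; split=> x /=.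
  move=> [c' [u [c'_in /ival_inj <- -> mu]]]; apply/mapP; exists u => //.
  rewrite mem_filter mu mem_iota /= add0n.
  by case/andP: mu => /eqP <- _; rewrite ltn_ceil// expn_gt0.
move=> /mapP[u]; rewrite mem_filter => /andP[mu _] ->.
by exists c, u.
Qed.

Lemma sparse_family_sparse : sparse R sparse_family.
Proof.
split; first by move=> I /mapP[c _ ->]; exact: ival_interval.
exists major_set; split.
- move=> I _ x [c [u [_ -> -> /andP[/eqP um _]]]]; rewrite /ival /=.
  by apply: cell_in_ival; rewrite um leqnn leqW.
- move=> I I' /mapP[c c_in ->] /mapP[c' c'_in ->] [x []].
  move=> [c1 [u [_ /ival_inj<- -> mu]]] [c1' [u' [_ /ival_inj<- /addrI [<-] mu']]].
  by rewrite (major_inj c_in c'_in mu mu').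
move=> I /mapP[c c_in ->]; rewrite major_set_ival// int_card_seq; last first.
  by rewrite map_inj_uniq ?filter_uniq ?iota_uniq// => u v /addrI [].
(* Three quarters of a cell are exactly a quarter of its triple. *)
have := major_count fG_ge0 G_ge0 c.1 c.2.
rewrite -(big_mkord (major fG G c.1 c.2) (fun=> 1)) -big_filter.
rewrite big_const_seq count_predT iter_addr addr0 size_map /index_iota subn0 int_card_ival.
by lra.
Qed.

Lemma sparse_family_form :
  ((\sum_(c <- cs) sparse_term c)%:E <= ereal_sup [set sparse_form S 1 r f g | S in sparse R])%E.
Proof.
apply: (@le_trans _ _ (sparse_form sparse_family 1 r f g)); last first.
  by apply: ereal_sup_ubound; exists sparse_family => //; exact: sparse_family_sparse.
apply: esum_ge; exists sparse_family.
  by apply: fsets_self; exact: finite_seq.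
rewrite -fsbig_seq ?map_inj_uniq ?cells_uniq//; last exact: ival_inj.
by rewrite big_map sumEFin.
Qed.

End Form.
End Intervals.

(** * The maximal operator *)

Section Complex.
Local Open Scope complex_scope.
Context {R : realType}.

Lemma complex_sum (I : Type) (s : seq I) (Q : pred I) (b : I -> R) (z : I -> R[i]) :
  \sum_(i <- s | Q i) (b i)%:C * z i =
  (\sum_(i <- s | Q i) b i * complex.Re (z i)) +i* (\sum_(i <- s | Q i) b i * complex.Im (z i)).
Proof.
elim: s => [|i s IHs]; first by rewrite !big_nil.
rewrite !big_cons IHs; case: ifP => // _; case: (z i) => x y.
by apply/eqP; rewrite eq_complex /= !mul0r subr0 addr0 !eqxx.
Qed.

Lemma cabs_le_Re_Im (z : R[i]) : cabs z <= `|complex.Re z| + `|complex.Im z|.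
Proof.
case: z => x y /=; rewrite -[leRHS]ger0_norm ?addr_ge0// -sqrtr_sqr ler_wsqrtr//.
rewrite -(real_normK (num_real x)) -(real_normK (num_real y)).
by have := mulr_ge0 (normr_ge0 x) (normr_ge0 y); nra.
Qed.

Lemma Re_le_cabs (z : R[i]) : `|complex.Re z| <= cabs z.
Proof. by case: z => x y /=; rewrite -sqrtr_sqr ler_wsqrtr// lerDl sqr_ge0. Qed.

Lemma Im_le_cabs (z : R[i]) : `|complex.Im z| <= cabs z.
Proof. by case: z => x y /=; rewrite -sqrtr_sqr ler_wsqrtr// lerDr sqr_ge0. Qed.

Lemma cabs_sum (I : Type) (s : seq I) (Q : pred I) (z : I -> R[i]) :
  cabs (\sum_(i <- s | Q i) z i) <= \sum_(i <- s | Q i) cabs (z i).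
Proof.
elim: s => [|i s IHs]; first by rewrite !big_nil Normc.normc0.
rewrite !big_cons; case: ifP => // _.
by apply: le_trans (le_normcD _ _) _; rewrite lerD2l.
Qed.

Lemma cabs_conj (z : R[i]) : cabs z^* = cabs z.
Proof. by case: z => x y /=; rewrite sqrrN. Qed.

Lemma cabs_real (x : R) : cabs x%:C = `|x|.
Proof. by rewrite /= expr0n addr0 sqrtr_sqr. Qed.

End Complex.

Section Transfer.
Local Open Scope complex_scope.
Context {R : realType} (a : nat -> R) (M C0 : R).
Let b n := a n / n%:R.
Hypothesis kern_bound : forall k n, `|kern b k n| <= M / 2 ^+ k.
Hypothesis correlation : correlation_decay b C0 (decay ^+ 8).

Section Fixed.
Context (f g : int -> R[i]) (o : int) (K : nat) (r : R).
Hypothesis r_itv : 1 < r < 2.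
Hypothesis f_supp : forall x, f x != 0 -> o <= x < o + (2 ^ K)%:Z.
Hypothesis g_supp : forall x, g x != 0 -> o <= x < o + (2 ^ K)%:Z.

Let supform := ereal_sup [set sparse_form S 1 r f g | S in sparse R].
Let gn u := cabs (g (pt o u)).

(* The supremum of the sparse forms could be infinite, hence the finite [L]
   below it. *)
Definition dominated (N : nat -> nat) (c : R) (F : nat -> R) := exists L : R,
  [/\ 0 <= L, (L%:E <= supform)%E &
   \sum_(u < 2 ^ K) gn u * `|\sum_(y < u | (N u <= u - y)%N) b (u - y)%N * F y| <= c * L].

Let unit_const : R := 3 * (local_const M C0 / (r - 1)).

Let unit_const_ge0 : 0 <= unit_const.
Proof.
case/andP: r_itv => r1 _; rewrite mulr_ge0 ?divr_ge0 ?(local_const_ge0 kern_bound correlation)//.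
by rewrite subr_ge0 ltW.
Qed.

Lemma dominated_nonneg N fn : (forall u, 0 <= fn u <= cabs (f (pt o u))) ->
  dominated N unit_const fn.
Proof.
move=> fn_le; have fn0 u : 0 <= fn u by case/andP: (fn_le u).
have g0 u : 0 <= gn u by exact: cabs_ge0.
have [cs [cs1 cs2]] := selection fn0 g0 r_itv kern_bound correlation N K 0.
pose L := \sum_(c <- cs) sparse_term o f g r c.
exists L; split.
- by apply: sumr_ge0 => c _; exact: sparse_term_ge0.
- apply: (@sparse_family_form R o f g r r_itv fn cs fn0) => u.
  by apply: leq_trans (cs1 u) _; case: (_ == _).
have -> : \sum_(u < 2 ^ K) gn u * `|\sum_(y < u | (N u <= u - y)%N) b (u - y)%N * fn y| =
    \sum_(x < 1 * 2 ^ K | (x %/ 2 ^ K == 0)%N) gn x * scale_sum fn b N K x.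
  rewrite mul1n [RHS]big_mkcond; apply: eq_bigr => u _.
  rewrite divn_small// eqxx; congr (_ * `|_|); apply: eq_bigl => y; symmetry.
  (* Both points lie in one cell of length [2 ^ K], so the cap [K] on the scales excludes
     nothing. *)
  apply: andb_idr => _; have [->|d_gt0] := posnP (u - y)%N; first by rewrite trunc_log0.
  rewrite -ltnS -(ltn_exp2l _ _ (isT : 1 < 2)%N) (leq_ltn_trans (trunc_logP _ d_gt0))//.
  by rewrite (leq_ltn_trans (leq_subr _ _))// (ltn_trans (ltn_ord u))// ltn_exp2l.
apply: le_trans cs2 _; rewrite /unit_const [leRHS]mulrAC [leRHS]mulrC ler_wpM2l//.
  by rewrite divr_ge0 ?(local_const_ge0 kern_bound correlation)//; case/andP: r_itv => *; lra.
by rewrite /L mulr_sumr; apply: ler_sum => c _; exact: sparse_term_ge.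
Qed.

(** The two functions come with different sparse families; the larger of the two values below the
    supremum serves both. *)
Lemma dominated_add N (c1 c2 : R) (F1 F2 F : nat -> R) : 0 <= c1 -> 0 <= c2 ->
  dominated N c1 F1 -> dominated N c2 F2 ->
  (forall u, `|\sum_(y < u | (N u <= u - y)%N) b (u - y)%N * F y| <=
     `|\sum_(y < u | (N u <= u - y)%N) b (u - y)%N * F1 y| +
     `|\sum_(y < u | (N u <= u - y)%N) b (u - y)%N * F2 y|) -> dominated N (c1 + c2) F.
Proof.
move=> c1_ge0 c2_ge0 [L1 [L1_ge0 L1_le H1]] [L2 [L2_ge0 L2_le H2]] HF.
exists (Num.max L1 L2); split; first by rewrite le_max L1_ge0.
  by case: (leP L1 L2).
apply: (@le_trans _ _ (c1 * L1 + c2 * L2)); last first.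
  by rewrite mulrDl lerD// ler_wpM2l// le_max lexx ?orbT.
apply: le_trans (lerD H1 H2); rewrite -big_split/=; apply: ler_sum => u _.
rewrite -mulrDr; apply: ler_wpM2l; [exact: cabs_ge0|exact: HF].
Qed.

Lemma dominated_real N F : (forall u, `|F u| <= cabs (f (pt o u))) ->
  dominated N (unit_const + unit_const) F.
Proof.
move=> F_le.
have pos : dominated N unit_const (fun u => Num.max (F u) 0).
  apply: dominated_nonneg => u; rewrite le_max lexx orbT /=.
  by rewrite ge_max cabs_ge0 andbT (le_trans (ler_norm _)).
have neg : dominated N unit_const (fun u => Num.max (- F u) 0).
  apply: dominated_nonneg => u; rewrite le_max lexx orbT /=.
  by rewrite ge_max cabs_ge0 andbT (le_trans (ler_norm _))// normrN.
apply: dominated_add pos neg _ => // u.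
rewrite -[X in _ <= _ + X]normrN; apply: le_trans (ler_normD _ _).
rewrite -sumrN -big_split/= le_eqVlt; apply/orP; left; apply/eqP; congr `|_|.
apply: eq_bigr => y _; rewrite -mulrN -mulrDr; congr (_ * _).
by rewrite /=; case: (leP (F y) 0); case: (leP (- F y) 0); lra.
Qed.

Let csum N u := \sum_(y < u | (N u <= u - y)%N) (b (u - y)%N)%:C * f (pt o y).

Lemma dominated_complex N : exists L : R, [/\ 0 <= L, (L%:E <= supform)%E &
  \sum_(u < 2 ^ K) gn u * cabs (csum N u) <= 4 * unit_const * L].
Proof.
have [L1 [L1_ge0 L1_le H1]] := dominated_real N (fun u => Re_le_cabs (f (pt o u))).
have [L2 [L2_ge0 L2_le H2]] := dominated_real N (fun u => Im_le_cabs (f (pt o u))).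
exists (Num.max L1 L2); split; first by rewrite le_max L1_ge0.
  by case: (leP L1 L2).
have -> : 4 * unit_const * Num.max L1 L2 = (unit_const + unit_const) * Num.max L1 L2 +
   (unit_const + unit_const) * Num.max L1 L2 by ring.
have uu : 0 <= unit_const + unit_const by rewrite addr_ge0.
apply: (@le_trans _ _ ((unit_const + unit_const) * L1 + (unit_const + unit_const) * L2)); last first.
  by rewrite lerD// ler_wpM2l// le_max lexx ?orbT.
apply: le_trans (lerD H1 H2); rewrite -big_split/=; apply: ler_sum => u _.
rewrite -mulrDr; apply: ler_wpM2l; first exact: cabs_ge0.
rewrite /csum complex_sum; exact: cabs_le_Re_Im.
Qed.

(** As [f] vanishes to the left of [o], the partial sums are constant from [n = u] on; then
    [y = u - n], and [1 <= n0] excludes [y = u]. *)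
Lemma tail_sum (n0 u : nat) : (1 <= n0)%N ->
  \big[+%R/0]_(n0 <= n <oo) ((a n / n%:R)%:C * f (pt o u - n%:Z) : R[i]^o) =
  \sum_(y < u | (n0 <= u - y)%N) (b (u - y)%N)%:C * f (pt o y).
Proof.
move=> n0_gt0.
pose E n := (a n / n%:R)%:C * f (pt o u - n%:Z).
have E0 n : (u < n)%N -> E n = 0.
  move=> un; rewrite /E (_ : f _ = 0) ?mulr0//; apply/eqP; apply: contraT => /f_supp.
  by rewrite /pt; lia.
have finite_part : \sum_(y < u | (n0 <= u - y)%N) (b (u - y)%N)%:C * f (pt o y) =
    \sum_(n0 <= n < u.+1) E n.
  transitivity (\sum_(0 <= n < u.+1 | (n0 <= n)%N) E n).
    rewrite big_nat_rev/= add0n big_mkord [RHS]big_mkcond big_ord_recr/= subSS subnn.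
    rewrite [(n0 <= 0)%N]leqNgt n0_gt0 /= addr0 -big_mkcond/=.
    apply: eq_big => y; first by rewrite subSS.
    move=> _; rewrite subSS /E /b; congr (_ * f _).
    have yu := ltn_ord y; rewrite /pt; lia.
  have [le|lt] := leqP n0 u.+1; last first.
    rewrite [RHS]big_geq ?(ltnW lt)// big_nat_cond big_pred0// => n.
    by apply/negbTE; rewrite negb_and -ltnNge; case: leqP => //=; lia.
  rewrite (big_cat_nat (n := n0))//= big_nat_cond big_pred0 ?add0r => [|n]; last first.
    by apply/negbTE; rewrite negb_and -ltnNge; case: leqP => //=; lia.
  by rewrite big_nat_cond [RHS]big_nat_cond; apply: eq_bigl => n; lia.
rewrite finite_part; apply: lim_near_cst => //.
exists u.+1 => // m /= um.
have [le|lt] := leqP n0 u.+1.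
  rewrite (big_cat_nat (n := u.+1))//= [X in _ + X]big_nat_cond [X in _ + X]big1 ?addr0// => n.
  by move=> /andP[/andP[un _] _]; rewrite -/(E n) E0.
rewrite [RHS]big_geq ?(ltnW lt)// big_nat_cond big1// => n /andP[/andP[n0n _] _].
by rewrite -/(E n) E0//; apply: leq_trans (ltnW lt) n0n.
Qed.

Let values u := [set cabs (\big[+%R/0]_(n0 <= n <oo)
   ((a n / n%:R)%:C * f (pt o u - n%:Z) : R[i]^o)) | n0 in [set n0 : nat | (1 <= n0)%N]].

Lemma values_bounded u : has_sup (values u).
Proof.
split; first by exists (cabs (\big[+%R/0]_(1 <= n <oo)
   ((a n / n%:R)%:C * f (pt o u - n%:Z) : R[i]^o))); exists 1%N.
exists (\sum_(y < u) cabs ((b (u - y)%N)%:C * f (pt o y))) => _ [n0 /= n0_gt0 <-].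
rewrite tail_sum//; apply: le_trans (cabs_sum _ _ _) _.
by rewrite [leLHS]big_mkcond/=; apply: ler_sum => y _; case: ifP => // _; exact: cabs_ge0.
Qed.

(** This linearises the maximal operator: a truncation reaching half of a positive supremum exists
    at each point, at the cost of a factor 2. *)
Lemma sup_attained u : exists n0, sup (values u) <= 2 * cabs
  (\sum_(y < u | (n0 <= u - y)%N) (b (u - y)%N)%:C * f (pt o y)).
Proof.
have [sup_gt0|sup_le0] := ltP 0 (sup (values u)); last first.
  by exists 0%N; apply: le_trans sup_le0 _; rewrite mulr_ge0// cabs_ge0.
have s2 : 0 < sup (values u) / 2 by rewrite divr_gt0.
have [_ [n0 /= n0_gt0 <-]] := sup_adherent s2 (values_bounded u).
rewrite tail_sum// => H; exists n0; lra.
Qed.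

Lemma sup_values_ge0 u : 0 <= sup (values u).
Proof.
apply: le_trans (cabs_ge0 (\big[+%R/0]_(1 <= n <oo)
   ((a n / n%:R)%:C * f (pt o u - n%:Z) : R[i]^o))) _.
by apply: ub_le_sup; [case: (values_bounded u)|exists 1%N].
Qed.

Lemma pairing_le : exists L : R, [/\ 0 <= L, (L%:E <= supform)%E &
  cabs (pairing (maximal_hilbert a f) g) <= 8 * unit_const * L].
Proof.
have /choice[N NP] := sup_attained.
have [L [L_ge0 L_le H]] := dominated_complex N.
exists L; split=> //.
have -> : pairing (maximal_hilbert a f) g =
    \sum_(u < 2 ^ K) maximal_hilbert a f (pt o u) * (g (pt o u))^*.
  rewrite /pairing (fsbigE [seq pt o u | u <- iota 0 (2 ^ K)]).
  - rewrite big_map -[RHS](big_mkord xpredT (fun u => maximal_hilbert a f (pt o u) * (g (pt o u))^*)).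
    by rewrite /index_iota subn0; apply: eq_bigl => u; exact: in_setT.
  - by rewrite map_inj_uniq ?iota_uniq// => u v /addrI [].
  - by [].
  move=> x _ x_out; have [->|/g_supp gx] := eqVneq (g x) 0; first by rewrite rmorph0 mulr0.
  case/negP: x_out; apply/mapP; exists `|x - o|%N; last by rewrite /pt; lia.
  by rewrite mem_iota /= add0n; lia.
apply: le_trans (cabs_sum _ _ _) _.
have -> : 8 * unit_const * L = 2 * (4 * unit_const * L) by ring.
apply: le_trans (ler_wpM2l _ H) => //; rewrite mulr_sumr; apply: ler_sum => u _.
rewrite Normc.normcM cabs_conj cabs_real ger0_norm; last exact: sup_values_ge0.
rewrite mulrCA mulrC; apply: ler_wpM2l; first exact: cabs_ge0.
exact: NP.
Qed.

End Fixed.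

Lemma finitely_supported_bounded (f : int -> R[i]) : finitely_supported f ->
  exists n : nat, forall x, f x != 0 -> (`|x| <= n)%N.
Proof.
move=> /finite_seqP[s sE]; exists (\sum_(x <- s) `|x|)%N => x fx.
have : [set x | f x != 0] x by [].
rewrite sE /= => xs; rewrite (big_rem x)//=; exact: leq_addr.
Qed.

Lemma sparse_norm_le (r : R) : 1 < r < 2 ->
  (sparse_norm (maximal_hilbert a) 1 r <= (24 * local_const M C0 / (r - 1))%:E)%E.
Proof.
move=> r_itv; have [r1 r2] := andP r_itv.
apply: ereal_inf_lbound; exists (24 * local_const M C0 / (r - 1)) => // f g f_fin g_fin.
have [n1 n1P] := finitely_supported_bounded f_fin.
have [n2 n2P] := finitely_supported_bounded g_fin.
pose n := (n1 + n2)%N; pose K := (n + n).+1.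
have nK : (n + n < 2 ^ K)%N by rewrite (leq_trans (ltn_expl (n + n) (isT : 1 < 2)%N))// leq_exp2l.
have supp (h : int -> R[i]) n' : (n' <= n)%N -> (forall x, h x != 0 -> (`|x| <= n')%N) ->
    forall x, h x != 0 -> - n%:Z <= x < - n%:Z + (2 ^ K)%:Z.
  by move=> n'n hP x /hP xn'; move: nK; set q := (2 ^ K)%N; lia.
have [L [L_ge0 L_le H]] := pairing_le r_itv (supp f n1 (leq_addr _ _) n1P) (supp g n2 (leq_addl _ _) n2P).
have E : 24 * local_const M C0 / (r - 1) = 8 * (3 * (local_const M C0 / (r - 1))) by ring.
rewrite E; apply: (@le_trans _ _ (8 * (3 * (local_const M C0 / (r - 1))) * L)%:E).
  by rewrite lee_fin.
rewrite EFinM lee_wpmul2l// lee_fin !mulr_ge0//.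
  exact: (local_const_ge0 kern_bound correlation).
by rewrite invr_ge0; lra.
Qed.

End Transfer.

Theorem theorem1p9 (R : realType) (d : measure_display)
    (Omega : measurableType d) (P : probability Omega R)
    (X : nat -> {RV P >-> R})
    (X_bounded : exists M : R, forall n : nat, (1 <= n)%N ->
       {ae P, forall w, `|X n w| <= M})
    (X_indep : mutually_independent [set n : nat | (1 <= n)%N] X)
    (X_mean0 : forall n : nat, (1 <= n)%N -> ('E_P[X n] = 0)%E) :
  {ae P, forall w, exists C : R, forall r : R, 1 < r < 2 ->
    (sparse_norm (maximal_hilbert (fun n => X n w)) 1 r
       <= (C / (r - 1))%:E)%E}.
Proof.
have [M0 M0P] := X_bounded.
pose M := `|M0| + 1.
have M_gt0 : 0 < M by rewrite ltr_wpDl.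
have X_le n : (1 <= n)%N -> {ae P, forall w, `|X n w| <= M}.
  move=> /M0P; apply: filterS => w; move=> /le_trans; apply.
  by rewrite (le_trans (ler_norm _))// lerDl.
have decay_large : 3 / 2 <= 2 * (@decay R ^+ 8) ^+ 2.
  rewrite /decay !exprSr !expr0; lra.
have decay_itv : 0 < @decay R ^+ 8 <= 1.
  by rewrite exprn_gt0 ?exprn_ile1 /decay; lra.
have := ae_correlation M_gt0 X_le X_indep X_mean0 decay_itv decay_large.
apply: filterS => w [C0 [kern_bound correlation]].
(* [local_const] is free of [r], which makes the constant uniform. Here [24 = 2 * 4 * 3]: half the
   supremum, four nonnegative parts of [f], and the passage from cells to intervals. *)
exists (24 * local_const M C0) => r r_itv.
exact: sparse_norm_le.
Qed.
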